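(* Let $q\in\mathbb C$ with $0<|q|<1$, and let $a,b,z\in\mathbb C\setminus\{0\}$ with $|a|<1$, $|z|<1$, such that no denominator below vanishes. Fix square roots $\sqrt q,\sqrt a,\sqrt b$ and compute all square roots below consistently from them. Then $${}_3\phi_2\left(\begin{matrix}ab,\;\sqrt q\,a,\;q\sqrt{ab}\\ \sqrt q\,b,\;\sqrt{ab}\end{matrix};q,z\right)$$ $$=\frac{(a^2z^2,-\sqrt{q^3a^3b}\,z;q)_\infty}{(qa^2z^2,-\sqrt{a/(qb)}\,z;q)_\infty}\;{}_4\phi_3\left(\begin{matrix}q\sqrt{ab},\;\sqrt{qab},\;-\sqrt{qab},\;-\sqrt{qb/a}\\ \sqrt q\,b,\;-\sqrt{q^3a^3b}\,z,\;-\sqrt{q^3b/a}\,z^{-1}\end{matrix};q,q\right)$$ $$\quad+\frac{(qab,\;\sqrt q\,az,\;-\sqrt{qb/a},\;-\sqrt{ab}\,z;q)_\infty}{(\sqrt q\,b,\;-q\sqrt{ab},\;z,\;-\sqrt{qb/a}\,z^{-1};q)_\infty}\;{}_4\phi_3\left(\begin{matrix}z,\;az,\;-az,\;-\sqrt q\,az\\ qa^2z^2,\;-\sqrt{qa/b}\,z,\;-\sqrt{ab}\,z\end{matrix};q,q\right)$$ $$=\frac{(a^2z^2,\;q\sqrt{ab}\,z,\;-\sqrt{qab}\,z,\;q\sqrt{a^3b}\,z,\;-\sqrt{q^3a^3b}\,z;q)_\infty}{(qa^2z^2,\;z,\;az,\;-\sqrt q\,az,\;-\sqrt{q^3}\,abz;q)_\infty}$$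 $$\quad\times{}_8W_7\left(-\sqrt q\,abz;\;q\sqrt{ab},\;-\sqrt{qab},\;\sqrt{b/a},\;-\sqrt{qb/a},\;-qaz;\;q,\;-az\right).$$
   Context: Square roots: $\sqrt{ab}:=\sqrt a\sqrt b$, $\sqrt{qab}:=\sqrt q\sqrt a\sqrt b$, $\sqrt{b/a}:=\sqrt b/\sqrt a$, $\sqrt{qb/a}:=\sqrt q\sqrt b/\sqrt a$, $\sqrt{q^3b/a}:=q\sqrt q\sqrt b/\sqrt a$, $\sqrt{a/(qb)}:=\sqrt a/(\sqrt q\sqrt b)$, $\sqrt{qa/b}:=\sqrt q\sqrt a/\sqrt b$, $\sqrt{a^3b}:=a\sqrt a\sqrt b$, $\sqrt{q^3a^3b}:=q\sqrt q\,a\sqrt a\sqrt b$, $\sqrt{q^3}:=q\sqrt q$. Notation: $(a;q)_n:=\prod_{k=0}^{n-1}(1-aq^k)$, $(a;q)_\infty:=\prod_{k\ge0}(1-aq^k)$, $(a_1,\dots,a_r;q)_n:=\prod_i(a_i;q)_n$ (also for $n=\infty$); ${}_{r+1}\phi_r\left(\begin{matrix}a_1,\dots,a_{r+1}\\ b_1,\dots,b_r\end{matrix};q,u\right):=\sum_{k\ge0}\frac{(a_1,\dots,a_{r+1};q)_k}{(q,b_1,\dots,b_r;q)_k}u^k$; ${}_8W_7(a;a_1,\dots,a_5;q,u):=\sum_{k\ge0}\frac{1-aq^{2k}}{1-a}\frac{(a,a_1,\dots,a_5;q)_k}{(q,qa/a_1,\dots,qa/a_5;q)_k}u^k$. *)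

(* Defs.v *)
From Stdlib Require Export Reals List.
From Coquelicot Require Export Coquelicot.
Export ListNotations.

Open Scope C_scope.

(* Sum of a complex series, in the style of Coquelicot's [RInt]: a total
   function, meaningful when the series converges. *)
Definition CSeries (u : nat -> C) : C :=
  iota (fun s : C_CompleteNormedModule =>
          @is_series C_AbsRing C_NormedModule u s).

Lemma CSeries_unique (u : nat -> C) (s : C) :
  @is_series C_AbsRing C_NormedModule u s -> CSeries u = s.
Proof.
intro H. unfold CSeries, is_series.
apply (iota_filterlim_locally (V := C_CompleteNormedModule)). exact H.
Qed.

(* (a;q)_n *)
Fixpoint qpoch (a q : C) (n : nat) : C :=
  match n with
  | O => 1
  | S m => qpoch a q m * (1 - a * q ^ m)
  end.

(* (a;q)_oo, the limit of the partial products; it exists for |q| < 1. *)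
Definition qpoch_inf (a q : C) : C :=
  iota (fun p : C_CompleteNormedModule =>
          filterlim (qpoch a q) eventually (locally p)).

Lemma qpoch_inf_unique (a q p : C) :
  filterlim (qpoch a q) eventually (locally p) -> qpoch_inf a q = p.
Proof.
intro H. unfold qpoch_inf.
apply (iota_filterlim_locally (V := C_CompleteNormedModule)). exact H.
Qed.

(* (a_1,...,a_r;q)_n and (a_1,...,a_r;q)_oo *)
Definition qpochs (l : list C) (q : C) (n : nat) : C :=
  fold_right (fun a p => qpoch a q n * p) 1 l.

Definition qpochs_inf (l : list C) (q : C) : C :=
  fold_right (fun a p => qpoch_inf a q * p) 1 l.

(* The basic hypergeometric series _{r+1}phi_r, to be used with
   length num = S (length den) only: the sign and power-of-q factor of a
   general _r phi_s is not included. *)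
Definition phi (num den : list C) (q u : C) : C :=
  CSeries (fun k => qpochs num q k / qpochs (q :: den) q k * u ^ k).

Definition phi_denominators_nonzero (den : list C) (q : C) : Prop :=
  forall k, qpochs (q :: den) q k <> 0.

(* The parameters of the very-well-poised series _8W_7(a; a1,...,a5; q, u)
   that occur in the denominators (q, qa/a1, ..., qa/a5; q)_k. *)
Definition W87_den (a a1 a2 a3 a4 a5 q : C) : list C :=
  [q; q * a / a1; q * a / a2; q * a / a3; q * a / a4; q * a / a5].

Definition W87 (a a1 a2 a3 a4 a5 q u : C) : C :=
  CSeries (fun k =>
    (1 - a * q ^ (2 * k)) / (1 - a)
    * (qpochs [a; a1; a2; a3; a4; a5] q k
       / qpochs (W87_den a a1 a2 a3 a4 a5 q) q k)
    * u ^ k).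

Definition W87_denominators_nonzero (a a1 a2 a3 a4 a5 q : C) : Prop :=
  1 - a <> 0 /\ forall k, qpochs (W87_den a a1 a2 a3 a4 a5 q) q k <> 0.

(* Main.v *)
Require Import Defs.
From Stdlib Require Import Lra Lia FunctionalExtensionality.

(* Let y = - sqrt(a/(qb)) z and G = - sqrt(qb/a), so that z = G y.  Up to an elementary factor,
   the pair of 4phi3 series is the q-integral over [y, 1] of
     Phi(t) = (qt, qt/y, sqrt(q) b t, q^2 ab y t)_oo
              / (q sqrt(ab) t, sqrt(qab) t, - sqrt(qab) t, G t)_oo,
   that is, a sum over the lattices q^N and y q^N.  A nonterminating 6phi5 sum with one
   numerator parameter 1/t expands part of Phi into a series in k whose k-th term contains
   (1/t;q)_k; this series terminates on q^N and converges on y q^N, because its ratio there is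
   z or -az.  Then the sum over k can be interchanged with the q-integral.

   Expanding (sqrt(q) b t, q^2 ab y t)_oo / (sqrt(qab) t)_oo leaves inner q-integrals which the
   nonterminating q-Saalschutz formula evaluates; the outer sum is the 8W7.

   Expanding (sqrt(q) b t)_oo / (G t)_oo leaves inner q-integrals I_k with denominator
   (qab t^2)_oo.  They satisfy a second-order recurrence with characteristic roots y and
   1/(qab y), and grow no faster than y^k, whence I_k = y^k I_0; the limit of y^(-k) I_k gives
   I_0, and the outer sum is the 3phi2.

   The 6phi5 and q-Saalschutz sums follow by telescoping from first-order recurrences. *)

Open Scope C_scope.

(** * Limits and geometrically dominated series in C *)

(** The interchange of sums shapes the proof. A 6phi5 of argument d t converges for |d t| < 1, but
    points of q^N near 1 need not satisfy this, since d is sqrt(qab) or -sqrt(qb/a); there the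
    series has to terminate instead. The 6phi5 sum is therefore proved in a finite form on q^N and
    in an infinite form on y q^N, from one certificate. Dividing t^k (1/t;q)_k by y^k makes the two
    cases uniform: the quotient is bounded over k and over either lattice, and the remaining factor
    (d y)^k is z^k or (-az)^k. With the weight q^j this gives a single geometric bound in j and k.
    Numerator products may vanish, as only zero denominators are excluded. Identities are therefore
    kept multiplied out, and quotients of infinite products that could become 0/0 are written as
    finite products. The constant in each first-order recurrence is fixed at a point where the sum
    terminates. *)

Definition Clim (u : nat -> C) (l : C) : Prop :=
  is_lim_seq (fun n => Cmod (u n - l)) 0.

(** The index type is arbitrary so that uniformity in two indices is boundedness over
    [nat * nat]. *)
Definition bounded {I : Type} (f : I -> C) : Prop :=
  exists M : R, forall i, (Cmod (f i) <= M)%R.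

(** [Clim] speaks of moduli so that estimates become estimates on real sequences; this is its link
    to the filters in [CSeries] and [qpoch_inf]. *)
Lemma Clim_filterlim (u : nat -> C) (l : C) :
  Clim u l <-> filterlim u eventually (locally (T := C_UniformSpace) l).
Proof.
split; intro H.
- apply (proj2 (filterlim_locally (U := C_UniformSpace) u l)).
  intro eps.
  assert (He := cond_pos eps).
  apply is_lim_seq_spec in H. destruct (H eps) as [N HN].
  exists N. intros n Hn. specialize (HN n Hn).
  rewrite Rminus_0_r, Rabs_pos_eq in HN by apply Cmod_ge_0.
  assert (Hm := Rmax_Cmod (u n - l)).
  split; unfold ball; simpl; unfold AbsRing_ball, minus, plus, opp, abs; simpl.
  + apply Rle_lt_trans with (2 := HN). apply Rle_trans with (2 := Hm).
    apply (Rmax_l (Rabs (fst (u n - l)))).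
  + apply Rle_lt_trans with (2 := HN). apply Rle_trans with (2 := Hm).
    apply (Rmax_r _ (Rabs (snd (u n - l)))).
- apply is_lim_seq_spec. intro eps.
  (* Balls here are coordinatewise and [Cmod_2Rmax] costs a factor sqrt 2 < 2, hence the radius eps
     / 2. *)
  assert (Hd : (0 < eps / 2)%R) by (assert (H0 := cond_pos eps); lra).
  destruct (proj1 (filterlim_locally (U := C_UniformSpace) u l) H (mkposreal _ Hd))
    as [N HN].
  exists N. intros n Hn. specialize (HN n Hn).
  rewrite Rminus_0_r, Rabs_pos_eq by apply Cmod_ge_0.
  destruct HN as [H1 H2].
  unfold ball in H1, H2; simpl in H1, H2.
  unfold AbsRing_ball, minus, plus, opp, abs in H1, H2; simpl in H1, H2.
  apply Rle_lt_trans with (1 := Cmod_2Rmax _).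
  assert (Hs : (sqrt 2 < 2)%R).
  { rewrite <- (sqrt_Rsqr 2) at 2 by lra. apply sqrt_lt_1; unfold Rsqr; lra. }
  assert (Hs0 : (0 < sqrt 2)%R) by (apply sqrt_lt_R0; lra).
  assert (Hm : (Rmax (Rabs (fst (u n - l)%C)) (Rabs (snd (u n - l)%C)) < eps / 2)%R)
    by (apply Rmax_lub_lt; assumption).
  assert (H0 : (0 <= Rmax (Rabs (fst (u n - l)%C)) (Rabs (snd (u n - l)%C)))%R).
  { apply Rle_trans with (1 := Rabs_pos (fst (u n - l)%C)). apply Rmax_l. }
  nra.
Qed.

Lemma Clim_le (u : nat -> C) (l : C) (e : nat -> R) :
  (forall n, (Cmod (u n - l) <= e n)%R) -> is_lim_seq e 0 -> Clim u l.
Proof.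
intros H He.
apply is_lim_seq_le_le with (u := fun _ => 0%R) (w := e); auto.
- intro n. split; [apply Cmod_ge_0 | apply H].
- apply is_lim_seq_const.
Qed.

Lemma Clim_const (c : C) : Clim (fun _ => c) c.
Proof.
apply Clim_le with (fun _ => 0%R); [|apply is_lim_seq_const].
intro n. replace (c - c) with (RtoC 0) by ring. rewrite Cmod_0. lra.
Qed.

Lemma Clim_ext (u v : nat -> C) (l : C) :
  (forall n, u n = v n) -> Clim u l -> Clim v l.
Proof. intro H. apply is_lim_seq_ext. intro n. now rewrite H. Qed.

Lemma Clim_eq (u : nat -> C) (a b : C) : Clim u a -> a = b -> Clim u b.
Proof. intros H E. now rewrite <- E. Qed.

Lemma is_lim_seq_0_mult (e : nat -> R) (M : R) :
  is_lim_seq e 0 -> is_lim_seq (fun n => (e n * M)%R) 0.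
Proof.
intro H. replace (Finite 0) with (Finite (0 * M)) by (f_equal; ring).
apply is_lim_seq_mult'; [exact H|apply is_lim_seq_const].
Qed.

Lemma Clim_plus (u v : nat -> C) (a b : C) :
  Clim u a -> Clim v b -> Clim (fun n => u n + v n) (a + b).
Proof.
intros Hu Hv. apply Clim_le with (fun n => (Cmod (u n - a) + Cmod (v n - b))%R).
- intro n. replace (u n + v n - (a + b)) with ((u n - a) + (v n - b)) by ring.
  apply Cmod_triangle.
- replace (Finite 0) with (Finite (0 + 0)) by (f_equal; ring).
  apply is_lim_seq_plus'; assumption.
Qed.

Lemma Clim_scal (c : C) (u : nat -> C) (a : C) :
  Clim u a -> Clim (fun n => c * u n) (c * a).
Proof.
intro Hu. apply Clim_le with (fun n => (Cmod c * Cmod (u n - a))%R).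
- intro n. replace (c * u n - c * a) with (c * (u n - a)) by ring.
  rewrite Cmod_mult. lra.
- apply is_lim_seq_ext with (fun n => (Cmod (u n - a) * Cmod c)%R); [intro; ring|].
  now apply is_lim_seq_0_mult.
Qed.

Lemma Clim_minus (u v : nat -> C) (a b : C) :
  Clim u a -> Clim v b -> Clim (fun n => u n - v n) (a - b).
Proof.
intros Hu Hv. apply Clim_ext with (fun n => u n + (- (1)) * v n).
- intro n. ring.
- replace (a - b) with (a + (- (1)) * b) by ring.
  apply Clim_plus; [assumption|]. now apply Clim_scal.
Qed.

Lemma bounded_Clim (u : nat -> C) (a : C) : Clim u a -> bounded u.
Proof.
intro H.
assert (Hb : exists M, forall n, (Rabs (Cmod (u n - a)) <= M)%R).
{ destruct (filterlim_bounded (K := R_AbsRing) (V := R_NormedModule)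
    (fun n => Cmod (u n - a))) as [M HM].
  - exists 0%R. exact H.
  - exists M. exact HM. }
destruct Hb as [M HM]. exists (M + Cmod a)%R. intro n.
replace (u n) with ((u n - a) + a) by ring.
apply Rle_trans with (1 := Cmod_triangle _ _).
specialize (HM n). rewrite Rabs_pos_eq in HM by apply Cmod_ge_0. lra.
Qed.

Lemma Clim_mult_bounded (u v : nat -> C) :
  Clim u 0 -> bounded v -> Clim (fun n => u n * v n) 0.
Proof.
intros Hu [M HM]. apply Clim_le with (fun n => (Cmod (u n - 0) * M)%R).
- intro n. replace (u n * v n - 0) with ((u n - 0) * v n) by ring.
  rewrite Cmod_mult. apply Rmult_le_compat_l; [apply Cmod_ge_0|apply HM].
- now apply is_lim_seq_0_mult.
Qed.

Lemma Clim_mult (u v : nat -> C) (a b : C) :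
  Clim u a -> Clim v b -> Clim (fun n => u n * v n) (a * b).
Proof.
intros Hu Hv.
apply Clim_ext with (fun n => (u n - a) * v n + a * v n).
- intro n. ring.
- replace (a * b) with (0 + a * b) by ring. apply Clim_plus.
  + apply Clim_mult_bounded; [|now apply bounded_Clim with b].
    replace (RtoC 0) with (a - a) by ring. apply Clim_minus; [assumption|apply Clim_const].
  + now apply Clim_scal.
Qed.

Ltac clim_mult :=
  repeat lazymatch goal with
  | |- Clim (fun n => Cmult (@?f n) (@?g n)) _ => apply (Clim_mult f g)
  end.

Lemma Clim_unique (u : nat -> C) (a b : C) : Clim u a -> Clim u b -> a = b.
Proof.
intros Ha Hb.
assert (H : Clim (fun n => u n - u n) (a - b)) by now apply Clim_minus.
assert (H0 : is_lim_seq (fun _ => Cmod (a - b)) 0).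
{ apply is_lim_seq_ext with (2 := H). intro n. rewrite <- Cmod_opp. f_equal. ring. }
assert (H1 := is_lim_seq_unique _ _ H0). rewrite Lim_seq_const in H1.
injection H1 as H1. apply Cmod_eq_0 in H1.
replace a with ((a - b) + b) by ring. rewrite H1. ring.
Qed.

Lemma Clim_shift (u : nat -> C) (l : C) (m : nat) :
  Clim u l -> Clim (fun n => u (n + m)%nat) l.
Proof. intro H. apply (is_lim_seq_incr_n (fun n => Cmod (u n - l)) m). exact H. Qed.

Lemma Clim_unshift (u : nat -> C) (l : C) :
  Clim (fun n => u (S n)) l -> Clim u l.
Proof. intro H. apply (is_lim_seq_incr_1 (fun n => Cmod (u n - l))). exact H. Qed.

Lemma Clim_inv (u : nat -> C) (l : C) :
  l <> 0 -> Clim u l -> Clim (fun n => / u n) (/ l).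
Proof.
intros Hl Hu.
assert (Hp : (0 < Cmod l)%R) by now apply Cmod_gt_0.
assert (He : Hierarchy.eventually (fun n => (Cmod (u n - l) < Cmod l / 2)%R)).
{ assert (Hu' := Hu). apply is_lim_seq_spec in Hu'.
  assert (Hd : (0 < Cmod l / 2)%R) by lra.
  destruct (Hu' (mkposreal _ Hd)) as [N HN]. exists N. intros n Hn.
  specialize (HN n Hn). simpl in HN.
  rewrite Rminus_0_r, Rabs_pos_eq in HN by apply Cmod_ge_0. exact HN. }
apply is_lim_seq_le_le_loc with (u := fun _ => 0%R)
  (w := fun n => (Cmod (u n - l) * (2 / (Cmod l * Cmod l)))%R).
- destruct He as [N HN]. exists N. intros n Hn. specialize (HN n Hn).
  split; [apply Cmod_ge_0|].
  assert (H1 : (Cmod l / 2 < Cmod (u n))%R).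
  { assert (H := Cmod_triangle (- (u n - l)) (u n)).
    replace (- (u n - l) + u n) with l in H by ring. rewrite Cmod_opp in H. lra. }
  assert (Hun : u n <> 0) by (apply Cmod_gt_0; lra).
  replace (/ u n - / l) with (- (u n - l) * / (u n * l)) by (field; auto).
  rewrite Cmod_mult, Cmod_opp. apply Rmult_le_compat_l; [apply Cmod_ge_0|].
  rewrite Cmod_inv by (now apply Cmult_neq_0). rewrite Cmod_mult.
  replace (2 / (Cmod l * Cmod l))%R with (/ (Cmod l / 2 * Cmod l))%R by (field; lra).
  apply Rinv_le_contravar; nra.
- apply is_lim_seq_const.
- now apply is_lim_seq_0_mult.
Qed.

Lemma Clim_geom (x : C) : (Cmod x < 1)%R -> Clim (fun n => x ^ n) 0.
Proof.
intro Hx. apply Clim_le with (fun n => (Cmod x ^ n)%R).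
- intro n. replace (x ^ n - 0) with (x ^ n) by ring. rewrite Cmod_pow. lra.
- apply is_lim_seq_geom. rewrite Rabs_pos_eq by apply Cmod_ge_0. exact Hx.
Qed.

Lemma bounded_mult {I : Type} (f g : I -> C) :
  bounded f -> bounded g -> bounded (fun i => f i * g i).
Proof.
intros [M HM] [N HN]. exists (M * N)%R. intro i. rewrite Cmod_mult.
apply Rmult_le_compat; auto using Cmod_ge_0.
Qed.

Lemma bounded_plus {I : Type} (f g : I -> C) :
  bounded f -> bounded g -> bounded (fun i => f i + g i).
Proof.
intros [M HM] [N HN]. exists (M + N)%R. intro i.
apply Rle_trans with (1 := Cmod_triangle _ _). apply Rplus_le_compat; auto.
Qed.

Lemma bounded_opp {I : Type} (f : I -> C) : bounded f -> bounded (fun i => - f i).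
Proof. intros [M HM]. exists M. intro i. now rewrite Cmod_opp. Qed.

Lemma bounded_minus {I : Type} (f g : I -> C) :
  bounded f -> bounded g -> bounded (fun i => f i - g i).
Proof. intros Hf Hg. now apply (bounded_plus f (fun i => - g i)); [|apply bounded_opp]. Qed.

Lemma bounded_const {I : Type} (c : C) : bounded (fun _ : I => c).
Proof. exists (Cmod c). intros; lra. Qed.

Lemma bounded_comp {I J : Type} (h : J -> I) (f : I -> C) :
  bounded f -> bounded (fun j => f (h j)).
Proof. intros [M HM]. exists M. auto. Qed.

Lemma bounded_ext {I : Type} (f g : I -> C) :
  (forall i, f i = g i) -> bounded f -> bounded g.
Proof. intros H [M HM]. exists M. intro i. now rewrite <- H. Qed.

Lemma bounded_pow {I : Type} (x : C) (h : I -> nat) :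
  (Cmod x <= 1)%R -> bounded (fun i => x ^ h i).
Proof.
intro Hx. exists 1%R. intro i. rewrite Cmod_pow.
rewrite <- (pow1 (h i)). apply pow_incr. split; [apply Cmod_ge_0|exact Hx].
Qed.

(** * Partial sums and series with a geometric majorant *)

Fixpoint csum (u : nat -> C) (n : nat) : C :=
  match n with O => 0 | S m => csum u m + u m end.

Lemma csum_sum_n (u : nat -> C) (n : nat) :
  sum_n (G := C_AbelianMonoid) u n = csum u (S n).
Proof.
induction n as [|n IH].
- rewrite sum_O. simpl. ring.
- rewrite sum_Sn, IH. reflexivity.
Qed.

Lemma csum_ext (u v : nat -> C) (n : nat) :
  (forall k, (k < n)%nat -> u k = v k) -> csum u n = csum v n.
Proof.
induction n as [|n IH]; intro H; [reflexivity|]. simpl.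
rewrite IH by (intros; apply H; lia). now rewrite H by lia.
Qed.

Lemma csum_scal (c : C) (u : nat -> C) (n : nat) :
  csum (fun k => c * u k) n = c * csum u n.
Proof. induction n as [|n IH]; simpl; [ring|]. rewrite IH. ring. Qed.

Lemma csum_plus (u v : nat -> C) (n : nat) :
  csum (fun k => u k + v k) n = csum u n + csum v n.
Proof. induction n as [|n IH]; simpl; [ring|]. rewrite IH. ring. Qed.

Lemma csum_telescope (h : nat -> C) (n : nat) :
  csum (fun k => h k - h (S k)) n = h O - h n.
Proof. induction n as [|n IH]; simpl; [ring|]. rewrite IH. ring. Qed.

Lemma csum_const0 (n : nat) : csum (fun _ => 0) n = 0.
Proof. induction n as [|n IH]; simpl; [reflexivity|]. rewrite IH. ring. Qed.

Lemma CSeries_Clim (u : nat -> C) (s : C) : Clim (csum u) s -> CSeries u = s.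
Proof.
intro H. apply CSeries_unique. unfold is_series.
apply Clim_filterlim.
apply Clim_ext with (fun n => csum u (n + 1)%nat).
- intro n. rewrite Nat.add_1_r. symmetry. apply csum_sum_n.
- now apply Clim_shift.
Qed.

(** The convergence criterion of the proof: the terms are powers of a number of modulus below 1
    times a bounded factor, see [geo_bounded]. *)
Definition geo (u : nat -> C) : Prop :=
  exists M r : R, (0 <= r < 1)%R /\ forall n, (Cmod (u n) <= M * r ^ n)%R.

Lemma geo_bounded (r : C) (f : nat -> C) :
  (Cmod r < 1)%R -> bounded f -> geo (fun n => r ^ n * f n).
Proof.
intros Hr [M HM]. exists M, (Cmod r).
split; [split; [apply Cmod_ge_0|exact Hr]|].
intro n. rewrite Cmod_mult, Cmod_pow, Rmult_comm.
apply Rmult_le_compat_r; [apply pow_le, Cmod_ge_0|apply HM].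
Qed.

Lemma geo_ext (u v : nat -> C) : (forall n, u n = v n) -> geo u -> geo v.
Proof.
intros H [M [r [Hr HM]]]. exists M, r. split; [exact Hr|]. intro n. now rewrite <- H.
Qed.

Lemma geo_scal (c : C) (u : nat -> C) : geo u -> geo (fun n => c * u n).
Proof.
intros [M [r [Hr HM]]]. exists (Cmod c * M)%R, r. split; [exact Hr|].
intro n. rewrite Cmod_mult, Rmult_assoc. apply Rmult_le_compat_l; [apply Cmod_ge_0|auto].
Qed.

Lemma geo_plus (u v : nat -> C) : geo u -> geo v -> geo (fun n => u n + v n).
Proof.
intros [M [r [Hr HM]]] [N [s [Hs HN]]]. exists (M + N)%R, (Rmax r s). split.
- split; [apply Rle_trans with (2 := Rmax_l r s); lra|]. apply Rmax_lub_lt; lra.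
- intro n. apply Rle_trans with (1 := Cmod_triangle (u n) (v n)).
  assert (HM0 : (0 <= M)%R)
    by (specialize (HM O); simpl in HM; assert (H0 := Cmod_ge_0 (u O)); lra).
  assert (HN0 : (0 <= N)%R)
    by (specialize (HN O); simpl in HN; assert (H0 := Cmod_ge_0 (v O)); lra).
  assert (Hp1 : (r ^ n <= Rmax r s ^ n)%R) by (apply pow_incr; split; [lra|apply Rmax_l]).
  assert (Hp2 : (s ^ n <= Rmax r s ^ n)%R) by (apply pow_incr; split; [lra|apply Rmax_r]).
  specialize (HM n). specialize (HN n). nra.
Qed.

Lemma geo_minus (u v : nat -> C) : geo u -> geo v -> geo (fun n => u n - v n).
Proof.
intros Hu Hv. apply geo_ext with (fun n => u n + (- (1)) * v n); [intro; ring|].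
apply geo_plus; [exact Hu|now apply geo_scal].
Qed.

Lemma geo_Clim (u : nat -> C) : geo u -> Clim (csum u) (CSeries u).
Proof.
intros [M [r [Hr HM]]].
assert (Hex : ex_series (K := C_AbsRing) (V := C_CompleteNormedModule) u).
{ apply (ex_series_le (K := C_AbsRing) (V := C_CompleteNormedModule) u
           (fun n => (M * r ^ n)%R)).
  - exact HM.
  - apply (ex_series_scal (K := R_AbsRing) (V := R_NormedModule) M (fun n => (r ^ n)%R)).
    apply ex_series_geom. rewrite Rabs_pos_eq; lra. }
destruct Hex as [s Hs].
rewrite (CSeries_unique u s Hs).
apply Clim_unshift. apply Clim_filterlim.
eapply filterlim_ext; [intro n; apply csum_sum_n|]. exact Hs.
Qed.

Lemma csum_geo_le (u : nat -> C) (M r : R) (n : nat) :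
  (0 <= r < 1)%R -> (forall k, (Cmod (u k) <= M * r ^ k)%R) ->
  (Cmod (csum u n) <= M / (1 - r))%R.
Proof.
intros Hr H.
assert (HM : (0 <= M)%R).
{ specialize (H O). simpl in H. assert (H0 := Cmod_ge_0 (u O)). lra. }
apply Rle_trans with (M * (1 - r ^ n) / (1 - r))%R.
- induction n as [|n IH]; simpl.
  + rewrite Cmod_0. unfold Rdiv. rewrite Rminus_diag_eq, Rmult_0_r, Rmult_0_l by reflexivity. lra.
  + apply Rle_trans with (1 := Cmod_triangle _ _).
    apply Rle_trans with (M * (1 - r ^ n) / (1 - r) + M * r ^ n)%R.
    * apply Rplus_le_compat; auto.
    * right. field. lra.
- apply Rmult_le_compat_r; [left; apply Rinv_0_lt_compat; lra|].
  assert (H0 : (0 <= r ^ n)%R) by (apply pow_le; lra). nra.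
Qed.

Lemma Clim_Cmod_le (u : nat -> C) (l : C) (M : R) :
  Clim u l -> (forall n, (Cmod (u n) <= M)%R) -> (Cmod l <= M)%R.
Proof.
intros Hu H.
apply (is_lim_seq_le (fun n => Cmod l) (fun n => (Cmod (u n - l) + M)%R) (Cmod l) M).
- intro n. replace l with ((- (u n - l)) + u n) at 1 by ring.
  apply Rle_trans with (1 := Cmod_triangle _ _). rewrite Cmod_opp.
  specialize (H n). lra.
- apply is_lim_seq_const.
- replace (Finite M) with (Finite (0 + M)) by (f_equal; ring).
  apply is_lim_seq_plus'; [exact Hu|apply is_lim_seq_const].
Qed.

Lemma CSeries_geo_le (u : nat -> C) (M r : R) :
  (0 <= r < 1)%R -> (forall k, (Cmod (u k) <= M * r ^ k)%R) ->
  (Cmod (CSeries u) <= M / (1 - r))%R.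
Proof.
intros Hr H. apply Clim_Cmod_le with (csum u).
- apply geo_Clim. now exists M, r.
- intro n. now apply csum_geo_le.
Qed.

Lemma CSeries_ext (u v : nat -> C) : (forall n, u n = v n) -> CSeries u = CSeries v.
Proof.
intro H. f_equal. now apply functional_extensionality.
Qed.

Lemma CSeries_plus (u v : nat -> C) :
  geo u -> geo v -> CSeries (fun n => u n + v n) = CSeries u + CSeries v.
Proof.
intros Hu Hv. apply CSeries_Clim.
apply Clim_ext with (fun n => csum u n + csum v n).
- intro n. now rewrite csum_plus.
- now apply Clim_plus; apply geo_Clim.
Qed.

Lemma CSeries_scal (c : C) (u : nat -> C) :
  geo u -> CSeries (fun n => c * u n) = c * CSeries u.
Proof.
intros Hu. apply CSeries_Clim.
apply Clim_ext with (fun n => c * csum u n).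
- intro n. now rewrite csum_scal.
- now apply Clim_scal, geo_Clim.
Qed.

Lemma CSeries_minus (u v : nat -> C) :
  geo u -> geo v -> CSeries (fun n => u n - v n) = CSeries u - CSeries v.
Proof.
intros Hu Hv. apply CSeries_Clim.
apply Clim_ext with (fun n => csum u n - csum v n).
- intro n. replace (csum u n - csum v n) with (csum u n + (- (1)) * csum v n) by ring.
  rewrite <- csum_scal, <- csum_plus. apply csum_ext. intros. ring.
- now apply Clim_minus; apply geo_Clim.
Qed.

Lemma csum_split (u : nat -> C) (n m : nat) :
  csum u (m + n) = csum u n + csum (fun k => u (k + n)%nat) m.
Proof. induction m as [|m IH]; simpl; [ring|]. rewrite IH. ring. Qed.

Lemma geo_shift (u : nat -> C) (n : nat) : geo u -> geo (fun k => u (k + n)%nat).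
Proof.
intros [M [r [Hr HM]]]. exists (M * r ^ n)%R, r. split; [exact Hr|].
intro k. apply Rle_trans with (1 := HM _). rewrite pow_add. right. ring.
Qed.

Lemma CSeries_split (u : nat -> C) (n : nat) :
  geo u -> CSeries u = csum u n + CSeries (fun k => u (k + n)%nat).
Proof.
intro Hu. apply CSeries_Clim.
assert (H : Clim (fun m => csum u (m + n)%nat) (csum u n + CSeries (fun k => u (k + n)%nat))).
{ apply Clim_ext with (fun m => csum u n + csum (fun k => u (k + n)%nat) m).
  - intro m. now rewrite csum_split.
  - apply Clim_plus; [apply Clim_const|]. now apply geo_Clim, geo_shift. }
apply (is_lim_seq_incr_n
  (fun m => Cmod (csum u m - (csum u n + CSeries (fun k => u (k + n)%nat)))) n).
exact H.
Qed.

Lemma CSeries_tail_le (u : nat -> C) (M r : R) (n : nat) :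
  (0 <= r < 1)%R -> (forall k, (Cmod (u k) <= M * r ^ k)%R) ->
  (Cmod (CSeries u - csum u n) <= M * r ^ n / (1 - r))%R.
Proof.
intros Hr H. rewrite (CSeries_split u n) by now exists M, r.
replace (csum u n + CSeries (fun k => u (k + n)%nat) - csum u n)
  with (CSeries (fun k => u (k + n)%nat)) by ring.
apply CSeries_geo_le; [exact Hr|].
intro k. apply Rle_trans with (1 := H _). rewrite pow_add. right. ring.
Qed.

Lemma CSeries_telescope (h : nat -> C) (l : C) :
  Clim h l -> CSeries (fun k => h k - h (S k)) = h O - l.
Proof.
intro H. apply CSeries_Clim. apply Clim_ext with (fun n => h O - h n).
- intro n. now rewrite csum_telescope.
- apply Clim_minus; [apply Clim_const|exact H].
Qed.

Lemma CSeries_finite (u : nat -> C) (n : nat) :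
  (forall k, (n <= k)%nat -> u k = 0) -> CSeries u = csum u n.
Proof.
intro H. apply CSeries_Clim.
apply (is_lim_seq_incr_n (fun m => Cmod (csum u m - csum u n)) n).
apply is_lim_seq_ext with (fun _ => 0%R); [|apply is_lim_seq_const].
intro m. rewrite csum_split.
rewrite (csum_ext (fun k => u (k + n)%nat) (fun _ => 0)) by (intros; apply H; lia).
rewrite csum_const0. replace (csum u n + 0 - csum u n) with (RtoC 0) by ring.
now rewrite Cmod_0.
Qed.

(** Tannery's theorem. The two tails after [m] terms are small uniformly in [n], and the first [m]
    terms form a finite sum, which passes to the limit; each of the three errors is made smaller
    than eps / 3. *)
Lemma CSeries_dominated (u : nat -> nat -> C) (v : nat -> C) (M r : R) :
  (0 <= r < 1)%R -> (forall n j, (Cmod (u n j) <= M * r ^ j)%R) ->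
  (forall j, Clim (fun n => u n j) (v j)) ->
  Clim (fun n => CSeries (u n)) (CSeries v).
Proof.
intros Hr H Hlim.
assert (Hv : forall j, (Cmod (v j) <= M * r ^ j)%R).
{ intro j. apply Clim_Cmod_le with (fun n => u n j); auto. }
assert (Hfin : forall m, Clim (fun n => csum (u n) m) (csum v m)).
{ induction m as [|m IH]; simpl; [apply Clim_const|]. apply Clim_plus; auto. }
assert (HM : (0 <= M)%R).
{ specialize (H O O). simpl in H. assert (H0 := Cmod_ge_0 (u O O)). lra. }
assert (Ht : is_lim_seq (fun n => (M * r ^ n / (1 - r))%R) 0).
{ replace 0%R with (M * 0 / (1 - r))%R by (unfold Rdiv; ring).
  apply is_lim_seq_mult'; [|apply is_lim_seq_const].
  apply is_lim_seq_mult'; [apply is_lim_seq_const|].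
  apply is_lim_seq_geom. rewrite Rabs_pos_eq; lra. }
apply is_lim_seq_spec. intro eps.
assert (He := cond_pos eps).
assert (He3 : (0 < eps / 3)%R) by lra.
apply is_lim_seq_spec in Ht. destruct (Ht (mkposreal _ He3)) as [m Hm].
specialize (Hm m (Nat.le_refl _)). simpl in Hm. rewrite Rminus_0_r in Hm.
apply Rabs_def2 in Hm. destruct Hm as [Hm _].
specialize (Hfin m). apply is_lim_seq_spec in Hfin.
destruct (Hfin (mkposreal _ He3)) as [N HN].
exists N. intros n Hn. specialize (HN n Hn). simpl in HN.
rewrite Rminus_0_r, Rabs_pos_eq in HN |- * by apply Cmod_ge_0.
assert (H1 := CSeries_tail_le (u n) M r m Hr (H n)).
assert (H2 := CSeries_tail_le v M r m Hr Hv).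
replace (CSeries (u n) - CSeries v)
  with ((CSeries (u n) - csum (u n) m) + ((csum (u n) m - csum v m) + - (CSeries v - csum v m)))
  by ring.
apply Rle_lt_trans with (1 := Cmod_triangle _ _).
assert (H3 := Cmod_triangle (csum (u n) m - csum v m) (- (CSeries v - csum v m))).
rewrite Cmod_opp in H3. lra.
Qed.

(** Finite sums over [j] commute with the series over [k] by linearity; letting their length grow is
    a case of [CSeries_dominated] with majorant [M / (1 - r) * s ^ k]. *)
Lemma CSeries_exchange (t : nat -> nat -> C) (M r s : R) :
  (0 <= r < 1)%R -> (0 <= s < 1)%R ->
  (forall j k, (Cmod (t j k) <= M * r ^ j * s ^ k)%R) ->
  CSeries (fun j => CSeries (t j)) = CSeries (fun k => CSeries (fun j => t j k)).
Proof.
intros Hr Hs H.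
assert (H1 : forall j, (Cmod (CSeries (t j)) <= M / (1 - s) * r ^ j)%R).
{ intro j. replace (M / (1 - s) * r ^ j)%R with (M * r ^ j / (1 - s))%R by (field; lra).
  now apply CSeries_geo_le. }
assert (Hl : Clim (fun n => csum (fun j => CSeries (t j)) n) (CSeries (fun j => CSeries (t j)))).
{ apply geo_Clim. now exists (M / (1 - s))%R, r. }
assert (Hcol : forall k j, (Cmod (t j k) <= M * s ^ k * r ^ j)%R).
{ intros k j. apply Rle_trans with (1 := H j k). right. ring. }
assert (He : forall n,
  csum (fun j => CSeries (t j)) n = CSeries (fun k => csum (fun j => t j k) n)).
{ assert (Hg : forall n, geo (fun k => csum (fun j => t j k) n)).
  { intro n. exists (M / (1 - r))%R, s. split; [exact Hs|]. intro k.
    replace (M / (1 - r) * s ^ k)%R with (M * s ^ k / (1 - r))%R by (field; lra).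
    apply csum_geo_le; auto. }
  assert (Hg' : forall n, geo (t n)).
  { intro n. exists (M * r ^ n)%R, s. split; auto. }
  induction n as [|n IH]; simpl.
  - symmetry. rewrite (CSeries_finite (fun _ => 0) O); auto.
  - now rewrite CSeries_plus, IH. }
apply Clim_unique with (1 := Hl).
apply Clim_ext with (fun n => CSeries (fun k => csum (fun j => t j k) n)); [auto|].
apply (CSeries_dominated (fun n k => csum (fun j => t j k) n) _ (M / (1 - r)) s Hs).
- intros n k. replace (M / (1 - r) * s ^ k)%R with (M * s ^ k / (1 - r))%R by (field; lra).
  apply csum_geo_le; auto.
- intro k. apply geo_Clim. exists (M * s ^ k)%R, r. auto.
Qed.

Lemma bounded_CSeries {I : Type} (x : C) (h : I -> nat -> C) :
  (Cmod x < 1)%R -> bounded (fun i : I * nat => h (fst i) (snd i)) ->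
  bounded (fun i => CSeries (fun j => x ^ j * h i j)).
Proof.
intros Hx [M HM]. exists (M / (1 - Cmod x))%R. intro i. apply CSeries_geo_le.
- split; [apply Cmod_ge_0|exact Hx].
- intro j. rewrite Cmod_mult, Cmod_pow, Rmult_comm.
  apply Rmult_le_compat_r; [apply pow_le, Cmod_ge_0|]. apply (HM (i, j)).
Qed.

(** * q-shifted factorials *)

Lemma qpoch_S_l (a q : C) (n : nat) :
  qpoch a q (S n) = (1 - a) * qpoch (a * q) q n.
Proof.
induction n as [|n IH]; [simpl; ring|].
change (qpoch a q (S (S n))) with (qpoch a q (S n) * (1 - a * q ^ S n)).
rewrite IH. simpl. ring.
Qed.

Lemma qpoch_add (a q : C) (n m : nat) :
  qpoch a q (n + m) = qpoch a q n * qpoch (a * q ^ n) q m.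
Proof.
induction m as [|m IH].
- rewrite Nat.add_0_r. simpl. ring.
- rewrite Nat.add_succ_r. simpl. rewrite IH, Cpow_add_r. ring.
Qed.

Lemma qpoch_0_l (q : C) (n : nat) : qpoch 0 q n = 1.
Proof. induction n as [|n IH]; simpl; [reflexivity|]. rewrite IH. ring. Qed.

Lemma qpoch_1_l (q : C) (n : nat) : qpoch 1 q (S n) = 0.
Proof. rewrite qpoch_S_l. ring. Qed.

Lemma qpoch_neq_0 (a q : C) (n : nat) :
  (forall k, (k < n)%nat -> 1 - a * q ^ k <> 0) -> qpoch a q n <> 0.
Proof.
induction n as [|n IH]; intro H; simpl.
- intro E. apply C1_nz. exact E.
- apply Cmult_neq_0; auto.
Qed.

Lemma qpoch_factor_neq_0 (a q : C) (n : nat) :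
  qpoch a q (S n) <> 0 -> 1 - a * q ^ n <> 0.
Proof. intros H E. apply H. simpl. rewrite E. ring. Qed.

(** The factors of even and odd index separate: 1 - x^2 q^(2i) is (1 - x q^i)(1 + x q^i), and 1 -
    x^2 q^(2i+1) splits in the same way with r x in place of x. *)
Lemma qpoch_double (x q r : C) (n : nat) :
  r ^ 2 = q ->
  qpoch (x ^ 2) q (2 * n)
  = qpoch x q n * qpoch (- x) q n * (qpoch (r * x) q n * qpoch (- (r * x)) q n).
Proof.
intro Hr. induction n as [|n IH]; [simpl; ring|].
replace (2 * S n)%nat with (S (S (2 * n)))%nat by lia.
cbn [qpoch]. rewrite IH, (Cpow_S q).
replace (2 * n)%nat with (n + n)%nat by lia. rewrite Cpow_add_r.
set (p := q ^ n). rewrite <- Hr. ring.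
Qed.

(* [t^k (1/t;q)_k], extended continuously to [t = 0]. *)
Fixpoint qfall (t q : C) (k : nat) : C :=
  match k with O => 1 | S m => qfall t q m * (t - q ^ m) end.

Lemma qfall_mul_q (t q : C) (k : nat) :
  qfall (q * t) q (S k) = (q * t - 1) * q ^ k * qfall t q k.
Proof.
induction k as [|k IH]; [simpl; ring|].
change (qfall (q * t) q (S (S k))) with (qfall (q * t) q (S k) * (q * t - q ^ S k)).
rewrite IH. simpl. ring.
Qed.

(** Here [qfall 0 q k] is (-1)^k q^(k(k-1)/2). The formula serves the substitution t -> q^k t in
    [watson_saal]. *)
Lemma qfall_mul_qpow (x q : C) (k : nat) :
  qfall (x * q ^ k) q k = qfall 0 q k * qpoch (x * q) q k.
Proof.
induction k as [|k IH]; [simpl; ring|].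
replace (x * q ^ S k) with (q * (x * q ^ k)) by (rewrite Cpow_S; ring).
rewrite qfall_mul_q, IH. simpl. ring.
Qed.

Lemma qfall_qpow_eq_0 (q : C) (j k : nat) : (j < k)%nat -> qfall (q ^ j) q k = 0.
Proof.
intro H. induction H as [|k H IH]; simpl.
- ring.
- rewrite IH. ring.
Qed.

Lemma Clim_qfall (u : nat -> C) (l q : C) (k : nat) :
  Clim u l -> Clim (fun n => qfall (u n) q k) (qfall l q k).
Proof.
intro H. induction k as [|k IH]; simpl; [apply Clim_const|].
apply Clim_mult; [exact IH|]. apply Clim_minus; [exact H|apply Clim_const].
Qed.

Lemma Clim_qpoch (u : nat -> C) (l q : C) (k : nat) :
  Clim u l -> Clim (fun n => qpoch (u n) q k) (qpoch l q k).
Proof.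
intro H. induction k as [|k IH]; simpl; [apply Clim_const|].
apply Clim_mult; [exact IH|]. apply Clim_minus; [apply Clim_const|].
apply Clim_mult; [exact H|apply Clim_const].
Qed.

Lemma prod_one_plus_geom_le (u : nat -> R) (X r : R) :
  (0 <= X)%R -> (0 <= r < 1)%R -> (u O <= 1)%R -> (forall n, (0 <= u n)%R) ->
  (forall n, (u (S n) <= u n * (1 + X * r ^ n))%R) ->
  forall n, (u n <= exp (X / (1 - r)))%R.
Proof.
intros HX Hr H0 Hp HS n.
assert (H : (u n <= exp (X * (1 - r ^ n) / (1 - r)))%R).
{ induction n as [|n IH].
  - replace (X * (1 - r ^ 0) / (1 - r))%R with 0%R by (simpl; field; lra).
    now rewrite exp_0.
  - apply Rle_trans with (1 := HS n).
    replace (X * (1 - r ^ S n) / (1 - r))%R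
      with (X * (1 - r ^ n) / (1 - r) + X * r ^ n)%R by (simpl; field; lra).
    rewrite exp_plus. apply Rmult_le_compat; auto.
    + assert (Hn : (0 <= r ^ n)%R) by (apply pow_le; lra). nra.
    + assert (Hn : (0 <= r ^ n)%R) by (apply pow_le; lra).
      destruct (Req_dec (X * r ^ n) 0) as [E|E].
      * rewrite E, exp_0. lra.
      * left. apply exp_ineq1. exact E. }
apply Rle_trans with (1 := H).
assert (Hn : (0 <= r ^ n)%R) by (apply pow_le; lra).
assert (Hle : (X * (1 - r ^ n) / (1 - r) <= X / (1 - r))%R).
{ apply Rmult_le_compat_r; [left; apply Rinv_0_lt_compat; lra|]. nra. }
destruct Hle as [Hle|Hle]; [left; now apply exp_increasing|right; now rewrite Hle].
Qed.

(** * Infinite products for |q| < 1: convergence, uniform bounds, zeros *)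

Section Nome.

Variable q : C.
Hypothesis Hq : (Cmod q < 1)%R.

Lemma Cmod_q_range : (0 <= Cmod q < 1)%R.
Proof. split; [apply Cmod_ge_0|exact Hq]. Qed.

Lemma Cmod_qpoch_le (a : C) (n : nat) :
  (Cmod (qpoch a q n) <= exp (Cmod a / (1 - Cmod q)))%R.
Proof.
apply (prod_one_plus_geom_le (fun n => Cmod (qpoch a q n)) (Cmod a) (Cmod q)).
- apply Cmod_ge_0.
- apply Cmod_q_range.
- simpl. rewrite Cmod_1. lra.
- intro. apply Cmod_ge_0.
- intro k. simpl. rewrite Cmod_mult. apply Rmult_le_compat_l; [apply Cmod_ge_0|].
  apply Rle_trans with (1 := Cmod_triangle 1 (- (a * q ^ k))).
  rewrite Cmod_1, Cmod_opp, Cmod_mult, Cmod_pow. lra.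
Qed.

(** Telescoping turns the product into a partial sum, so that the convergence of the infinite
    product and its distance from 1 follow from a geometric majorant. *)
Lemma qpoch_csum (a : C) (n : nat) :
  qpoch a q n = 1 - csum (fun k => q ^ k * (a * qpoch a q k)) n.
Proof. induction n as [|n IH]; simpl; [ring|]. rewrite IH at 1. ring_simplify.
  rewrite IH at 1. ring. Qed.

Lemma qpoch_Clim (a : C) : Clim (qpoch a q) (qpoch_inf a q).
Proof.
assert (H : Clim (qpoch a q) (1 - CSeries (fun k => q ^ k * (a * qpoch a q k)))).
{ apply Clim_ext with (fun n => 1 - csum (fun k => q ^ k * (a * qpoch a q k)) n).
  - intro n. now rewrite <- qpoch_csum.
  - apply Clim_minus; [apply Clim_const|]. apply geo_Clim, geo_bounded; [exact Hq|].
    apply bounded_mult; [apply bounded_const|].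
    exists (exp (Cmod a / (1 - Cmod q)))%R. apply Cmod_qpoch_le. }
assert (E : qpoch_inf a q = 1 - CSeries (fun k => q ^ k * (a * qpoch a q k))).
{ apply qpoch_inf_unique. now apply Clim_filterlim. }
now rewrite E.
Qed.

Lemma qpoch_inf_split (a : C) (n : nat) :
  qpoch_inf a q = qpoch a q n * qpoch_inf (a * q ^ n) q.
Proof.
apply Clim_unique with (fun m => qpoch a q (m + n)).
- apply (Clim_shift (qpoch a q)). apply qpoch_Clim.
- apply Clim_ext with (fun m => qpoch a q n * qpoch (a * q ^ n) q m).
  + intro m. now rewrite <- qpoch_add, Nat.add_comm.
  + apply Clim_scal, qpoch_Clim.
Qed.

Lemma qpoch_inf_S_l (a : C) : qpoch_inf a q = (1 - a) * qpoch_inf (a * q) q.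
Proof. rewrite (qpoch_inf_split a 1). simpl. f_equal; [ring|]. f_equal. ring. Qed.

Lemma Cmod_qpoch_inf_le (a : C) :
  (Cmod (qpoch_inf a q) <= exp (Cmod a / (1 - Cmod q)))%R.
Proof.
apply Clim_Cmod_le with (qpoch a q); [apply qpoch_Clim|apply Cmod_qpoch_le].
Qed.

Lemma exp_div_mono (x y : R) :
  (x <= y)%R -> (exp (x / (1 - Cmod q)) <= exp (y / (1 - Cmod q)))%R.
Proof.
intro H. assert (H0 := Cmod_q_range).
assert (Hle : (x / (1 - Cmod q) <= y / (1 - Cmod q))%R).
{ apply Rmult_le_compat_r; [left; apply Rinv_0_lt_compat; lra|exact H]. }
destruct Hle as [Hle|Hle]; [left; now apply exp_increasing|right; now rewrite Hle].
Qed.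

Lemma bounded_qpoch {I : Type} (f : I -> C) (h : I -> nat) :
  bounded f -> bounded (fun i => qpoch (f i) q (h i)).
Proof.
intros [M HM]. exists (exp (M / (1 - Cmod q)))%R. intro i.
apply Rle_trans with (1 := Cmod_qpoch_le _ _). now apply exp_div_mono.
Qed.

Lemma bounded_qpoch_inf {I : Type} (f : I -> C) :
  bounded f -> bounded (fun i => qpoch_inf (f i) q).
Proof.
intros [M HM]. exists (exp (M / (1 - Cmod q)))%R. intro i.
apply Rle_trans with (1 := Cmod_qpoch_inf_le _). now apply exp_div_mono.
Qed.

Lemma bounded_qpow {I : Type} (h : I -> nat) : bounded (fun i => q ^ h i).
Proof. apply bounded_pow. now left. Qed.

Lemma bounded_cqpow {I : Type} (c : C) (h : I -> nat) : bounded (fun i => c * q ^ h i).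
Proof. apply bounded_mult; [apply bounded_const|apply bounded_qpow]. Qed.

Lemma qpoch_neq_0_of_inf (a : C) (n : nat) : qpoch_inf a q <> 0 -> qpoch a q n <> 0.
Proof. intros H E. apply H. rewrite (qpoch_inf_split a n), E. ring. Qed.

Lemma qpoch_inf_tail_neq_0 (a : C) (n : nat) :
  qpoch_inf a q <> 0 -> qpoch_inf (a * q ^ n) q <> 0.
Proof. intros H E. apply H. rewrite (qpoch_inf_split a n), E. ring. Qed.

(** Since 1 / (a;q)_n = (a q^n;q)_oo / (a;q)_oo, one nonzero infinite product controls all lengths
    at once. *)
Lemma bounded_inv_qpoch {I : Type} (a : C) (h : I -> nat) :
  qpoch_inf a q <> 0 -> bounded (fun i => / qpoch a q (h i)).
Proof.
intro H. apply bounded_ext with (fun i => / qpoch_inf a q * qpoch_inf (a * q ^ h i) q).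
- intro i. rewrite (qpoch_inf_split a (h i)). field.
  split; first [now apply qpoch_neq_0_of_inf|now apply qpoch_inf_tail_neq_0].
- apply bounded_mult; [apply bounded_const|].
  apply bounded_qpoch_inf, bounded_cqpow.
Qed.

Lemma bounded_inv_qpoch_inf {I : Type} (a : C) (h : I -> nat) :
  qpoch_inf a q <> 0 -> bounded (fun i => / qpoch_inf (a * q ^ h i) q).
Proof.
intro H. apply bounded_ext with (fun i => / qpoch_inf a q * qpoch a q (h i)).
- intro i. rewrite (qpoch_inf_split a (h i)). field.
  split; first [now apply qpoch_neq_0_of_inf|now apply qpoch_inf_tail_neq_0].
- apply bounded_mult; [apply bounded_const|].
  apply bounded_qpoch, bounded_const.
Qed.

(** Uniform in [n] and with a factor |a|, so that in [Clim_qpoch_1] the base and the length may vary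
    together. *)
Lemma Cmod_qpoch_minus_1_le (a : C) (n : nat) :
  (Cmod (qpoch a q n - 1) <= Cmod a * (exp (Cmod a / (1 - Cmod q)) / (1 - Cmod q)))%R.
Proof.
rewrite (qpoch_csum a n).
replace (1 - csum (fun k => q ^ k * (a * qpoch a q k)) n - 1)
  with (- csum (fun k => q ^ k * (a * qpoch a q k)) n) by ring.
rewrite Cmod_opp. unfold Rdiv. rewrite <- Rmult_assoc.
apply (csum_geo_le _ _ (Cmod q)); [apply Cmod_q_range|].
intro k. rewrite !Cmod_mult, Cmod_pow, Rmult_comm.
apply Rmult_le_compat_r; [apply pow_le, Cmod_ge_0|].
apply Rmult_le_compat_l; [apply Cmod_ge_0|apply Cmod_qpoch_le].
Qed.

Lemma is_lim_seq_Cmod_mult (u : nat -> C) (M : R) :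
  Clim u 0 -> is_lim_seq (fun n => (Cmod (u n) * M)%R) 0.
Proof.
intro H. apply is_lim_seq_0_mult.
apply is_lim_seq_ext with (2 := H). intro n. f_equal. ring.
Qed.

Lemma Clim_qpoch_1 (u : nat -> C) (h : nat -> nat) :
  Clim u 0 -> Clim (fun n => qpoch (u n) q (h n)) 1.
Proof.
intro H. destruct (bounded_Clim u 0 H) as [M HM].
apply Clim_le with (fun n => (Cmod (u n) * (exp (M / (1 - Cmod q)) / (1 - Cmod q)))%R).
- intro n. apply Rle_trans with (1 := Cmod_qpoch_minus_1_le _ _).
  apply Rmult_le_compat_l; [apply Cmod_ge_0|].
  assert (H0 := Cmod_q_range).
  apply Rmult_le_compat_r; [left; apply Rinv_0_lt_compat; lra|].
  apply exp_div_mono, HM.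
- now apply is_lim_seq_Cmod_mult.
Qed.

Lemma Clim_qpoch_inf_1 (u : nat -> C) :
  Clim u 0 -> Clim (fun n => qpoch_inf (u n) q) 1.
Proof.
intro H. destruct (bounded_Clim u 0 H) as [M HM].
apply Clim_le with (fun n => (Cmod (u n) * (exp (M / (1 - Cmod q)) / (1 - Cmod q)))%R).
- intro n.
  apply Rle_trans with (Cmod (u n) * (exp (Cmod (u n) / (1 - Cmod q)) / (1 - Cmod q)))%R.
  + apply Clim_Cmod_le with (fun m => qpoch (u n) q m - 1).
    * apply Clim_minus; [apply qpoch_Clim|apply Clim_const].
    * intro m. apply Cmod_qpoch_minus_1_le.
  + apply Rmult_le_compat_l; [apply Cmod_ge_0|].
    assert (H0 := Cmod_q_range).
    apply Rmult_le_compat_r; [left; apply Rinv_0_lt_compat; lra|].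
    apply exp_div_mono, HM.
- now apply is_lim_seq_Cmod_mult.
Qed.

Lemma Clim_cqpow (c : C) : Clim (fun n => c * q ^ n) 0.
Proof. replace (RtoC 0) with (c * 0) by ring. now apply Clim_scal, Clim_geom. Qed.

Lemma qpoch_inf_0_l : qpoch_inf 0 q = 1.
Proof.
apply Clim_unique with (qpoch 0 q); [apply qpoch_Clim|].
apply Clim_ext with (fun _ => 1); [intro; now rewrite qpoch_0_l|apply Clim_const].
Qed.

Lemma qpoch_inf_1_l : qpoch_inf 1 q = 0.
Proof. rewrite qpoch_inf_S_l. ring. Qed.

(** Some tail (a q^N;q)_oo lies at distance less than 1 from 1, hence is nonzero; finitely many
    factors remain. *)
Lemma qpoch_inf_neq_0 (a : C) :
  (forall n, 1 - a * q ^ n <> 0) -> qpoch_inf a q <> 0.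
Proof.
intro H.
assert (Hl := Clim_qpoch_inf_1 _ (Clim_cqpow a)).
apply is_lim_seq_spec in Hl. destruct (Hl (mkposreal 1 Rlt_0_1)) as [N HN].
specialize (HN N (Nat.le_refl _)). simpl in HN.
rewrite Rminus_0_r, Rabs_pos_eq in HN by apply Cmod_ge_0.
rewrite (qpoch_inf_split a N). apply Cmult_neq_0.
- apply qpoch_neq_0. auto.
- intro E. rewrite E in HN. replace (0 - 1) with (- (1)) in HN by ring.
  rewrite Cmod_opp, Cmod_1 in HN. lra.
Qed.

Lemma qpoch_inf_neq_0_small (a : C) : (Cmod a < 1)%R -> qpoch_inf a q <> 0.
Proof.
intro H. apply qpoch_inf_neq_0. intros n E.
assert (E1 : a * q ^ n = 1).
{ replace (a * q ^ n) with (1 - (1 - a * q ^ n)) by ring. rewrite E. ring. }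
apply (f_equal Cmod) in E1. rewrite Cmod_mult, Cmod_pow, Cmod_1 in E1.
assert (H1 : (0 <= Cmod q ^ n <= 1)%R).
{ split; [apply pow_le, Cmod_ge_0|]. rewrite <- (pow1 n). apply pow_incr.
  split; [apply Cmod_ge_0|now left]. }
assert (H2 := Cmod_ge_0 a). nra.
Qed.

Lemma qpoch_inf_neq_0_of_all (a : C) :
  (forall n, qpoch a q n <> 0) -> qpoch_inf a q <> 0.
Proof. intro H. apply qpoch_inf_neq_0. intro n. apply qpoch_factor_neq_0, H. Qed.

Lemma qpoch_inf_factor_neq_0 (a : C) (n : nat) :
  qpoch_inf a q <> 0 -> 1 - a * q ^ n <> 0.
Proof. intro H. now apply qpoch_factor_neq_0, qpoch_neq_0_of_inf. Qed.

(** Dividing by y^k turns each factor into f - q^n / y, of modulus at most 1 + |1/y| |q|^n. *)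
Lemma bounded_qfall {I : Type} (y : C) (f : I -> C) (h : I -> nat) :
  y <> 0 -> (forall i, (Cmod (f i) <= 1)%R) ->
  bounded (fun i => qfall (y * f i) q (h i) / y ^ h i).
Proof.
intros Hy Hf. exists (exp (Cmod (/ y) / (1 - Cmod q)))%R. intro i.
apply (prod_one_plus_geom_le (fun n => Cmod (qfall (y * f i) q n / y ^ n))
         (Cmod (/ y)) (Cmod q)).
- apply Cmod_ge_0.
- apply Cmod_q_range.
- simpl. replace (1 / 1) with (RtoC 1) by field. rewrite Cmod_1. lra.
- intro. apply Cmod_ge_0.
- intro n. simpl.
  replace (qfall (y * f i) q n * (y * f i - q ^ n) / (y * y ^ n))
    with (qfall (y * f i) q n / y ^ n * (f i + - (/ y * q ^ n)))
    by (field; split; [now apply Cpow_nz|exact Hy]).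
  rewrite Cmod_mult. apply Rmult_le_compat_l; [apply Cmod_ge_0|].
  apply Rle_trans with (1 := Cmod_triangle _ _).
  rewrite Cmod_opp, Cmod_mult, Cmod_pow. specialize (Hf i). lra.
Qed.

Lemma Cmod_qpow_le_1 (n : nat) : (Cmod (q ^ n) <= 1)%R.
Proof.
rewrite Cmod_pow, <- (pow1 n). apply pow_incr. split; [apply Cmod_ge_0|now left].
Qed.

(** Points with |q^j| > |y| are harmless because [qfall] vanishes for k > j. Choose m with |q^m| <=
    |y|. For j >= m the claim reduces to [bounded_qfall] with q^m in place of y; for j < m only k <=
    j < m is left, where |1/y|^k is at most (1 + |1/y|)^m. *)
Lemma bounded_qfall_lattice {I : Type} (y : C) (j k : I -> nat) :
  q <> 0 -> y <> 0 -> bounded (fun i => qfall (q ^ j i) q (k i) / y ^ k i).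
Proof.
intros Hq0 Hy.
assert (Hm : exists m, (Cmod (q ^ m) <= Cmod y)%R).
{ assert (Hl := Clim_geom q Hq). apply is_lim_seq_spec in Hl.
  assert (Hp : (0 < Cmod y)%R) by now apply Cmod_gt_0.
  destruct (Hl (mkposreal _ Hp)) as [N HN].
  exists N. specialize (HN N (Nat.le_refl _)). simpl in HN.
  rewrite Rminus_0_r, Rabs_pos_eq in HN by apply Cmod_ge_0.
  replace (q ^ N - 0) with (q ^ N) in HN by ring. now left. }
destruct Hm as [m Hm].
assert (Hqm : q ^ m <> 0) by now apply Cpow_nz.
destruct (bounded_qfall (I := nat * nat) (q ^ m) (fun p => q ^ fst p) snd Hqm) as [M1 HM1].
{ intro p. apply Cmod_qpow_le_1. }
destruct (bounded_qfall (I := nat * nat) 1 (fun p => q ^ fst p) snd C1_nz) as [M2 HM2].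
{ intro p. apply Cmod_qpow_le_1. }
assert (HM20 : (0 <= M2)%R).
{ apply Rle_trans with (2 := HM2 (O, O)). apply Cmod_ge_0. }
assert (HM10 : (0 <= M1)%R).
{ apply Rle_trans with (2 := HM1 (O, O)). apply Cmod_ge_0. }
set (B := (1 + Cmod (/ y))%R).
assert (HB : (1 <= B)%R) by (unfold B; assert (H := Cmod_ge_0 (/ y)); lra).
assert (HBm : (0 <= B ^ m)%R) by (apply pow_le; lra).
exists (M1 + M2 * B ^ m)%R. intro i. set (J := j i). set (K := k i).
destruct (Compare_dec.le_lt_dec m J) as [HJ|HJ].
- apply Rle_trans with M1; [|nra].
  replace (qfall (q ^ J) q K / y ^ K)
    with (qfall (q ^ m * q ^ (J - m)) q K / (q ^ m) ^ K * ((q ^ m * / y) ^ K)).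
  + rewrite Cmod_mult. rewrite <- (Rmult_1_r M1).
    apply Rmult_le_compat; try apply Cmod_ge_0.
    * apply (HM1 (J - m, K)%nat).
    * rewrite Cmod_pow, <- (pow1 K). apply pow_incr.
      split; [apply Cmod_ge_0|].
      rewrite Cmod_mult, Cmod_inv by exact Hy.
      assert (Hp : (0 < Cmod y)%R) by now apply Cmod_gt_0.
      apply Rmult_le_reg_r with (Cmod y); [exact Hp|].
      rewrite Rmult_assoc, Rinv_l by lra. lra.
  + rewrite <- Cpow_add_r. replace (m + (J - m))%nat with J by lia.
    rewrite Cpow_mult_l, Cpow_inv by exact Hy. field.
    split; [now apply Cpow_nz|]. now apply Cpow_nz.
- destruct (Compare_dec.le_lt_dec K J) as [HK|HK].
  + apply Rle_trans with (M2 * B ^ m)%R; [|lra].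
    unfold Cdiv. rewrite Cmod_mult.
    apply Rmult_le_compat; try apply Cmod_ge_0.
    * specialize (HM2 (J, K)). simpl in HM2. rewrite Cpow_1_l in HM2.
      replace (1 * q ^ J) with (q ^ J) in HM2 by ring.
      replace (qfall (q ^ J) q K / 1) with (qfall (q ^ J) q K) in HM2 by field.
      exact HM2.
    * rewrite <- Cpow_inv by exact Hy. rewrite Cmod_pow.
      apply Rle_trans with (B ^ K)%R.
      -- apply pow_incr. split; [apply Cmod_ge_0|]. unfold B. lra.
      -- apply Rle_pow; [exact HB|lia].
  + rewrite qfall_qpow_eq_0 by exact HK.
    replace (0 / y ^ K) with (RtoC 0) by (field; now apply Cpow_nz).
    rewrite Cmod_0. nra.
Qed.

End Nome.

Lemma qpoch_inf_double (x q r : C) :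
  (Cmod q < 1)%R -> r ^ 2 = q ->
  qpoch_inf (x ^ 2) q
  = qpoch_inf x q * qpoch_inf (- x) q * (qpoch_inf (r * x) q * qpoch_inf (- (r * x)) q).
Proof.
intros H Hr. apply Clim_unique with (fun n => qpoch (x ^ 2) q (2 * n)).
- apply (is_lim_seq_subseq (fun n => Cmod (qpoch (x ^ 2) q n - qpoch_inf (x ^ 2) q))
           0 (fun n => (2 * n)%nat)).
  + apply eventually_subseq. intro n. lia.
  + now apply qpoch_Clim.
- apply Clim_ext with (1 := fun n => eq_sym (qpoch_double x q r n Hr)).
  apply Clim_mult; apply Clim_mult; now apply qpoch_Clim.
Qed.

(** Leaves as goals the nonvanishing of inverted infinite products and any factor of another shape,
    such as a [qfall] quotient. *)
Ltac bdd :=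
  lazymatch goal with
  | |- bounded (fun _ => ?c) => apply bounded_const
  | |- bounded (fun i => Cmult (@?f i) (@?g i)) => apply (bounded_mult f g); bdd
  | |- bounded (fun i => Cplus (@?f i) (@?g i)) => apply (bounded_plus f g); bdd
  | |- bounded (fun i => Cminus (@?f i) (@?g i)) => apply (bounded_minus f g); bdd
  | |- bounded (fun i => Copp (@?f i)) => apply (bounded_opp f); bdd
  | |- bounded (fun i => qpoch (@?f i) ?q (@?h i)) =>
      apply (bounded_qpoch q ltac:(assumption) f h); bdd
  | |- bounded (fun i => qpoch_inf (@?f i) ?q) =>
      apply (bounded_qpoch_inf q ltac:(assumption) f); bdd
  | |- bounded (fun i => Cinv (qpoch ?a ?q (@?h i))) =>
      apply (bounded_inv_qpoch q ltac:(assumption) a h)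
  | |- bounded (fun i => Cinv (qpoch_inf (Cmult ?a (Cpow ?q (@?h i))) ?q)) =>
      apply (bounded_inv_qpoch_inf q ltac:(assumption) a h)
  | |- bounded (fun i => Cpow ?q (@?h i)) => apply (bounded_pow q h); now left
  | |- _ => idtac
  end.

(** * The nonterminating 6phi5 sum *)

Lemma Cmult_neq_0_inv (x y : C) : x * y <> 0 -> x <> 0 /\ y <> 0.
Proof. intro H. split; intro E; apply H; rewrite E; ring. Qed.

(* The coefficients of a 6phi5 with base [a], [q a = b c d], without the factor [d ^ k]; the
   quotient (a;q)_k / (1 - a) is written (q a;q)_(k-1), which makes sense for [a = 1]. *)
Definition wp_coef (b c d q : C) (k : nat) : C :=
  match k with
  | O => 1
  | S m =>
      (1 - b * c * d * q ^ (2 * m + 1)) * qpoch (b * c * d) q m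
      * (qpoch b q k * qpoch c q k
         / (qpoch q q k * qpoch (c * d) q k * qpoch (b * d) q k))
  end.

(** Certificate for the recurrence from t to q t. The value 0 at k = 0 is the convention 1 /
    (q;q)_(-1) = 0. *)
Definition wp_cert (b c d q t : C) (g : nat -> C) (k : nat) : C :=
  match k with
  | O => 0
  | S m =>
      t * qpoch (b * c * d) q m
      * (qpoch b q k * qpoch c q k / (qpoch q q m * qpoch (c * d) q m * qpoch (b * d) q m))
      * d ^ k * qfall t q m * g k
  end.

(** Only a first-order relation of [g] enters, so the identity serves both the finite products of
    [wp_fin] and the infinite ones of [wp_sum]. At q t the factor is [g (S k)] because b c d q^k (q
    t) = b c d q^(k+1) t. *)
Lemma wp_telescope (b c d q t : C) (g : nat -> C) (k : nat) :
  qpoch q q k <> 0 -> qpoch (c * d) q k <> 0 -> qpoch (b * d) q k <> 0 ->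
  g k = (1 - b * c * d * q ^ k * t) * g (S k) ->
  (1 - d * t) * (wp_coef b c d q k * d ^ k * qfall t q k * g k)
  - (1 - c * d * t) * (1 - b * d * t)
    * (wp_coef b c d q k * d ^ k * qfall (q * t) q k * g (S k))
  = wp_cert b c d q t g k - wp_cert b c d q t g (S k).
Proof.
intros Hq Hc Hb Hg. destruct k as [|m].
- simpl in *. rewrite Hg. field.
- unfold wp_coef, wp_cert. rewrite Hg.
  rewrite qfall_mul_q.
  replace (q ^ (2 * m + 1)) with (q ^ m * q ^ m * q)
    by (replace (2 * m + 1)%nat with (m + m + 1)%nat by lia;
        rewrite !Cpow_add_r; simpl; ring).
  simpl in *.
  apply Cmult_neq_0_inv in Hq, Hc, Hb.
  field. tauto.
Qed.

Section WellPoised.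

Variables b c d q : C.
Hypothesis Hq0 : q <> 0.
Hypothesis Hq : (Cmod q < 1)%R.
Hypothesis Hc : qpoch_inf (c * d) q <> 0.
Hypothesis Hb : qpoch_inf (b * d) q <> 0.

Lemma qpoch_inf_q_neq_0 : qpoch_inf q q <> 0.
Proof. now apply qpoch_inf_neq_0_small. Qed.

Lemma qpoch_q_neq_0 (n : nat) : qpoch q q n <> 0.
Proof. apply qpoch_neq_0_of_inf; [exact Hq|apply qpoch_inf_q_neq_0]. Qed.

Let Hck (n : nat) : qpoch (c * d) q n <> 0.
Proof. now apply qpoch_neq_0_of_inf. Qed.

Let Hbk (n : nat) : qpoch (b * d) q n <> 0.
Proof. now apply qpoch_neq_0_of_inf. Qed.

(* The finite products (e q^(j+k);q)_(j-k) replace (e q^(j+k);q)_oo / (e q^(2j);q)_oo,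
   so that nothing degenerates when [e = b c d] is a negative power of [q]. *)
Definition wp_fin (j : nat) : C :=
  csum (fun k => wp_coef b c d q k * d ^ k * qfall (q ^ j) q k
                 * qpoch (b * c * d * q ^ (j + k)) q (j - k)) (S j).

(** The telescoping sum over k <= j + 1 vanishes at both ends: the certificate is 0 at k = 0 and
    contains [qfall (q ^ j) q (S j)] at k = j + 2. *)
Lemma wp_fin_S (j : nat) :
  (1 - b * c * d * q ^ (2 * j)) * (1 - b * c * d * q ^ (2 * j + 1))
  * (1 - d * q ^ j) * wp_fin j
  = (1 - c * d * q ^ j) * (1 - b * d * q ^ j) * wp_fin (S j).
Proof.
(* All these products end with the exponent 2j + 1, as those of [wp_fin (S j)] do; those of
   [wp_fin j] lack the last two factors, which become the first two factors of the recurrence. *)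
set (g := fun k => qpoch (b * c * d * q ^ (j + k)) q (j + 2 - k)).
assert (H : csum (fun k => wp_cert b c d q (q ^ j) g k - wp_cert b c d q (q ^ j) g (S k))
              (S (S j)) = 0).
{ rewrite csum_telescope. unfold wp_cert. rewrite qfall_qpow_eq_0 by lia. ring. }
rewrite (csum_ext _ (fun k =>
   (1 - d * q ^ j) * (wp_coef b c d q k * d ^ k * qfall (q ^ j) q k * g k)
   + (- ((1 - c * d * q ^ j) * (1 - b * d * q ^ j)))
     * (wp_coef b c d q k * d ^ k * qfall (q * q ^ j) q k * g (S k)))) in H.
2:{ intros k Hk. rewrite <- wp_telescope; auto using qpoch_q_neq_0; [ring|].
    unfold g. replace (j + 2 - k)%nat with (S (j + 2 - S k)) by lia.
    rewrite qpoch_S_l. replace (j + S k)%nat with (S (j + k)) by lia.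
    rewrite Cpow_S, !Cpow_add_r. f_equal; [ring|]. f_equal. ring. }
rewrite csum_plus, !csum_scal in H.
assert (H1 : csum (fun k => wp_coef b c d q k * d ^ k * qfall (q ^ j) q k * g k) (S (S j))
  = (1 - b * c * d * q ^ (2 * j)) * (1 - b * c * d * q ^ (2 * j + 1)) * wp_fin j).
{ change (csum (fun k => wp_coef b c d q k * d ^ k * qfall (q ^ j) q k * g k) (S j)
    + wp_coef b c d q (S j) * d ^ (S j) * qfall (q ^ j) q (S j) * g (S j)
    = (1 - b * c * d * q ^ (2 * j)) * (1 - b * c * d * q ^ (2 * j + 1)) * wp_fin j).
  rewrite qfall_qpow_eq_0 by lia. unfold wp_fin. rewrite <- csum_scal.
  rewrite Cmult_0_r, Cmult_0_l, Cplus_0_r. apply csum_ext. intros k Hk.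
  unfold g. replace (j + 2 - k)%nat with (S (S (j - k))) by lia. simpl qpoch.
  assert (E : q ^ (2 * j) = q ^ (j + k) * q ^ (j - k))
    by (rewrite <- Cpow_add_r; f_equal; lia).
  rewrite (Cpow_add_r q (2 * j) 1), E. simpl.
  ring. }
assert (H2 : csum (fun k => wp_coef b c d q k * d ^ k * qfall (q * q ^ j) q k * g (S k)) (S (S j))
  = wp_fin (S j)).
{ unfold wp_fin. apply csum_ext. intros k Hk. unfold g.
  replace (j + 2 - S k)%nat with (S j - k)%nat by lia.
  replace (j + S k)%nat with (S j + k)%nat by lia. reflexivity. }
rewrite H1, H2 in H.
match goal with |- ?x = ?y => replace x with (x - y + y) by ring end.
match type of H with ?x = _ =>
  transitivity (x + (1 - c * d * q ^ j) * (1 - b * d * q ^ j) * wp_fin (S j)) end;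
  [ring|rewrite H; ring].
Qed.

Lemma wp_fin_eq (j : nat) :
  wp_fin j * (qpoch (c * d) q j * qpoch (b * d) q j)
  = qpoch (b * c * d) q (2 * j) * qpoch d q j.
Proof.
induction j as [|j IH].
- unfold wp_fin. simpl. ring.
- replace (2 * S j)%nat with (S (S (2 * j)))%nat by lia. cbn [qpoch].
  replace (S (2 * j)) with (2 * j + 1)%nat by lia.
  match goal with |- ?x = _ =>
    replace x with ((1 - c * d * q ^ j) * (1 - b * d * q ^ j) * wp_fin (S j)
                    * (qpoch (c * d) q j * qpoch (b * d) q j)) by ring end.
  rewrite <- wp_fin_S.
  match goal with |- _ = ?x =>
    replace x with (qpoch (b * c * d) q (2 * j) * qpoch d q j
      * ((1 - b * c * d * q ^ (2 * j)) * (1 - b * c * d * q ^ (2 * j + 1)) * (1 - d * q ^ j)))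
      by ring end.
  rewrite <- IH. ring.
Qed.

(** The 6phi5 multiplied by (b c d t;q)_oo, so that no denominator depends on [t] and [t = 0] makes
    sense. *)
Definition wp_sum (t : C) : C :=
  CSeries (fun k => wp_coef b c d q k * d ^ k * qfall t q k
                    * qpoch_inf (b * c * d * q ^ k * t) q).

Lemma wp_sum_lattice (j : nat) :
  wp_sum (q ^ j) * (qpoch (c * d) q j * qpoch (b * d) q j)
  = qpoch_inf (b * c * d) q * qpoch d q j.
Proof.
assert (H : wp_sum (q ^ j) = qpoch_inf (b * c * d * q ^ (2 * j)) q * wp_fin j).
{ unfold wp_sum. rewrite (CSeries_finite _ (S j)).
  - unfold wp_fin. rewrite <- csum_scal. apply csum_ext. intros k Hk.
    replace (b * c * d * q ^ k * q ^ j) with (b * c * d * q ^ (j + k))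
      by (rewrite Cpow_add_r; ring).
    rewrite (qpoch_inf_split q Hq (b * c * d * q ^ (j + k)) (j - k)).
    rewrite <- (Cmult_assoc _ (q ^ (j + k)) (q ^ (j - k))), <- Cpow_add_r.
    replace (j + k + (j - k))%nat with (2 * j)%nat by lia. ring.
  - intros k Hk. rewrite qfall_qpow_eq_0 by lia. ring. }
rewrite H, <- Cmult_assoc, wp_fin_eq.
rewrite (qpoch_inf_split q Hq (b * c * d) (2 * j)). ring.
Qed.

Lemma bounded_wp_coef {I : Type} (h : I -> nat) :
  bounded (fun i => wp_coef b c d q (h i)).
Proof.
apply bounded_comp with (f := wp_coef b c d q).
assert (H : bounded (fun m => wp_coef b c d q (S m))).
{ unfold wp_coef, Cdiv.
  apply bounded_ext with (fun m => (1 - b * c * d * q ^ (2 * m + 1)) * qpoch (b * c * d) q m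
      * (qpoch b q (S m) * qpoch c q (S m))
      * (/ qpoch q q (S m) * / qpoch (c * d) q (S m) * / qpoch (b * d) q (S m))).
  - intro m. field. auto using qpoch_q_neq_0.
  - bdd; auto using qpoch_inf_q_neq_0. }
destruct H as [M HM]. exists (Rmax M (Cmod (wp_coef b c d q O))). intros [|m].
- apply Rmax_r.
- apply Rle_trans with (2 := Rmax_l _ _). apply HM.
Qed.

Lemma wp_term_eq (t x : C) (k : nat) (r : C) :
  t <> 0 ->
  wp_coef b c d q k * d ^ k * qfall (t * x) q k * r
  = (d * t) ^ k * (wp_coef b c d q k * (qfall (t * x) q k / t ^ k) * r).
Proof. intro Ht. rewrite Cpow_mult_l. field. now apply Cpow_nz. Qed.

(** The bound on d t gives convergence and also sends the certificate to 0, so the telescoping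
    series has sum 0. *)
Lemma wp_sum_q (t : C) :
  t <> 0 -> (Cmod (d * t) < 1)%R ->
  (1 - d * t) * wp_sum t = (1 - c * d * t) * (1 - b * d * t) * wp_sum (q * t).
Proof.
intros Ht Hdt.
set (g := fun k => qpoch_inf (b * c * d * q ^ k * t) q).
assert (Hcoef : forall x, (Cmod x <= 1)%R ->
   forall h : nat -> C, bounded h ->
   geo (fun k => wp_coef b c d q k * d ^ k * qfall (t * x) q k * h k)).
{ intros x Hx h Hh.
  apply geo_ext with (fun k => (d * t) ^ k
     * (wp_coef b c d q k * (qfall (t * x) q k / t ^ k) * h k)).
  - intro k. now rewrite <- wp_term_eq.
  - apply geo_bounded; [exact Hdt|].
    apply bounded_mult; [|exact Hh].
    apply bounded_mult; [apply (bounded_wp_coef (fun k => k))|].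
    apply (bounded_qfall q Hq t (fun _ => x) (fun k => k)); auto. }
assert (Hg : bounded g).
{ unfold g. apply bounded_qpoch_inf; [exact Hq|].
  apply bounded_mult; [now apply bounded_cqpow|apply bounded_const]. }
assert (Hg1 : geo (fun k => wp_coef b c d q k * d ^ k * qfall t q k * g k)).
{ assert (H := Hcoef 1). rewrite Cmult_1_r in H. apply H; [rewrite Cmod_1; lra|exact Hg]. }
assert (Hg2 : geo (fun k => wp_coef b c d q k * d ^ k * qfall (q * t) q k * g (S k))).
{ rewrite (Cmult_comm q t). apply Hcoef; [now left|].
  now apply (bounded_comp S g). }
assert (HH : Clim (wp_cert b c d q t g) 0).
{ apply Clim_unshift. unfold wp_cert.
  apply Clim_ext with (fun m => (d * t) ^ m * (t * d * qpoch (b * c * d) q m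
     * (qpoch b q (S m) * qpoch c q (S m)
        * (/ qpoch q q m * / qpoch (c * d) q m * / qpoch (b * d) q m))
     * (qfall (t * 1) q m / t ^ m) * g (S m))).
  - intro m. rewrite Cpow_mult_l, Cmult_1_r, (Cpow_S d). field.
    repeat split; auto using qpoch_q_neq_0, Cpow_nz.
  - apply Clim_mult_bounded; [now apply Clim_geom|].
    apply bounded_mult; [|now apply (bounded_comp S g)].
    apply bounded_mult;
      [|apply (bounded_qfall q Hq t (fun _ => 1) (fun k => k)); auto; intro; rewrite Cmod_1; lra].
    bdd; auto using qpoch_inf_q_neq_0. }
assert (E : (1 - d * t) * wp_sum t - (1 - c * d * t) * (1 - b * d * t) * wp_sum (q * t) = 0).
{ replace (wp_sum (q * t))
    with (CSeries (fun k => wp_coef b c d q k * d ^ k * qfall (q * t) q k * g (S k))).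
  2:{ apply CSeries_ext. intro k. unfold g. f_equal. f_equal. rewrite Cpow_S. ring. }
  change (wp_sum t) with (CSeries (fun k => wp_coef b c d q k * d ^ k * qfall t q k * g k)).
  rewrite <- !CSeries_scal by assumption.
  rewrite <- CSeries_minus.
  2:{ apply geo_ext with (fun k => wp_coef b c d q k * d ^ k * qfall t q k * ((1 - d * t) * g k)).
      - intro; ring.
      - assert (H := Hcoef 1). rewrite Cmult_1_r in H.
        apply H; [rewrite Cmod_1; lra|].
        apply bounded_mult; [apply bounded_const|exact Hg]. }
  2:{ apply geo_ext with (fun k => wp_coef b c d q k * d ^ k * qfall (t * q) q k
          * ((1 - c * d * t) * (1 - b * d * t) * g (S k))).
      - intro; rewrite (Cmult_comm t q); ring.
      - apply Hcoef; [now left|].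
        apply bounded_mult; [apply bounded_const|now apply (bounded_comp S g)]. }
  transitivity (CSeries (fun k => wp_cert b c d q t g k - wp_cert b c d q t g (S k))).
  - apply CSeries_ext. intro k. apply wp_telescope; auto using qpoch_q_neq_0.
    unfold g. rewrite (qpoch_inf_S_l q Hq (b * c * d * q ^ k * t)).
    f_equal. f_equal. rewrite Cpow_S. ring.
  - rewrite (CSeries_telescope _ 0 HH). simpl. ring. }
match goal with |- ?x = ?y => replace x with (x - y + y) by ring end.
rewrite E. ring.
Qed.

Lemma wp_sum_iter (t : C) (n : nat) :
  t <> 0 -> (Cmod (d * t) < 1)%R ->
  qpoch (d * t) q n * wp_sum t
  = qpoch (c * d * t) q n * qpoch (b * d * t) q n * wp_sum (t * q ^ n).
Proof.
intros Ht Hdt. induction n as [|n IH].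
- simpl. replace (t * 1) with t by ring. ring.
- assert (H : (1 - d * t * q ^ n) * wp_sum (t * q ^ n)
     = (1 - c * d * t * q ^ n) * (1 - b * d * t * q ^ n) * wp_sum (t * q ^ S n)).
  { replace (t * q ^ S n) with (q * (t * q ^ n)) by (rewrite Cpow_S; ring).
    replace (d * t * q ^ n) with (d * (t * q ^ n)) by ring.
    rewrite wp_sum_q.
    - f_equal. ring.
    - apply Cmult_neq_0; [exact Ht|now apply Cpow_nz].
    - replace (d * (t * q ^ n)) with (d * t * q ^ n) by ring.
      rewrite Cmod_mult. assert (H1 := Cmod_qpow_le_1 q Hq n).
      assert (H2 := Cmod_ge_0 (d * t)). assert (H3 := Cmod_ge_0 (q ^ n)). nra. }
  cbn [qpoch].
  transitivity ((1 - d * t * q ^ n) * (qpoch (d * t) q n * wp_sum t)); [ring|].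
  rewrite IH.
  transitivity (qpoch (c * d * t) q n * qpoch (b * d * t) q n
    * ((1 - d * t * q ^ n) * wp_sum (t * q ^ n))); [ring|].
  rewrite H. ring.
Qed.

Lemma Clim_wp_sum (t : C) :
  t <> 0 -> (Cmod (d * t) < 1)%R -> Clim (fun n => wp_sum (t * q ^ n)) (wp_sum 0).
Proof.
intros Ht Hdt.
assert (Hbd : bounded (fun i : nat * nat => wp_coef b c d q (snd i)
     * (qfall (t * q ^ fst i) q (snd i) / t ^ snd i)
     * qpoch_inf (b * c * d * q ^ snd i * (t * q ^ fst i)) q)).
{ apply bounded_mult.
  - apply bounded_mult; [apply bounded_wp_coef|].
    apply (bounded_qfall q Hq t (fun i : nat * nat => q ^ fst i) snd Ht).
    intro; now apply Cmod_qpow_le_1.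
  - apply bounded_qpoch_inf; [exact Hq|].
    apply bounded_mult; now apply bounded_cqpow. }
destruct Hbd as [M HM].
apply (CSeries_dominated (fun n k => wp_coef b c d q k * d ^ k * qfall (t * q ^ n) q k
                    * qpoch_inf (b * c * d * q ^ k * (t * q ^ n)) q) _ M (Cmod (d * t))).
- split; [apply Cmod_ge_0|exact Hdt].
- intros n k. rewrite wp_term_eq by exact Ht.
  rewrite Cmod_mult, Cmod_pow, Rmult_comm.
  apply Rmult_le_compat_r; [apply pow_le, Cmod_ge_0|]. apply (HM (n, k)).
- intro k. assert (Hl := Clim_cqpow q Hq t). apply Clim_mult.
  + apply Clim_scal. now apply Clim_qfall.
  + replace (b * c * d * q ^ k * 0) with (RtoC 0) by ring.
    rewrite qpoch_inf_0_l by exact Hq. apply Clim_qpoch_inf_1; [exact Hq|].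
    apply Clim_ext with (fun n => b * c * d * q ^ k * t * q ^ n); [intro; ring|].
    now apply Clim_cqpow.
Qed.

Lemma wp_sum_eq_aux (t : C) :
  t <> 0 -> (Cmod (d * t) < 1)%R ->
  qpoch_inf (d * t) q * wp_sum t
  = qpoch_inf (c * d * t) q * qpoch_inf (b * d * t) q * wp_sum 0.
Proof.
intros Ht Hdt.
apply Clim_unique with (fun n => qpoch (d * t) q n * wp_sum t).
- apply Clim_mult; [now apply qpoch_Clim|apply Clim_const].
- apply Clim_ext with (1 := fun n => eq_sym (wp_sum_iter t n Ht Hdt)).
  apply Clim_mult; [apply Clim_mult; now apply qpoch_Clim|now apply Clim_wp_sum].
Qed.

(** The value at 0 is read off at t = q^m with |d q^m| < 1: there the series terminates, with the
    sum given by [wp_sum_lattice], and also satisfies [wp_sum_eq_aux]. *)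
Lemma wp_sum_0 :
  qpoch_inf (c * d) q * qpoch_inf (b * d) q * wp_sum 0
  = qpoch_inf (b * c * d) q * qpoch_inf d q.
Proof.
assert (Hm : exists m, (Cmod (d * q ^ m) < 1)%R).
{ assert (Hl := Clim_cqpow q Hq d). apply is_lim_seq_spec in Hl.
  destruct (Hl (mkposreal 1 Rlt_0_1)) as [N HN].
  exists N. specialize (HN N (Nat.le_refl _)). simpl in HN.
  rewrite Rminus_0_r, Rabs_pos_eq in HN by apply Cmod_ge_0.
  now replace (d * q ^ N - 0) with (d * q ^ N) in HN by ring. }
destruct Hm as [m Hm].
assert (H := wp_sum_eq_aux (q ^ m) (Cpow_nz q m Hq0) Hm).
assert (H2 := wp_sum_lattice m).
rewrite (qpoch_inf_split q Hq (c * d) m), (qpoch_inf_split q Hq (b * d) m),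
  (qpoch_inf_split q Hq d m).
transitivity (qpoch (c * d) q m * qpoch (b * d) q m
  * (qpoch_inf (c * d * q ^ m) q * qpoch_inf (b * d * q ^ m) q * wp_sum 0)); [ring|].
rewrite <- H.
transitivity (qpoch_inf (d * q ^ m) q * (wp_sum (q ^ m) * (qpoch (c * d) q m * qpoch (b * d) q m)));
  [ring|]. rewrite H2. ring.
Qed.

(* The nonterminating 6phi5 summation, (II.20) in Gasper and Rahman. *)
Lemma wp_sum_eq (t : C) :
  t <> 0 -> (Cmod (d * t) < 1)%R ->
  qpoch_inf (d * t) q * wp_sum t * (qpoch_inf (c * d) q * qpoch_inf (b * d) q)
  = qpoch_inf (c * d * t) q * qpoch_inf (b * d * t) q
    * (qpoch_inf (b * c * d) q * qpoch_inf d q).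
Proof.
intros Ht Hdt. rewrite wp_sum_eq_aux, <- wp_sum_0 by assumption. ring.
Qed.

End WellPoised.

Lemma Clim_qpoch_inf_0 (q : C) (u : nat -> C) :
  (Cmod q < 1)%R -> Clim u 0 -> Clim (fun n => qpoch_inf (u n) q) (qpoch_inf 0 q).
Proof. intros Hq H. rewrite qpoch_inf_0_l by exact Hq. now apply Clim_qpoch_inf_1. Qed.

(** * The nonterminating q-Saalschutz sum *)

Section Saalschutz.

Variables B C0 y q : C.
Hypothesis Hq : (Cmod q < 1)%R.
Hypothesis Hy : y <> 0.
Hypothesis Hyq : qpoch_inf y q <> 0.
Hypothesis HB : qpoch_inf (B * y) q <> 0.
Hypothesis HC : qpoch_inf (C0 * y) q <> 0.

(* The two halves of the q-integral over [y, 1] of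
   (qt, qt/y, A B C0 y t)_oo / (A t, B t, C0 t)_oo, multiplied by (A, B, C0)_oo; on the lattice
   q^N the quotient (A)_oo / (A q^j)_oo is (A)_j, which stays meaningful when (A)_oo = 0. *)
Definition saal1 (A : C) (j : nat) : C :=
  q ^ j * (qpoch A q j * qpoch B q j * qpoch C0 q j
           * (qpoch_inf (q * q ^ j) q * qpoch_inf (q / y * q ^ j) q
              * qpoch_inf (A * B * C0 * y * q ^ j) q)).

Definition saal2 (A : C) (j : nat) : C :=
  q ^ j * (qpoch_inf A q * qpoch_inf B q * qpoch_inf C0 q
           * (/ qpoch_inf (A * y * q ^ j) q * / qpoch_inf (B * y * q ^ j) q
              * / qpoch_inf (C0 * y * q ^ j) q)
           * (qpoch_inf (y * q * q ^ j) q * qpoch_inf (q * q ^ j) q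
              * qpoch_inf (A * B * C0 * y * y * q ^ j) q)).

Definition saal (A : C) : C := CSeries (saal1 A) - y * CSeries (saal2 A).

Lemma geo_saal1 (A : C) : geo (saal1 A).
Proof. apply geo_bounded; [exact Hq|]. bdd. Qed.

Lemma geo_saal2 (A : C) : qpoch_inf (A * y) q <> 0 -> geo (saal2 A).
Proof. intro HA. apply geo_bounded; [exact Hq|]. bdd; assumption. Qed.

(** At j = 0 the factor (1;q)_oo is 0; the case is separate because of the length j - 1 in (A
    q;q)_(j-1). The form [1 * q ^ j] is the one that [qpoch_inf_qpow_S] unfolds. *)
Definition saal1_cert (A : C) (j : nat) : C :=
  match j with
  | O => 0
  | S m =>
      A * y * (qpoch (A * q) q m * qpoch B q j * qpoch C0 q j)
      * (qpoch_inf (1 * q ^ j) q * qpoch_inf (/ y * q ^ j) q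
         * qpoch_inf (A * B * C0 * y * q ^ j) q)
  end.

Definition saal2_cert (A : C) (j : nat) : C :=
  A * y * (qpoch_inf (A * q) q * qpoch_inf B q * qpoch_inf C0 q)
  * (/ qpoch_inf (A * y * q ^ j) q * / qpoch_inf (B * y * q ^ j) q
     * / qpoch_inf (C0 * y * q ^ j) q)
  * (qpoch_inf (y * q ^ j) q * qpoch_inf (1 * q ^ j) q
     * qpoch_inf (A * B * C0 * y * y * q ^ j) q).

Lemma qpoch_inf_qpow_S (x : C) (j : nat) :
  qpoch_inf (x * q ^ j) q = (1 - x * q ^ j) * qpoch_inf (x * q ^ S j) q.
Proof. rewrite qpoch_inf_S_l by exact Hq. f_equal. f_equal. rewrite Cpow_S. ring. Qed.

Lemma saal1_telescope (A : C) (j : nat) :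
  (1 - A * y) * saal1 A j - (1 - A * B * y) * (1 - A * C0 * y) * saal1 (A * q) j
  = saal1_cert A j - saal1_cert A (S j).
Proof.
unfold saal1, saal1_cert.
replace (A * q * B * C0 * y * q ^ j) with (A * B * C0 * y * q ^ S j)
  by (rewrite Cpow_S; ring).
replace (q * q ^ j) with (1 * q ^ S j) by (rewrite Cpow_S; ring).
replace (q / y * q ^ j) with (/ y * q ^ S j) by (rewrite Cpow_S; field; exact Hy).
rewrite (qpoch_inf_qpow_S (A * B * C0 * y) j).
set (e := qpoch_inf (A * B * C0 * y * q ^ S j) q).
set (f := qpoch_inf (1 * q ^ S j) q).
set (g := qpoch_inf (/ y * q ^ S j) q).
destruct j as [|m].
- simpl. ring.
- unfold e, f, g. clear e f g.
  rewrite (qpoch_inf_qpow_S 1 (S m)), (qpoch_inf_qpow_S (/ y) (S m)).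
  set (e := qpoch_inf (A * B * C0 * y * q ^ S (S m)) q).
  set (f := qpoch_inf (1 * q ^ S (S m)) q).
  set (g := qpoch_inf (/ y * q ^ S (S m)) q).
  rewrite (qpoch_S_l A). simpl. field. exact Hy.
Qed.

Lemma saal2_telescope (A : C) (j : nat) :
  qpoch_inf (A * y) q <> 0 ->
  y * ((1 - A * y) * saal2 A j - (1 - A * B * y) * (1 - A * C0 * y) * saal2 (A * q) j)
  = saal2_cert A j - saal2_cert A (S j).
Proof.
intro HA. unfold saal2, saal2_cert.
replace (A * q * B * C0 * y * y * q ^ j) with (A * B * C0 * y * y * q ^ S j)
  by (rewrite Cpow_S; ring).
replace (A * q * y * q ^ j) with (A * y * q ^ S j) by (rewrite Cpow_S; ring).
replace (q * q ^ j) with (1 * q ^ S j) by (rewrite Cpow_S; ring).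
replace (y * q * q ^ j) with (y * q ^ S j) by (rewrite Cpow_S; ring).
assert (HA' := qpoch_inf_tail_neq_0 q Hq _ j HA).
assert (HB' := qpoch_inf_tail_neq_0 q Hq _ j HB).
assert (HC' := qpoch_inf_tail_neq_0 q Hq _ j HC).
rewrite (qpoch_inf_S_l q Hq A).
rewrite qpoch_inf_qpow_S in HA'. rewrite qpoch_inf_qpow_S in HB'.
rewrite qpoch_inf_qpow_S in HC'.
rewrite (qpoch_inf_qpow_S (A * B * C0 * y * y) j), (qpoch_inf_qpow_S y j),
  (qpoch_inf_qpow_S 1 j), (qpoch_inf_qpow_S (A * y) j), (qpoch_inf_qpow_S (B * y) j),
  (qpoch_inf_qpow_S (C0 * y) j).
apply Cmult_neq_0_inv in HA', HB', HC'.
field. tauto.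
Qed.

Lemma Clim_saal1_cert (A : C) :
  Clim (saal1_cert A) (A * y * (qpoch_inf (A * q) q * qpoch_inf B q * qpoch_inf C0 q)).
Proof.
apply Clim_unshift. unfold saal1_cert.
match goal with |- Clim _ ?l => replace l with (l * (1 * 1 * 1)) by ring end.
apply Clim_mult.
- apply Clim_scal. apply Clim_mult; [apply Clim_mult|].
  + now apply qpoch_Clim.
  + replace (fun n => qpoch B q (S n)) with (fun n => qpoch B q (n + 1))
      by (apply functional_extensionality; intro; f_equal; lia).
    apply (Clim_shift (qpoch B q)). now apply qpoch_Clim.
  + replace (fun n => qpoch C0 q (S n)) with (fun n => qpoch C0 q (n + 1))
      by (apply functional_extensionality; intro; f_equal; lia).
    apply (Clim_shift (qpoch C0 q)). now apply qpoch_Clim.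
- assert (H : forall x, Clim (fun n => qpoch_inf (x * q ^ S n) q) 1).
  { intro x. apply Clim_qpoch_inf_1; [exact Hq|].
    apply Clim_ext with (fun n => x * q * q ^ n); [intro; rewrite Cpow_S; ring|].
    now apply Clim_cqpow. }
  clim_mult; apply H.
Qed.

Lemma Clim_qpoch_inf_qpow (x : C) : Clim (fun n => qpoch_inf (x * q ^ n) q) 1.
Proof. apply Clim_qpoch_inf_1; [exact Hq|]. now apply Clim_cqpow. Qed.

Lemma Clim_inv_qpoch_inf_qpow (x : C) : Clim (fun n => / qpoch_inf (x * q ^ n) q) 1.
Proof.
replace (RtoC 1) with (/ (RtoC 1)) by field.
apply Clim_inv; [apply C1_nz|apply Clim_qpoch_inf_qpow].
Qed.

Lemma Clim_saal2_cert (A : C) :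
  Clim (saal2_cert A) (A * y * (qpoch_inf (A * q) q * qpoch_inf B q * qpoch_inf C0 q)).
Proof.
unfold saal2_cert.
eapply Clim_eq.
- apply Clim_mult; [apply Clim_scal|].
  + clim_mult; apply Clim_inv_qpoch_inf_qpow.
  + clim_mult; apply Clim_qpoch_inf_qpow.
- ring.
Qed.

Lemma qpoch_inf_mul_q_neq_0 (x : C) : qpoch_inf x q <> 0 -> qpoch_inf (x * q) q <> 0.
Proof.
intro H. assert (H1 := qpoch_inf_tail_neq_0 q Hq x 1 H).
now replace (x * q ^ 1) with (x * q) in H1 by ring.
Qed.

(** Both certificates vanish at j = 0 and have the same limit, the boundary term at t = 0. It
    cancels in the difference of the two halves; in general neither half satisfies the recurrence
    alone. *)
Lemma saal_q (A : C) :
  qpoch_inf (A * y) q <> 0 ->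
  (1 - A * y) * saal A = (1 - A * B * y) * (1 - A * C0 * y) * saal (A * q).
Proof.
intro HA.
assert (HAq : qpoch_inf (A * q * y) q <> 0).
{ replace (A * q * y) with (A * y * q) by ring. now apply qpoch_inf_mul_q_neq_0. }
assert (H1 := CSeries_telescope _ _ (Clim_saal1_cert A)).
assert (H2 := CSeries_telescope _ _ (Clim_saal2_cert A)).
rewrite (CSeries_ext _ _ (fun j => eq_sym (saal1_telescope A j))) in H1.
rewrite (CSeries_ext _ _ (fun j => eq_sym (saal2_telescope A j HA))) in H2.
rewrite CSeries_minus in H1 by (auto using geo_saal1, geo_scal, geo_minus).
rewrite !CSeries_scal in H1 by (auto using geo_saal1, geo_scal, geo_minus).
rewrite CSeries_scal in H2 by (auto using geo_saal2, geo_scal, geo_minus).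
rewrite CSeries_minus in H2 by (auto using geo_saal2, geo_scal, geo_minus).
rewrite !CSeries_scal in H2 by (auto using geo_saal2, geo_scal, geo_minus).
assert (E : saal2_cert A 0 = 0).
{ unfold saal2_cert. simpl. replace (1 * 1) with (RtoC 1) by ring.
  rewrite qpoch_inf_1_l by exact Hq. ring. }
rewrite E in H2. simpl in H1. unfold saal.
match goal with |- ?x = ?y => replace x with (x - y + y) by ring end.
match type of H1 with ?l1 = ?r1 => match type of H2 with ?l2 = ?r2 =>
  transitivity (l1 - l2 + (1 - A * B * y) * (1 - A * C0 * y)
    * (CSeries (saal1 (A * q)) - y * CSeries (saal2 (A * q)))) end end; [ring|].
rewrite H1, H2. ring.
Qed.

Lemma saal_iter (A : C) (n : nat) :
  qpoch_inf (A * y) q <> 0 ->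
  qpoch (A * y) q n * saal A
  = qpoch (A * B * y) q n * qpoch (A * C0 * y) q n * saal (A * q ^ n).
Proof.
intro HA. induction n as [|n IH].
- simpl. replace (A * 1) with A by ring. ring.
- assert (H : (1 - A * y * q ^ n) * saal (A * q ^ n)
     = (1 - A * B * y * q ^ n) * (1 - A * C0 * y * q ^ n) * saal (A * q ^ S n)).
  { replace (A * q ^ S n) with (A * q ^ n * q) by (rewrite Cpow_S; ring).
    replace (A * y * q ^ n) with (A * q ^ n * y) by ring.
    rewrite saal_q; [f_equal; ring|].
    replace (A * q ^ n * y) with (A * y * q ^ n) by ring.
    now apply qpoch_inf_tail_neq_0. }
  cbn [qpoch].
  transitivity ((1 - A * y * q ^ n) * (qpoch (A * y) q n * saal A)); [ring|].
  rewrite IH.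
  transitivity (qpoch (A * B * y) q n * qpoch (A * C0 * y) q n
    * ((1 - A * y * q ^ n) * saal (A * q ^ n))); [ring|].
  rewrite H. ring.
Qed.

Lemma Clim_CSeries_qpow (u : nat -> nat -> C) (v : nat -> C) :
  bounded (fun i : nat * nat => u (fst i) (snd i)) ->
  (forall j, Clim (fun n => u n j) (v j)) ->
  Clim (fun n => CSeries (fun j => q ^ j * u n j)) (CSeries (fun j => q ^ j * v j)).
Proof.
intros [M HM] H.
apply (CSeries_dominated (fun n j => q ^ j * u n j) (fun j => q ^ j * v j) M (Cmod q)).
- split; [apply Cmod_ge_0|exact Hq].
- intros n j. rewrite Cmod_mult, Cmod_pow, Rmult_comm.
  apply Rmult_le_compat_r; [apply pow_le, Cmod_ge_0|]. apply (HM (n, j)).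
- intro j. now apply Clim_scal.
Qed.

Lemma Clim_saal (A : C) :
  qpoch_inf (A * y) q <> 0 -> Clim (fun n => saal (A * q ^ n)) (saal 0).
Proof.
intro HA. assert (Hl := Clim_cqpow q Hq A).
assert (HE : forall x, Clim (fun n => A * q ^ n * x) (0 * x)).
{ intro x. apply Clim_mult; [exact Hl|apply Clim_const]. }
unfold saal. apply Clim_minus; [|apply Clim_scal].
- apply Clim_CSeries_qpow.
  + bdd.
  + intro j. clim_mult; try apply Clim_const.
    * now apply Clim_qpoch.
    * replace (0 * B * C0 * y * q ^ j) with (RtoC 0) by ring.
      apply Clim_qpoch_inf_0; [exact Hq|].
      apply Clim_ext with (fun n => (A * B * C0 * y * q ^ j) * q ^ n); [intro; ring|].
      now apply Clim_cqpow.
- apply Clim_CSeries_qpow.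
  + apply bounded_mult; [apply bounded_mult|]; [bdd| |bdd].
    apply bounded_mult; [apply bounded_mult|]; [|bdd; assumption|bdd; assumption].
    (* With A q^n in place of A this factor depends on n + j only, so one bound covers both
       indices. *)
    apply bounded_ext with (fun i : nat * nat => / qpoch_inf (A * y * q ^ (fst i + snd i)) q).
    * intro i. rewrite Cpow_add_r. do 2 f_equal. ring.
    * now bdd.
  + intro j. clim_mult; try apply Clim_const.
    * now apply Clim_qpoch_inf_0.
    * apply Clim_inv.
      -- replace (0 * y * q ^ j) with (RtoC 0) by ring.
         rewrite qpoch_inf_0_l by exact Hq. apply C1_nz.
      -- replace (0 * y * q ^ j) with (RtoC 0) by ring.
         apply Clim_qpoch_inf_0; [exact Hq|].
         apply Clim_ext with (fun n => (A * y * q ^ j) * q ^ n); [intro; ring|].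
         now apply Clim_cqpow.
    * replace (0 * B * C0 * y * y * q ^ j) with (RtoC 0) by ring.
      apply Clim_qpoch_inf_0; [exact Hq|].
      apply Clim_ext with (fun n => (A * B * C0 * y * y * q ^ j) * q ^ n); [intro; ring|].
      now apply Clim_cqpow.
Qed.

Lemma saal_eq_aux (A : C) :
  qpoch_inf (A * y) q <> 0 ->
  qpoch_inf (A * y) q * saal A
  = qpoch_inf (A * B * y) q * qpoch_inf (A * C0 * y) q * saal 0.
Proof.
intros HA. apply Clim_unique with (fun n => qpoch (A * y) q n * saal A).
- apply Clim_mult; [now apply qpoch_Clim|apply Clim_const].
- apply Clim_ext with (1 := fun n => eq_sym (saal_iter A n HA)).
  apply Clim_mult; [apply Clim_mult; now apply qpoch_Clim|now apply Clim_saal].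
Qed.

(** The factor (1;q)_j leaves only j = 0 on q^N, and (1;q)_oo = 0 removes the other half. *)
Lemma saal_1 : saal 1 = qpoch_inf q q * qpoch_inf (q / y) q * qpoch_inf (B * C0 * y) q.
Proof.
unfold saal. rewrite (CSeries_finite (saal1 1) 1).
2:{ intros [|k] Hk; [lia|]. unfold saal1. rewrite qpoch_1_l. ring. }
rewrite (CSeries_finite (saal2 1) 0).
2:{ intros k _. unfold saal2. rewrite qpoch_inf_1_l by exact Hq. ring. }
simpl. unfold saal1. simpl. rewrite !Cmult_1_r, !Cmult_1_l. ring.
Qed.

(* The nonterminating q-Saalschutz summation, (II.24) in Gasper and Rahman: the recurrence
   moves both [A] and [1] to [0], and the case [A = 1] is trivial. *)
Lemma saal_eq (A : C) :
  qpoch_inf (A * y) q <> 0 ->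
  qpoch_inf (A * y) q * qpoch_inf (B * y) q * qpoch_inf (C0 * y) q * saal A
  = qpoch_inf q q * qpoch_inf y q * qpoch_inf (q / y) q
    * (qpoch_inf (A * B * y) q * qpoch_inf (A * C0 * y) q * qpoch_inf (B * C0 * y) q).
Proof.
intro HA.
assert (H1 := saal_eq_aux 1). rewrite saal_1, !Cmult_1_l in H1. specialize (H1 Hyq).
transitivity (qpoch_inf (B * y) q * qpoch_inf (C0 * y) q * (qpoch_inf (A * y) q * saal A));
  [ring|].
rewrite saal_eq_aux by exact HA.
transitivity (qpoch_inf (A * B * y) q * qpoch_inf (A * C0 * y) q
  * (qpoch_inf (B * y) q * qpoch_inf (C0 * y) q * saal 0)); [ring|].
rewrite <- H1. ring.
Qed.

End Saalschutz.

(** * A q-integral with quadratic denominator *)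

Lemma qfall_qpoch (t q : C) (k : nat) : t <> 0 -> qfall t q k = t ^ k * qpoch (/ t) q k.
Proof.
intro Ht. induction k as [|k IH]; simpl; [ring|]. rewrite IH. field. exact Ht.
Qed.

Section QuadraticKernel.

Variables e y q : C.
Hypothesis Hq0 : q <> 0.
Hypothesis Hq : (Cmod q < 1)%R.
Hypothesis Hy : y <> 0.
Hypothesis Hw : (Cmod (e * y * y) < 1)%R.

(* y^(-k) times the q-integral over [y, 1] of
   qfall t k (qt, qt/y, q e y t, e q^k t)_oo / (e t^2)_oo, on the lattices q^N and y q^N. *)
Definition quad1_factor (k j : nat) : C :=
  (qfall (q ^ j) q k / y ^ k
           * (qpoch_inf (q * q ^ j) q * qpoch_inf (q / y * q ^ j) q
              * qpoch_inf (q * e * y * q ^ j) q)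
           * qpoch (e * q ^ (j + k)) q (j - k)).

Definition quad1 (k j : nat) : C := q ^ j * quad1_factor k j.

Definition quad2_factor (k j : nat) : C :=
  (qfall (y * q ^ j) q k / y ^ k
           * (qpoch_inf (q * y * q ^ j) q * qpoch_inf (q * q ^ j) q
              * qpoch_inf (q * e * y * y * q ^ j) q
              * qpoch_inf (e * q ^ k * (y * q ^ j)) q)
           * / qpoch_inf (e * y * y * q ^ (2 * j)) q).

Definition quad2 (k j : nat) : C := q ^ j * quad2_factor k j.

Definition quad (k : nat) : C := CSeries (quad1 k) - y * CSeries (quad2 k).

Lemma qpoch_inf_w_neq_0 : qpoch_inf (e * y * y) q <> 0.
Proof. now apply qpoch_inf_neq_0_small. Qed.

Lemma bounded_quad1 : bounded (fun i : nat * nat => quad1_factor (fst i) (snd i)).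
Proof.
unfold quad1_factor.
apply bounded_mult; [apply bounded_mult|]; [|bdd|bdd].
now apply bounded_qfall_lattice.
Qed.

Lemma bounded_quad2 : bounded (fun i : nat * nat => quad2_factor (fst i) (snd i)).
Proof.
unfold quad2_factor.
apply bounded_mult; [apply bounded_mult|]; [|bdd|bdd; apply qpoch_inf_w_neq_0].
apply (bounded_qfall q Hq y (fun i : nat * nat => q ^ snd i) fst Hy).
intro; now apply Cmod_qpow_le_1.
Qed.

Lemma geo_quad1 (k : nat) : geo (quad1 k).
Proof.
apply geo_bounded; [exact Hq|].
apply (bounded_comp (fun j => (k, j)) _ bounded_quad1).
Qed.

Lemma geo_quad2 (k : nat) : geo (quad2 k).
Proof.
apply geo_bounded; [exact Hq|].
apply (bounded_comp (fun j => (k, j)) _ bounded_quad2).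
Qed.

Definition quad1_cert (k j : nat) : C :=
  qfall (q ^ j) q (S k) / y ^ k
  * (qpoch_inf (q * q ^ j) q * qpoch_inf (/ y * q ^ j) q * qpoch_inf (e * y * q ^ j) q)
  * qpoch (e * q ^ (j + k + 1)) q (j - (k + 1)).

Definition quad2_cert (k j : nat) : C :=
  qfall (y * q ^ j) q (S k) / y ^ k
  * (qpoch_inf (q * y * q ^ j) q * qpoch_inf (1 * q ^ j) q * qpoch_inf (e * y * y * q ^ j) q
     * qpoch_inf (e * q ^ S k * (y * q ^ j)) q)
  * / qpoch_inf (e * y * y * q ^ (2 * j)) q.

Lemma quad1_telescope (k j : nat) :
  quad1 k j - (1 + e * y * y) * quad1 (S k) j + e * y * y * quad1 (S (S k)) j
  = quad1_cert k j - quad1_cert k (S j).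
Proof.
unfold quad1, quad1_factor, quad1_cert.
replace (q / y * q ^ j) with (/ y * q ^ S j) by (rewrite Cpow_S; field; exact Hy).
replace (q * e * y * q ^ j) with (e * y * q ^ S j) by (rewrite Cpow_S; ring).
rewrite (qpoch_inf_qpow_S q Hq q j), (qpoch_inf_qpow_S q Hq (/ y) j),
  (qpoch_inf_qpow_S q Hq (e * y) j).
set (E1 := qpoch_inf (q * q ^ S j) q).
set (E2 := qpoch_inf (/ y * q ^ S j) q).
set (E3 := qpoch_inf (e * y * q ^ S j) q).
rewrite (Cpow_S q j). rewrite qfall_mul_q.
assert (Hyk := Cpow_nz y k Hy).
(* The lengths j - k, j - (k + 1), j - (k + 2) are truncated subtractions. Where one of them would
   be negative, the term vanishes through [qfall]; the cases j < k, j = k and j = k + 1 are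
   therefore checked apart from the generic one. *)
destruct (Compare_dec.le_lt_dec k j) as [Hkj|Hkj].
2:{ rewrite !qfall_qpow_eq_0 by lia. rewrite !Cpow_S. field. auto. }
destruct (Nat.eq_dec j k) as [->|Hne].
{ rewrite !(qfall_qpow_eq_0 q k (S _)) by lia.
  replace (k - k)%nat with O by lia. replace (S k - (k + 1))%nat with O by lia.
  simpl. field. auto. }
destruct (Nat.eq_dec j (S k)) as [->|Hne'].
{ rewrite !(qfall_qpow_eq_0 q (S k) (S (S _))) by lia.
  replace (S k - k)%nat with 1%nat by lia. replace (S k - S k)%nat with O by lia.
  replace (S k - (k + 1))%nat with O by lia. replace (S (S k) - (k + 1))%nat with 1%nat by lia.
  replace (S k + k)%nat with (1 + k + k)%nat by lia.
  replace (S (S k) + k + 1)%nat with (1 + 1 + 1 + k + k)%nat by lia.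
  simpl qpoch. cbn [qfall]. rewrite !Cpow_add_r, !Cpow_S.
  set (p := q ^ k). simpl. field. auto. }
replace (j - k)%nat with (S (S (j - k - 2))) by lia.
replace (j - S k)%nat with (S (j - k - 2)) by lia.
replace (j - S (S k))%nat with (j - k - 2)%nat by lia.
replace (j - (k + 1))%nat with (S (j - k - 2)) by lia.
replace (S j - (k + 1))%nat with (S (S (j - k - 2))) by lia.
rewrite (qpoch_S_l (e * q ^ (j + k))), (qpoch_S_l (e * q ^ (j + k) * q)),
  (qpoch_S_l (e * q ^ (j + S k))), (qpoch_S_l (e * q ^ (j + k + 1))).
replace (e * q ^ (j + k) * q * q) with (e * q ^ (j + k + 2))
  by (rewrite !Cpow_add_r; simpl; ring).
replace (e * q ^ (j + S k) * q) with (e * q ^ (j + k + 2))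
  by (replace (j + S k)%nat with (j + k + 1)%nat by lia; rewrite !Cpow_add_r; simpl; ring).
replace (e * q ^ (j + k + 1) * q) with (e * q ^ (j + k + 2))
  by (rewrite !Cpow_add_r; simpl; ring).
replace (j + S (S k))%nat with (j + k + 2)%nat by lia.
replace (S j + k + 1)%nat with (j + k + 2)%nat by lia.
cbn [qpoch].
set (P := qpoch (e * q ^ (j + k + 2)) q (j - k - 2)).
assert (Ej : q ^ (j + k + 2) * q ^ (j - k - 2) = q ^ j * q ^ j)
  by (rewrite <- !Cpow_add_r; f_equal; lia).
assert (Ej' : q ^ (j + k + 2) * q ^ S (j - k - 2) = q ^ j * q ^ j * q)
  by (rewrite Cpow_S, <- Ej; ring).
rewrite <- (Cmult_assoc e (q ^ (j + k + 2)) (q ^ (j - k - 2))), Ej.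
rewrite <- (Cmult_assoc e (q ^ (j + k + 2)) (q ^ S (j - k - 2))), Ej'.
replace (j + S k)%nat with (j + k + 1)%nat by lia.
rewrite !Cpow_add_r, Cpow_1_r.
cbn [qfall]. rewrite !Cpow_S.
clearbody E1 E2 E3 P. clear Ej Ej'.
set (s := q ^ j). set (p := q ^ k). set (Q := qfall s q k). clearbody Q.
field. auto.
Qed.

Lemma quad2_telescope (k j : nat) :
  y * (quad2 k j - (1 + e * y * y) * quad2 (S k) j + e * y * y * quad2 (S (S k)) j)
  = quad2_cert k j - quad2_cert k (S j).
Proof.
unfold quad2, quad2_factor, quad2_cert.
replace (q * e * y * y * q ^ j) with (e * y * y * q ^ S j) by (rewrite Cpow_S; ring).
replace (q * q ^ j) with (1 * q ^ S j) by (rewrite Cpow_S; ring).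
rewrite (qpoch_inf_qpow_S q Hq 1 j), (qpoch_inf_qpow_S q Hq (e * y * y) j).
rewrite (qpoch_inf_qpow_S q Hq (q * y) j).
assert (Hk : forall m, qpoch_inf (e * q ^ m * (y * q ^ j)) q
   = (1 - e * q ^ m * (y * q ^ j)) * qpoch_inf (e * q ^ S m * (y * q ^ j)) q).
{ intro m. rewrite qpoch_inf_S_l by exact Hq. do 2 f_equal. rewrite Cpow_S. ring. }
rewrite (Hk k), (Hk (S k)).
replace (e * q ^ S k * (y * q ^ S j)) with (e * q ^ S (S k) * (y * q ^ j))
  by (rewrite !Cpow_S; ring).
assert (Hw2 := qpoch_inf_tail_neq_0 q Hq _ (2 * j) qpoch_inf_w_neq_0).
assert (Hw3 := qpoch_inf_tail_neq_0 q Hq _ (2 * S j) qpoch_inf_w_neq_0).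
assert (E : qpoch_inf (e * y * y * q ^ (2 * j)) q
  = (1 - e * y * y * q ^ (2 * j)) * ((1 - e * y * y * q ^ (2 * j + 1))
    * qpoch_inf (e * y * y * q ^ (2 * S j)) q)).
{ rewrite (qpoch_inf_qpow_S q Hq _ (2 * j)). replace (S (2 * j)) with (2 * j + 1)%nat by lia.
  rewrite (qpoch_inf_qpow_S q Hq _ (2 * j + 1)).
  replace (S (2 * j + 1)) with (2 * S j)%nat by lia. reflexivity. }
rewrite E in Hw2 |- *. clear E Hk.
apply Cmult_neq_0_inv in Hw2. destruct Hw2 as [Ha Hb].
apply Cmult_neq_0_inv in Hb. destruct Hb as [Hb Hc].
replace (y * q ^ S j) with (q * (y * q ^ j)) by (rewrite Cpow_S; ring).
rewrite qfall_mul_q.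
assert (Hyk := Cpow_nz y k Hy).
replace (2 * j + 1)%nat with (j + j + 1)%nat in * by lia.
replace (2 * j)%nat with (j + j)%nat in * by lia.
rewrite !Cpow_add_r, Cpow_1_r in *.
cbn [qfall]. rewrite !(Cpow_S y), (Cpow_S q k).
generalize dependent (qpoch_inf (e * y * y * q ^ (2 * S j)) q). intros W HW _.
generalize (qpoch_inf (e * q ^ S (S k) * (y * q ^ j)) q). intro E1.
generalize (qpoch_inf (e * y * y * q ^ S j) q). intro E2.
generalize (qpoch_inf (1 * q ^ S j) q). intro E3.
generalize (qpoch_inf (q * y * q ^ S j) q). intro E4.
generalize (qfall (y * q ^ j) q k). intro Q.
generalize dependent (q ^ j). intros s Ha Hb.
generalize dependent (q ^ k). intro p.
field. auto.
Qed.

Lemma Clim_quad1_cert (k : nat) : Clim (quad1_cert k) (qfall 0 q (S k) / y ^ k).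
Proof.
unfold quad1_cert. eapply Clim_eq.
- apply Clim_mult; [apply Clim_mult|].
  + apply Clim_mult; [|apply Clim_const]. apply Clim_qfall. now apply Clim_geom.
  + clim_mult; now apply Clim_qpoch_inf_qpow.
  + apply Clim_qpoch_1; [exact Hq|].
    apply Clim_ext with (fun n => e * q ^ (k + 1) * q ^ n); [|now apply Clim_cqpow].
    intro n. rewrite <- Cmult_assoc, <- Cpow_add_r. do 2 f_equal. lia.
- unfold Cdiv. ring.
Qed.

Lemma Clim_quad2_cert (k : nat) : Clim (quad2_cert k) (qfall 0 q (S k) / y ^ k).
Proof.
unfold quad2_cert. eapply Clim_eq.
- apply Clim_mult; [apply Clim_mult|].
  + apply Clim_mult; [|apply Clim_const]. apply Clim_qfall. now apply Clim_cqpow.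
  + clim_mult; [now apply Clim_qpoch_inf_qpow..|].
    apply Clim_ext with (fun n => qpoch_inf (e * q ^ S k * y * q ^ n) q);
      [intro n; f_equal; ring|now apply Clim_qpoch_inf_qpow].
  + apply Clim_inv; [apply C1_nz|]. apply Clim_qpoch_inf_1; [exact Hq|].
    apply Clim_ext with (fun n => q ^ n * (e * y * y * q ^ n)).
    * intro n. replace (2 * n)%nat with (n + n)%nat by lia. rewrite Cpow_add_r. ring.
    * replace (RtoC 0) with (0 * 0) by ring.
      apply Clim_mult; [now apply Clim_geom|now apply Clim_cqpow].
- field. now apply Cpow_nz.
Qed.

Lemma CSeries_comb (a b : C) (u v w : nat -> C) :
  geo u -> geo v -> geo w ->
  CSeries (fun n => u n - a * v n + b * w n) = CSeries u - a * CSeries v + b * CSeries w.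
Proof.
intros Hu Hv Hw0.
rewrite (CSeries_plus (fun n => u n - a * v n) (fun n => b * w n))
  by auto using geo_scal, geo_minus.
rewrite CSeries_minus by auto using geo_scal.
now rewrite !CSeries_scal.
Qed.

(* The characteristic roots of this recurrence are 1 and 1 / (e y^2); the latter has modulus
   > 1, so a convergent solution is constant. *)
Lemma quad_rec (k : nat) :
  quad k - (1 + e * y * y) * quad (S k) + e * y * y * quad (S (S k)) = 0.
Proof.
assert (H1 := CSeries_telescope _ _ (Clim_quad1_cert k)).
assert (H2 := CSeries_telescope _ _ (Clim_quad2_cert k)).
rewrite (CSeries_ext _ _ (fun j => eq_sym (quad1_telescope k j))) in H1.
rewrite (CSeries_ext _ _ (fun j => eq_sym (quad2_telescope k j))) in H2.
rewrite CSeries_comb in H1 by auto using geo_quad1.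
rewrite CSeries_scal in H2
  by (apply geo_plus; [apply geo_minus|]; auto using geo_quad2, geo_scal).
rewrite CSeries_comb in H2 by auto using geo_quad2.
assert (E1 : quad1_cert k 0 = 0).
{ unfold quad1_cert. rewrite qfall_qpow_eq_0 by lia. unfold Cdiv. ring. }
assert (E2 : quad2_cert k 0 = 0).
{ unfold quad2_cert. change (q ^ 0) with (RtoC 1).
  rewrite (Cmult_1_r 1), qpoch_inf_1_l by exact Hq. ring. }
rewrite E1 in H1. rewrite E2 in H2. unfold quad.
match type of H1 with ?l1 = ?r1 => match type of H2 with ?l2 = ?r2 =>
  transitivity (l1 - l2) end end; [ring|].
rewrite H1, H2. ring.
Qed.

(** The point q^j contributes 0 as soon as k > j, and the majorant in j is uniform in k. *)
Lemma Clim_quad1 : Clim (fun k => CSeries (quad1 k)) 0.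
Proof.
eapply Clim_eq.
- apply (Clim_CSeries_qpow q Hq _ (fun _ => 0)); [apply bounded_quad1|].
  intro j. unfold quad1_factor. apply (is_lim_seq_incr_n _ (S j)).
  apply is_lim_seq_ext with (fun _ => 0%R); [|apply is_lim_seq_const].
  intro n. cbn [fst snd]. rewrite qfall_qpow_eq_0 by lia.
  match goal with |- _ = Cmod ?x => replace x with (RtoC 0) by (unfold Cdiv; ring) end.
  now rewrite Cmod_0.
- rewrite (CSeries_finite _ 0); [reflexivity|]. intros; ring.
Qed.

(** At t = y q^j the quotient [qfall t q k / y ^ k] equals q^(jk) (1/t;q)_k, which tends to 0 unless
    j = 0; only the end point t = y survives in the limit. *)
Lemma Clim_quad2 :
  Clim (fun k => CSeries (quad2 k))
    (qpoch_inf (/ y) q * (qpoch_inf (q * y) q * qpoch_inf q q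
       * qpoch_inf (q * e * y * y) q) / qpoch_inf (e * y * y) q).
Proof.
set (v := fun j : nat => match j with
  | O => qpoch_inf (/ y) q * (qpoch_inf (q * y) q * qpoch_inf q q
       * qpoch_inf (q * e * y * y) q * 1) * / qpoch_inf (e * y * y) q
  | S _ => 0 end).
eapply Clim_eq.
- apply (Clim_CSeries_qpow q Hq _ v); [apply bounded_quad2|].
  assert (Hlast : forall j, Clim (fun n => qpoch_inf (e * q ^ n * (y * q ^ j)) q) 1).
  { intro j. apply Clim_ext with (fun n => qpoch_inf (e * (y * q ^ j) * q ^ n) q);
      [intro n; f_equal; ring|now apply Clim_qpoch_inf_qpow]. }
  assert (Hf : forall j, Clim (fun n => qfall (y * q ^ j) q n / y ^ n)
                 (match j with O => qpoch_inf (/ y) q | S _ => 0 end)).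
  { intro j. apply Clim_ext with (fun n => (q ^ j) ^ n * qpoch (/ (y * q ^ j)) q n).
    - intro n. rewrite qfall_qpoch by (apply Cmult_neq_0; [exact Hy|now apply Cpow_nz]).
      rewrite (Cpow_mult_l y). field. now apply Cpow_nz.
    - destruct j as [|j].
      + apply Clim_ext with (qpoch (/ y) q); [|now apply qpoch_Clim].
        intro n. simpl. rewrite Cpow_1_l, Cmult_1_r. ring.
      + apply Clim_mult_bounded.
        * apply Clim_geom. rewrite Cpow_S, Cmod_mult.
          assert (H1 := Cmod_qpow_le_1 q Hq j). assert (H2 := Cmod_ge_0 q).
          assert (H3 := Cmod_ge_0 (q ^ j)). nra.
        * apply (bounded_Clim _ _ (qpoch_Clim q Hq _)). }
  intro j. specialize (Hf j). unfold quad2_factor. destruct j as [|j]; unfold v.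
  + eapply Clim_eq.
    * apply Clim_mult; [apply Clim_mult; [exact Hf|]|apply Clim_const].
      apply Clim_mult; [apply Clim_const|apply Hlast].
    * simpl. rewrite !Cmult_1_r. reflexivity.
  + eapply Clim_eq.
    * apply Clim_mult; [apply Clim_mult; [exact Hf|]|apply Clim_const].
      apply Clim_mult; [apply Clim_const|apply Hlast].
    * ring.
- rewrite (CSeries_finite _ 1).
  + simpl. unfold Cdiv. ring.
  + intros [|k] Hk; [lia|]. simpl. ring.
Qed.

Lemma quad_eq (k : nat) :
  quad k = qpoch_inf q q * qpoch_inf y q * qpoch_inf (q / y) q / (1 - e * y * y).
Proof.
set (l := qpoch_inf q q * qpoch_inf y q * qpoch_inf (q / y) q / (1 - e * y * y)).
assert (Hw1 : 1 - e * y * y <> 0).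
{ assert (H := qpoch_inf_factor_neq_0 q Hq _ 0 qpoch_inf_w_neq_0).
  now rewrite Cmult_1_r in H. }
assert (Hl : Clim quad l).
{ unfold quad. eapply Clim_eq.
  - apply Clim_minus; [apply Clim_quad1|]. apply Clim_scal, Clim_quad2.
  - unfold l. assert (Hw2 := qpoch_inf_w_neq_0).
    rewrite (qpoch_inf_S_l q Hq (e * y * y)) in *.
    apply Cmult_neq_0_inv in Hw2. destruct Hw2 as [_ Hw2].
    (* The minus sign is absorbed by -y (1 - 1/y) = 1 - y. *)
    rewrite (qpoch_inf_S_l q Hq y), (qpoch_inf_S_l q Hq (/ y)).
    replace (q * e * y * y) with (e * y * y * q) by ring.
    replace (y * q) with (q * y) by ring.
    replace (/ y * q) with (q / y) by (field; exact Hy).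
    field. auto. }
assert (Hd : forall m, quad (S m) = quad m).
(* The differences satisfy d_m = (e y^2)^n d_(m+n) for every n. They are bounded, since [quad]
   converges, and |e y^2| < 1, so all of them are 0. *)
{ assert (Hi : forall n m, quad (S m) - quad m
     = (e * y * y) ^ n * (quad (S (n + m)) - quad (n + m))).
  { induction n as [|n IH]; intro m; [simpl; ring|].
    rewrite IH. assert (H := quad_rec (n + m)).
    change (S n + m)%nat with (S (n + m)).
    rewrite Cpow_S.
    replace (quad (n + m)) with ((1 + e * y * y) * quad (S (n + m))
      - e * y * y * quad (S (S (n + m)))) by
      (match type of H with ?x = _ => transitivity (quad (n + m) - x) end;
        [ring|rewrite H; ring]).
    ring. }
  intro m.
  assert (H0 : quad (S m) - quad m = 0).
  { apply Clim_unique with (fun _ : nat => quad (S m) - quad m); [apply Clim_const|].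
    apply Clim_ext with (1 := fun n => eq_sym (Hi n m)).
    apply Clim_mult_bounded; [now apply Clim_geom|].
    destruct (bounded_Clim _ _ Hl) as [M HM].
    apply bounded_minus; exists M; intro; apply HM. }
  replace (quad (S m)) with (quad (S m) - quad m + quad m) by ring. rewrite H0. ring. }
apply Clim_unique with (fun n => quad (n + k)).
- apply Clim_ext with (fun _ => quad k); [|apply Clim_const].
  induction n as [|n IH]; [reflexivity|]. simpl. now rewrite Hd.
- now apply Clim_shift.
Qed.

End QuadraticKernel.

(** * The two evaluations of the lattice sum *)

(** Shaped for the two expansions: [a] holds the 6phi5 coefficients, [w] is d y, that is z or -az,
    [x] is q, and [h] is the bounded rest of a term on one lattice. *)
Lemma CSeries_interchange (c x w : C) (a : nat -> C) (h : nat -> nat -> C) :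
  (Cmod x < 1)%R -> (Cmod w < 1)%R -> bounded a ->
  bounded (fun i : nat * nat => h (fst i) (snd i)) ->
  CSeries (fun j => c * CSeries (fun k => a k * w ^ k * (x ^ j * h k j)))
  = c * CSeries (fun k => a k * w ^ k * CSeries (fun j => x ^ j * h k j)).
Proof.
intros Hx Hw Ha Hh.
destruct (bounded_mult _ _ (bounded_comp (fst (B := nat)) _ Ha) Hh) as [M HM].
assert (Hb : forall j k,
  (Cmod (a k * w ^ k * (x ^ j * h k j)) <= M * Cmod x ^ j * Cmod w ^ k)%R).
{ intros j k. specialize (HM (k, j)). simpl in HM.
  replace (a k * w ^ k * (x ^ j * h k j)) with (x ^ j * (w ^ k * (a k * h k j))) by ring.
  rewrite (Cmod_mult (x ^ j)), (Cmod_mult (w ^ k)), !Cmod_pow.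
  assert (H1 : (0 <= Cmod x ^ j)%R) by (apply pow_le, Cmod_ge_0).
  assert (H2 : (0 <= Cmod w ^ k)%R) by (apply pow_le, Cmod_ge_0).
  replace (M * Cmod x ^ j * Cmod w ^ k)%R with (Cmod x ^ j * (Cmod w ^ k * M))%R by ring.
  apply Rmult_le_compat_l; [exact H1|]. now apply Rmult_le_compat_l. }
assert (Hx' : (0 <= Cmod x < 1)%R) by (split; [apply Cmod_ge_0|exact Hx]).
assert (Hw' : (0 <= Cmod w < 1)%R) by (split; [apply Cmod_ge_0|exact Hw]).
rewrite CSeries_scal.
- f_equal. rewrite (CSeries_exchange _ M (Cmod x) (Cmod w)) by assumption.
  apply CSeries_ext. intro k. apply CSeries_scal, geo_bounded; [exact Hx|].
  apply (bounded_comp (fun j => (k, j)) _ Hh).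
- exists (M / (1 - Cmod w))%R, (Cmod x). split; [exact Hx'|]. intro j.
  replace (M / (1 - Cmod w) * Cmod x ^ j)%R with (M * Cmod x ^ j / (1 - Cmod w))%R
    by (field; lra).
  now apply CSeries_geo_le.
Qed.

(** Quasi-periodicity of the theta function (y, q/y;q)_oo under y -> y / q^k; [qfall 0 q k * q ^ k]
    is (-1)^k q^(k(k+1)/2). *)
Lemma theta_shift (y q : C) (k : nat) :
  (Cmod q < 1)%R -> q <> 0 -> y <> 0 ->
  qfall 0 q k * q ^ k * (qpoch_inf (y / q ^ k) q * qpoch_inf (q / y * q ^ k) q)
  = y ^ k * (qpoch_inf y q * qpoch_inf (q / y) q).
Proof.
intros Hq Hq0 Hy. induction k as [|k IH].
- simpl. replace (y / 1) with y by field. rewrite !Cmult_1_r. ring.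
- rewrite (Cpow_S y), <- (Cmult_assoc y), <- IH.
  assert (Hk := Cpow_nz q k Hq0).
  rewrite (qpoch_inf_S_l q Hq (y / q ^ S k)), (qpoch_inf_S_l q Hq (q / y * q ^ k)).
  replace (y / q ^ S k * q) with (y / q ^ k) by (rewrite Cpow_S; field; auto).
  replace (q / y * q ^ k * q) with (q / y * q ^ S k) by (rewrite Cpow_S; ring).
  cbn [qfall]. rewrite Cpow_S. field. auto.
Qed.

Section Lattice.

Variables r s y G q : C.
Hypothesis Hr : r ^ 2 = q.
Hypothesis Hq0 : q <> 0.
Hypothesis Hq : (Cmod q < 1)%R.
Hypothesis Hs0 : s <> 0.
Hypothesis Hy0 : y <> 0.
Hypothesis HG0 : G <> 0.
Hypothesis Hz : (Cmod (G * y) < 1)%R.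
Hypothesis Hrsy : (Cmod (r * s * y) < 1)%R.
Hypothesis Hbeta : qpoch_inf (- s * G) q <> 0.
Hypothesis Hqs : qpoch_inf (- (q * s)) q <> 0.

(* With [z = G y], [sqrt(ab) = s] and [r = sqrt q], the two 4phi3 of the theorem are the sums
   over the lattices q^N and y q^N of
   (qt, qt/y, - s G t, q^2 s^2 y t)_oo / (q s t, r s t, - r s t, G t)_oo;
   here [- s G = sqrt(q) b] and [y = - sqrt(a/(qb)) z]. *)
Definition lattice1 (j : nat) : C :=
  q ^ j * (qpoch (q * s) q j * qpoch (r * s) q j * qpoch (- (r * s)) q j * qpoch G q j
           * (qpoch_inf (q * q ^ j) q * qpoch_inf (q / y * q ^ j) q
              * qpoch_inf (- s * G * q ^ j) q
              * qpoch_inf (q * q * s * s * y * q ^ j) q)).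

Definition lattice2 (j : nat) : C :=
  q ^ j * (qpoch_inf (q * s) q * qpoch_inf (r * s) q * qpoch_inf (- (r * s)) q * qpoch_inf G q
           * (/ qpoch_inf (q * s * y * q ^ j) q * / qpoch_inf (r * s * y * q ^ j) q
              * / qpoch_inf (- (r * s) * y * q ^ j) q * / qpoch_inf (G * y * q ^ j) q)
           * (qpoch_inf (q * y * q ^ j) q * qpoch_inf (q * q ^ j) q
              * qpoch_inf (- s * G * y * q ^ j) q
              * qpoch_inf (q * q * s * s * y * y * q ^ j) q)).

(** Up to the factor 1 - q, the q-integral multiplied by (q s, r s, - r s, G;q)_oo; in this form
    zeros of that product do no harm. *)
Definition lattice_sum : C := CSeries lattice1 - y * CSeries lattice2.

Lemma r_neq_0 : r <> 0.
Proof. intro E. apply Hq0. rewrite <- Hr, E. ring. Qed.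

Lemma Cmod_r_lt_1 : (Cmod r < 1)%R.
Proof.
assert (H : (Cmod r * Cmod r < 1)%R).
{ rewrite <- Cmod_mult. replace (r * r) with q by (rewrite <- Hr; ring). exact Hq. }
assert (H0 := Cmod_ge_0 r). nra.
Qed.

Lemma qpoch_inf_z_neq_0 : qpoch_inf (G * y) q <> 0.
Proof. now apply qpoch_inf_neq_0_small. Qed.

Lemma qpoch_inf_rsy_neq_0 : qpoch_inf (r * s * y) q <> 0.
Proof. now apply qpoch_inf_neq_0_small. Qed.

Lemma qpoch_inf_nrsy_neq_0 : qpoch_inf (- (r * s) * y) q <> 0.
Proof.
apply qpoch_inf_neq_0_small; [exact Hq|].
replace (- (r * s) * y) with (- (r * s * y)) by ring. now rewrite Cmod_opp.
Qed.

Lemma Cmod_qsy : (Cmod (q * s * y) < 1)%R.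
Proof.
replace (q * s * y) with (r * (r * s * y)) by (rewrite <- Hr; ring).
rewrite Cmod_mult. assert (H := Cmod_r_lt_1).
assert (H1 := Cmod_ge_0 r). assert (H2 := Cmod_ge_0 (r * s * y)). nra.
Qed.

Lemma qpoch_inf_qsy_neq_0 : qpoch_inf (q * s * y) q <> 0.
Proof. apply qpoch_inf_neq_0_small; [exact Hq|apply Cmod_qsy]. Qed.

Lemma qpoch_inf_nqsy_neq_0 : qpoch_inf (- (q * s) * y) q <> 0.
Proof.
apply qpoch_inf_neq_0_small; [exact Hq|].
replace (- (q * s) * y) with (- (q * s * y)) by ring. rewrite Cmod_opp. apply Cmod_qsy.
Qed.

Lemma Cmod_w : (Cmod (q * s * s * y * y) < 1)%R.
Proof.
replace (q * s * s * y * y) with ((r * s * y) * (r * s * y)) by (rewrite <- Hr; ring).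
rewrite Cmod_mult. assert (H := Cmod_ge_0 (r * s * y)). nra.
Qed.

Lemma qpoch_inf_w_factor :
  qpoch_inf (q * s * s * y * y) q
  = qpoch_inf (r * s * y) q * qpoch_inf (- (r * s) * y) q
    * (qpoch_inf (q * s * y) q * qpoch_inf (- (q * s) * y) q).
Proof.
assert (H := qpoch_inf_double (r * s * y) q r Hq Hr).
replace ((r * s * y) ^ 2) with (q * s * s * y * y) in H by (rewrite <- Hr; ring).
replace (r * (r * s * y)) with (q * s * y) in H by (rewrite <- Hr; ring).
rewrite H. do 2 f_equal; f_equal; ring.
Qed.

Lemma qpoch_inf_qss_factor :
  qpoch_inf (q * s * s) q
  = qpoch_inf (r * s) q * qpoch_inf (- (r * s)) q
    * (qpoch_inf (q * s) q * qpoch_inf (- (q * s)) q).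
Proof.
assert (H := qpoch_inf_double (r * s) q r Hq Hr).
replace ((r * s) ^ 2) with (q * s * s) in H by (rewrite <- Hr; ring).
now replace (r * (r * s)) with (q * s) in H by (rewrite <- Hr; ring).
Qed.

(** * First expansion: from the lattice sum to the 3phi2 *)

Let Bq := - q * s / G.

Lemma Bq_mul_G : Bq * G = - (q * s).
Proof. unfold Bq. field. exact HG0. Qed.

Lemma Bq_s_G_prod : Bq * - s * G = q * s * s.
Proof. unfold Bq. field. exact HG0. Qed.

(** Here [Bq] is sqrt(q) a. The 6phi5 with parameters [Bq], [- s], [G] expands (- s G t, - q s
    t;q)_oo / (G t;q)_oo. The additional (- q s t;q)_oo completes (q s t, r s t, - r s t;q)_oo to (q
    s^2 t^2;q)_oo, the quadratic denominator of [quad]; on q^N this is [qpoch_double]. *)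
Lemma lattice1_L (j : nat) :
  lattice1 j = qpoch_inf (- s * G) q
    * CSeries (fun k => wp_coef Bq (- s) G q k * (G * y) ^ k * quad1 (q * s * s) y q k j).
Proof.
assert (HbG : qpoch_inf (Bq * G) q <> 0) by now rewrite Bq_mul_G.
assert (H := wp_fin_eq Bq (- s) G q Hq Hbeta HbG j).
rewrite Bq_mul_G, Bq_s_G_prod in H.
assert (Hd := qpoch_double (r * s) q r j Hr).
replace ((r * s) ^ 2) with (q * s * s) in Hd by (rewrite <- Hr; ring).
replace (r * (r * s)) with (q * s) in Hd by (rewrite <- Hr; ring).
rewrite Hd in H. clear Hd.
assert (Hn := qpoch_neq_0_of_inf q Hq _ j Hqs).
assert (H' : qpoch (q * s) q j * qpoch (r * s) q j * qpoch (- (r * s)) q j * qpoch G q j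
   = wp_fin Bq (- s) G q j * qpoch (- s * G) q j).
{ transitivity (/ qpoch (- (q * s)) q j * (qpoch (r * s) q j * qpoch (- (r * s)) q j *
    (qpoch (q * s) q j * qpoch (- (q * s)) q j) * qpoch G q j)); [field; exact Hn|].
  rewrite <- H. field. exact Hn. }
unfold lattice1. rewrite H', (qpoch_inf_split q Hq (- s * G) j).
rewrite (CSeries_finite _ (S j)).
2:{ intros k Hk. unfold quad1, quad1_factor. rewrite qfall_qpow_eq_0 by lia. unfold Cdiv. ring. }
unfold wp_fin. rewrite Bq_s_G_prod.
match goal with |- _ = _ * ?c =>
  replace c with (q ^ j * (qpoch_inf (q * q ^ j) q * qpoch_inf (q / y * q ^ j) q
      * qpoch_inf (q * q * s * s * y * q ^ j) q)
    * csum (fun k => wp_coef Bq (- s) G q k * G ^ k * qfall (q ^ j) q k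
                 * qpoch (q * s * s * q ^ (j + k)) q (j - k)) (S j)) end; [ring|].
rewrite <- csum_scal. apply csum_ext. intros k _. unfold quad1, quad1_factor.
rewrite Cpow_mult_l.
replace (q * (q * s * s) * y * q ^ j) with (q * q * s * s * y * q ^ j) by ring.
field. now apply Cpow_nz.
Qed.

Lemma lattice2_L (j : nat) :
  lattice2 j = qpoch_inf (- s * G) q
    * CSeries (fun k => wp_coef Bq (- s) G q k * (G * y) ^ k * quad2 (q * s * s) y q k j).
Proof.
assert (HbG : qpoch_inf (Bq * G) q <> 0) by now rewrite Bq_mul_G.
assert (Hqj := Cpow_nz q j Hq0).
assert (Ht : y * q ^ j <> 0) by now apply Cmult_neq_0.
assert (Hzj : (Cmod (G * (y * q ^ j)) < 1)%R).
{ rewrite Cmult_assoc, Cmod_mult. assert (H1 := Cmod_qpow_le_1 q Hq j).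
  assert (H2 := Cmod_ge_0 (G * y)). assert (H3 := Cmod_ge_0 (q ^ j)). nra. }
assert (H := wp_sum_eq Bq (- s) G q Hq0 Hq Hbeta HbG _ Ht Hzj).
rewrite Bq_mul_G, Bq_s_G_prod, qpoch_inf_qss_factor in H.
replace (G * (y * q ^ j)) with (G * y * q ^ j) in H by ring.
replace (- s * G * (y * q ^ j)) with (- s * G * y * q ^ j) in H by ring.
replace (- (q * s) * (y * q ^ j)) with (- (q * s) * y * q ^ j) in H by ring.
assert (Ew : qpoch_inf (q * s * s * y * y * q ^ (2 * j)) q
  = qpoch_inf (r * s * y * q ^ j) q * qpoch_inf (- (r * s) * y * q ^ j) q
    * (qpoch_inf (q * s * y * q ^ j) q * qpoch_inf (- (q * s) * y * q ^ j) q)).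
{ assert (Hd := qpoch_inf_double (r * s * y * q ^ j) q r Hq Hr).
  replace ((r * s * y * q ^ j) ^ 2) with (q * s * s * y * y * q ^ (2 * j)) in Hd
    by (replace (2 * j)%nat with (j + j)%nat by lia; rewrite Cpow_add_r, <- Hr; ring).
  replace (r * (r * s * y * q ^ j)) with (q * s * y * q ^ j) in Hd by (rewrite <- Hr; ring).
  rewrite Hd. do 2 f_equal; f_equal; ring. }
assert (N1 := qpoch_inf_tail_neq_0 q Hq _ j qpoch_inf_z_neq_0).
assert (N2 := qpoch_inf_tail_neq_0 q Hq _ j qpoch_inf_rsy_neq_0).
assert (N3 := qpoch_inf_tail_neq_0 q Hq _ j qpoch_inf_nrsy_neq_0).
assert (N4 := qpoch_inf_tail_neq_0 q Hq _ j qpoch_inf_qsy_neq_0).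
assert (N5 := qpoch_inf_tail_neq_0 q Hq _ j qpoch_inf_nqsy_neq_0).
set (W := wp_sum Bq (- s) G q (y * q ^ j)) in *.
assert (E : CSeries (fun k => wp_coef Bq (- s) G q k * (G * y) ^ k * quad2 (q * s * s) y q k j)
  = q ^ j * (qpoch_inf (q * y * q ^ j) q * qpoch_inf (q * q ^ j) q
      * qpoch_inf (q * q * s * s * y * y * q ^ j) q
      * / qpoch_inf (q * s * s * y * y * q ^ (2 * j)) q) * W).
{ unfold W, wp_sum. rewrite Bq_s_G_prod, <- CSeries_scal.
  - apply CSeries_ext. intro k. unfold quad2, quad2_factor. rewrite Cpow_mult_l.
    replace (q * (q * s * s) * y * y * q ^ j) with (q * q * s * s * y * y * q ^ j) by ring.
    field. split; [|now apply Cpow_nz]. rewrite Ew. repeat apply Cmult_neq_0; assumption.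
  - apply geo_ext with (fun k => (G * y) ^ k * (wp_coef Bq (- s) G q k
        * (qfall (y * q ^ j) q k / y ^ k) * qpoch_inf (q * s * s * q ^ k * (y * q ^ j)) q)).
    + intro k. now rewrite <- wp_term_eq.
    + apply geo_bounded; [exact Hz|].
      apply bounded_mult; [apply bounded_mult|bdd].
      * now apply (bounded_wp_coef Bq (- s) G q Hq Hbeta HbG (fun k => k)).
      * apply (bounded_qfall q Hq y (fun _ => q ^ j) (fun k => k) Hy0).
        intro; now apply Cmod_qpow_le_1. }
rewrite E, Ew. unfold lattice2.
transitivity (q ^ j * (qpoch_inf (q * y * q ^ j) q * qpoch_inf (q * q ^ j) q
      * qpoch_inf (q * q * s * s * y * y * q ^ j) q)
  * (qpoch_inf (- s * G * y * q ^ j) q * qpoch_inf (- (q * s) * y * q ^ j) q *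
      (qpoch_inf (r * s) q * qpoch_inf (- (r * s)) q *
       (qpoch_inf (q * s) q * qpoch_inf (- (q * s)) q) * qpoch_inf G q))
  * / (qpoch_inf (- (q * s)) q * qpoch_inf (G * y * q ^ j) q)
  * / (qpoch_inf (r * s * y * q ^ j) q * qpoch_inf (- (r * s) * y * q ^ j) q
    * (qpoch_inf (q * s * y * q ^ j) q * qpoch_inf (- (q * s) * y * q ^ j) q))).
- field. repeat split; assumption.
- rewrite <- H. field. repeat split; assumption.
Qed.

Lemma lattice_sum_L :
  lattice_sum * (1 - q * s * s * y * y)
  = qpoch_inf (- s * G) q * (qpoch_inf q q * qpoch_inf y q * qpoch_inf (q / y) q)
    * CSeries (fun k => wp_coef Bq (- s) G q k * (G * y) ^ k).
Proof.
assert (HbG : qpoch_inf (Bq * G) q <> 0) by now rewrite Bq_mul_G.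
assert (Hw : (Cmod (q * s * s * y * y) < 1)%R) by apply Cmod_w.
assert (Hw1 : 1 - q * s * s * y * y <> 0).
{ assert (H := qpoch_inf_factor_neq_0 q Hq _ 0 (qpoch_inf_neq_0_small q Hq _ Hw)).
  now rewrite Cmult_1_r in H. }
assert (Hc : bounded (wp_coef Bq (- s) G q)).
{ now apply (bounded_wp_coef Bq (- s) G q Hq Hbeta HbG (fun k => k)). }
assert (B1 := bounded_quad1 (q * s * s) y q Hq0 Hq Hy0).
assert (B2 := bounded_quad2 (q * s * s) y q Hq Hy0 Hw).
assert (E1 : CSeries lattice1 = qpoch_inf (- s * G) q
  * CSeries (fun k => wp_coef Bq (- s) G q k * (G * y) ^ k * CSeries (quad1 (q * s * s) y q k))).
{ rewrite (CSeries_ext _ _ lattice1_L).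
  now apply (CSeries_interchange _ q (G * y) _ (quad1_factor (q * s * s) y q)). }
assert (E2 : CSeries lattice2 = qpoch_inf (- s * G) q
  * CSeries (fun k => wp_coef Bq (- s) G q k * (G * y) ^ k * CSeries (quad2 (q * s * s) y q k))).
{ rewrite (CSeries_ext _ _ lattice2_L).
  now apply (CSeries_interchange _ q (G * y) _ (quad2_factor (q * s * s) y q)). }
assert (Hgeo : forall u : nat -> C, bounded u ->
  geo (fun k => wp_coef Bq (- s) G q k * (G * y) ^ k * u k)).
{ intros u Hu. apply geo_ext with (fun k => (G * y) ^ k * (wp_coef Bq (- s) G q k * u k)).
  - intro k. ring.
  - apply geo_bounded; [exact Hz|now apply bounded_mult]. }
assert (G1 := Hgeo _ (bounded_CSeries q (quad1_factor (q * s * s) y q) Hq B1)).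
assert (G2 := Hgeo _ (bounded_CSeries q (quad2_factor (q * s * s) y q) Hq B2)).
unfold lattice_sum. rewrite E1, E2. clear E1 E2.
match goal with |- (?c * ?X - ?y * (?c * ?Y)) * ?d = _ =>
  transitivity (c * d * (X - y * Y)); [ring|] end.
rewrite <- (CSeries_scal y), <- CSeries_minus by (try apply geo_scal; assumption).
(* By [quad_eq] the inner q-integral does not depend on [k] and leaves the series as a constant. *)
rewrite (CSeries_ext _ (fun k => qpoch_inf q q * qpoch_inf y q * qpoch_inf (q / y) q
   / (1 - q * s * s * y * y) * (wp_coef Bq (- s) G q k * (G * y) ^ k))).
- rewrite CSeries_scal.
  + field. exact Hw1.
  + apply geo_ext with (fun k => wp_coef Bq (- s) G q k * (G * y) ^ k * 1); [intro; ring|].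
    apply Hgeo, bounded_const.
- intro k. rewrite <- (quad_eq (q * s * s) y q Hq0 Hq Hy0 Hw k). unfold quad. ring.
Qed.

(** * Second expansion: from the lattice sum to the 8W7 *)

Let bR := - G / r.
Let cR := q * r * s * y.

Lemma cR_mul_rs : cR * (r * s) = q * q * s * s * y.
Proof. unfold cR. rewrite <- Hr. ring. Qed.

Lemma bR_mul_rs : bR * (r * s) = - s * G.
Proof. unfold bR. field. apply r_neq_0. Qed.

Lemma bR_cR_rs_prod : bR * cR * (r * s) = - q * r * s * s * G * y.
Proof. unfold bR, cR. field. apply r_neq_0. Qed.

Hypothesis Hkappa : qpoch_inf (q * q * s * s * y) q <> 0.
Hypothesis He : qpoch_inf (- q * r * s * s * G * y) q <> 0.

Definition watson1_factor (k j : nat) : C :=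
  qfall (q ^ j) q k / y ^ k
  * (qpoch (q * s) q j * qpoch (- (r * s)) q j * qpoch G q j)
  * (qpoch_inf (q * q ^ j) q * qpoch_inf (q / y * q ^ j) q
     * qpoch_inf (- q * r * s * s * G * y * q ^ k * q ^ j) q).

Definition watson2_factor (k j : nat) : C :=
  qfall (y * q ^ j) q k / y ^ k
  * (qpoch_inf (q * s) q * qpoch_inf (- (r * s)) q * qpoch_inf G q)
  * (/ qpoch_inf (q * s * y * q ^ j) q * / qpoch_inf (- (r * s) * y * q ^ j) q
     * / qpoch_inf (G * y * q ^ j) q)
  * (qpoch_inf (q * y * q ^ j) q * qpoch_inf (q * q ^ j) q
     * qpoch_inf (- q * r * s * s * G * y * q ^ k * (y * q ^ j)) q).

Lemma bounded_watson1 : bounded (fun i : nat * nat => watson1_factor (fst i) (snd i)).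
Proof.
unfold watson1_factor.
apply bounded_mult; [apply bounded_mult|]; [|bdd|bdd].
now apply bounded_qfall_lattice.
Qed.

Lemma bounded_watson2 : bounded (fun i : nat * nat => watson2_factor (fst i) (snd i)).
Proof.
unfold watson2_factor.
apply bounded_mult; [apply bounded_mult; [apply bounded_mult|]|]; [|bdd| |bdd].
- apply (bounded_qfall q Hq y (fun i : nat * nat => q ^ snd i) fst Hy0).
  intro; now apply Cmod_qpow_le_1.
- bdd; auto using qpoch_inf_qsy_neq_0, qpoch_inf_nrsy_neq_0, qpoch_inf_z_neq_0.
Qed.

Let cst := qpoch_inf (q * q * s * s * y) q * qpoch_inf (- s * G) q
  / qpoch_inf (- q * r * s * s * G * y) q.

(** In the original parameters [bR] is sqrt(b/a), [cR] is -qaz and [r * s * y] is -az. Both lattices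
    use this form, with [w] collecting what does not depend on [k]. *)
Lemma wp_sum_R (t : C) (u : nat -> C) (w : C) :
  bounded (fun k => qfall t q k / y ^ k) ->
  (forall k, u k = w * (qfall t q k / y ^ k
                        * qpoch_inf (- q * r * s * s * G * y * q ^ k * t) q)) ->
  CSeries (fun k => wp_coef bR cR (r * s) q k * (r * s * y) ^ k * u k)
  = w * wp_sum bR cR (r * s) q t.
Proof.
assert (Hb' : qpoch_inf (bR * (r * s)) q <> 0) by now rewrite bR_mul_rs.
assert (Hc' : qpoch_inf (cR * (r * s)) q <> 0) by now rewrite cR_mul_rs.
intros Hb H. unfold wp_sum. rewrite bR_cR_rs_prod, <- CSeries_scal.
- apply CSeries_ext. intro k. rewrite H, (Cpow_mult_l (r * s)). field. now apply Cpow_nz.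
- apply geo_ext with (fun k => (r * s * y) ^ k * (wp_coef bR cR (r * s) q k
    * (qfall t q k / y ^ k) * qpoch_inf (- q * r * s * s * G * y * q ^ k * t) q)).
  + intro k. rewrite (Cpow_mult_l (r * s)). field. now apply Cpow_nz.
  + apply geo_bounded; [exact Hrsy|].
    apply bounded_mult; [apply bounded_mult|bdd].
    * now apply (bounded_wp_coef bR cR (r * s) q Hq Hc' Hb' (fun k => k)).
    * exact Hb.
Qed.

Lemma lattice1_R (j : nat) :
  lattice1 j = cst * CSeries (fun k => wp_coef bR cR (r * s) q k * (r * s * y) ^ k
                                       * (q ^ j * watson1_factor k j)).
Proof.
assert (Hb' : qpoch_inf (bR * (r * s)) q <> 0) by now rewrite bR_mul_rs.
assert (Hc' : qpoch_inf (cR * (r * s)) q <> 0) by now rewrite cR_mul_rs.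
assert (H := wp_sum_lattice bR cR (r * s) q Hq Hc' Hb' j).
rewrite bR_mul_rs, cR_mul_rs, bR_cR_rs_prod in H.
rewrite (wp_sum_R (q ^ j) _ (q ^ j * (qpoch (q * s) q j * qpoch (- (r * s)) q j * qpoch G q j)
  * (qpoch_inf (q * q ^ j) q * qpoch_inf (q / y * q ^ j) q))).
- unfold lattice1, cst.
  rewrite (qpoch_inf_split q Hq (- s * G) j), (qpoch_inf_split q Hq (q * q * s * s * y) j).
  transitivity (q ^ j * (qpoch (q * s) q j * qpoch (- (r * s)) q j * qpoch G q j)
    * (qpoch_inf (q * q ^ j) q * qpoch_inf (q / y * q ^ j) q)
    * (qpoch_inf (- s * G * q ^ j) q * qpoch_inf (q * q * s * s * y * q ^ j) q)
    / qpoch_inf (- q * r * s * s * G * y) q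
    * (qpoch_inf (- q * r * s * s * G * y) q * qpoch (r * s) q j)); [field; exact He|].
  rewrite <- H. field. exact He.
- now apply (bounded_qfall_lattice q Hq y (fun _ => j) (fun k => k)).
- intro k. unfold watson1_factor. ring.
Qed.

Lemma lattice2_R (j : nat) :
  lattice2 j = cst * CSeries (fun k => wp_coef bR cR (r * s) q k * (r * s * y) ^ k
                                       * (q ^ j * watson2_factor k j)).
Proof.
assert (Hb' : qpoch_inf (bR * (r * s)) q <> 0) by now rewrite bR_mul_rs.
assert (Hc' : qpoch_inf (cR * (r * s)) q <> 0) by now rewrite cR_mul_rs.
assert (Ht : y * q ^ j <> 0) by (apply Cmult_neq_0; [exact Hy0|now apply Cpow_nz]).
assert (Hzj : (Cmod (r * s * (y * q ^ j)) < 1)%R).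
{ rewrite Cmult_assoc, Cmod_mult. assert (H1 := Cmod_qpow_le_1 q Hq j).
  assert (H2 := Cmod_ge_0 (r * s * y)). assert (H3 := Cmod_ge_0 (q ^ j)). nra. }
assert (H := wp_sum_eq bR cR (r * s) q Hq0 Hq Hc' Hb' _ Ht Hzj).
rewrite bR_mul_rs, cR_mul_rs, bR_cR_rs_prod in H.
replace (r * s * (y * q ^ j)) with (r * s * y * q ^ j) in H by ring.
replace (- s * G * (y * q ^ j)) with (- s * G * y * q ^ j) in H by ring.
replace (q * q * s * s * y * (y * q ^ j)) with (q * q * s * s * y * y * q ^ j) in H by ring.
assert (N1 := qpoch_inf_tail_neq_0 q Hq _ j qpoch_inf_z_neq_0).
assert (N2 := qpoch_inf_tail_neq_0 q Hq _ j qpoch_inf_rsy_neq_0).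
assert (N3 := qpoch_inf_tail_neq_0 q Hq _ j qpoch_inf_nrsy_neq_0).
assert (N4 := qpoch_inf_tail_neq_0 q Hq _ j qpoch_inf_qsy_neq_0).
rewrite (wp_sum_R (y * q ^ j) _ (q ^ j
  * (qpoch_inf (q * s) q * qpoch_inf (- (r * s)) q * qpoch_inf G q)
  * (/ qpoch_inf (q * s * y * q ^ j) q * / qpoch_inf (- (r * s) * y * q ^ j) q
     * / qpoch_inf (G * y * q ^ j) q)
  * (qpoch_inf (q * y * q ^ j) q * qpoch_inf (q * q ^ j) q))).
- unfold lattice2, cst.
  set (W := wp_sum bR cR (r * s) q (y * q ^ j)) in *.
  transitivity (q ^ j
  * (qpoch_inf (q * s) q * qpoch_inf (- (r * s)) q * qpoch_inf G q)
  * (/ qpoch_inf (q * s * y * q ^ j) q * / qpoch_inf (- (r * s) * y * q ^ j) q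
     * / qpoch_inf (G * y * q ^ j) q)
  * (qpoch_inf (q * y * q ^ j) q * qpoch_inf (q * q ^ j) q)
  / (qpoch_inf (r * s * y * q ^ j) q * qpoch_inf (- q * r * s * s * G * y) q)
  * (qpoch_inf (q * q * s * s * y * y * q ^ j) q * qpoch_inf (- s * G * y * q ^ j) q
     * (qpoch_inf (- q * r * s * s * G * y) q * qpoch_inf (r * s) q))).
  + field. repeat split; assumption.
  + rewrite <- H. field. repeat split; assumption.
- apply (bounded_qfall q Hq y (fun _ => q ^ j) (fun k => k) Hy0).
  intro; now apply Cmod_qpow_le_1.
- intro k. unfold watson2_factor. ring.
Qed.

Hypothesis Hy : qpoch_inf y q <> 0.
Hypothesis Hyi : qpoch_inf (/ y) q <> 0.

(** A zero would mean y q^i = 1 with i >= 0, excluded by [Hy], or y = q^i with i >= 1, excluded by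
    [Hyi]. *)
Lemma qpoch_inf_y_div_neq_0 (k : nat) : qpoch_inf (y / q ^ k) q <> 0.
Proof.
induction k as [|k IH].
- now replace (y / q ^ 0) with y by (simpl; field).
- assert (Hk := Cpow_nz q k Hq0).
  rewrite qpoch_inf_S_l by exact Hq. apply Cmult_neq_0.
  + intro E. apply (qpoch_inf_factor_neq_0 q Hq _ (S k) Hyi).
    replace (1 - / y * q ^ S k) with (- (1 - y / q ^ S k) * (q ^ S k / y))
      by (rewrite Cpow_S; field; auto).
    rewrite E. ring.
  + now replace (y / q ^ S k * q) with (y / q ^ k) by (rewrite Cpow_S; field; auto).
Qed.

Lemma geo_watson1 (k : nat) : geo (fun j => q ^ j * watson1_factor k j).
Proof.
apply geo_bounded; [exact Hq|]. apply (bounded_comp (fun j => (k, j)) _ bounded_watson1).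
Qed.

(** Substitution t -> q^k t. On q^N the points j < k drop out because [qfall] vanishes there; on y
    q^N the end point becomes y / q^k. The parameters q s, - r s, G each absorb q^k, and their
    product with y / q^k is - q r s^2 G y q^(2k), which is the balance that [saal] requires. *)
Lemma watson_saal (k : nat) :
  CSeries (fun j => q ^ j * watson1_factor k j) - y * CSeries (fun j => q ^ j * watson2_factor k j)
  = qfall 0 q k * q ^ k / y ^ k * (qpoch (q * s) q k * qpoch (- (r * s)) q k * qpoch G q k)
    * saal (- (r * s) * q ^ k) (G * q ^ k) (y / q ^ k) q (q * s * q ^ k).
Proof.
assert (Hk := Cpow_nz q k Hq0). assert (Hyk := Cpow_nz y k Hy0).
assert (HyA : qpoch_inf (q * s * q ^ k * (y / q ^ k)) q <> 0).
{ replace (q * s * q ^ k * (y / q ^ k)) with (q * s * y) by (field; exact Hk).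
  apply qpoch_inf_qsy_neq_0. }
assert (HyB : qpoch_inf (- (r * s) * q ^ k * (y / q ^ k)) q <> 0).
{ replace (- (r * s) * q ^ k * (y / q ^ k)) with (- (r * s) * y) by (field; exact Hk).
  apply qpoch_inf_nrsy_neq_0. }
assert (HyC : qpoch_inf (G * q ^ k * (y / q ^ k)) q <> 0).
{ replace (G * q ^ k * (y / q ^ k)) with (G * y) by (field; exact Hk).
  apply qpoch_inf_z_neq_0. }
set (c := qfall 0 q k * q ^ k / y ^ k
   * (qpoch (q * s) q k * qpoch (- (r * s)) q k * qpoch G q k)).
assert (E1 : CSeries (fun j => q ^ j * watson1_factor k j)
  = c * CSeries (saal1 (- (r * s) * q ^ k) (G * q ^ k) (y / q ^ k) q (q * s * q ^ k))).
{ rewrite (CSeries_split _ k) by apply geo_watson1.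
  rewrite (csum_ext _ (fun _ => 0)), csum_const0.
  2:{ intros j Hj. unfold watson1_factor. rewrite qfall_qpow_eq_0 by exact Hj.
      unfold Cdiv. ring. }
  rewrite Cplus_0_l, <- CSeries_scal by now apply geo_saal1.
  apply CSeries_ext. intro i. unfold watson1_factor, saal1, c.
  replace (i + k)%nat with (k + i)%nat by lia.
  rewrite !qpoch_add.
  replace (q ^ (k + i)) with (q ^ i * q ^ k) by (rewrite Cpow_add_r; ring).
  rewrite qfall_mul_qpow.
  replace (qpoch_inf (q * q ^ i) q)
    with (qpoch (q ^ i * q) q k * qpoch_inf (q * (q ^ i * q ^ k)) q).
  2:{ rewrite (Cmult_comm (q ^ i) q), (qpoch_inf_split q Hq (q * q ^ i) k).
      f_equal. f_equal. ring. }
  replace (q / (y / q ^ k) * q ^ i) with (q / y * (q ^ i * q ^ k)) by (field; auto).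
  replace (q * s * q ^ k * (- (r * s) * q ^ k) * (G * q ^ k) * (y / q ^ k) * q ^ i)
    with (- q * r * s * s * G * y * q ^ k * (q ^ i * q ^ k)) by (field; exact Hk).
  field. exact Hyk. }
assert (E2 : y * CSeries (fun j => q ^ j * watson2_factor k j)
  = c * (y / q ^ k * CSeries (saal2 (- (r * s) * q ^ k) (G * q ^ k) (y / q ^ k) q (q * s * q ^ k)))).
{ rewrite Cmult_assoc, <- !CSeries_scal.
  2:{ now apply geo_saal2. }
  2:{ apply geo_bounded; [exact Hq|]. apply (bounded_comp (fun j => (k, j)) _ bounded_watson2). }
  apply CSeries_ext. intro j. unfold watson2_factor, saal2, c.
  rewrite (qpoch_inf_split q Hq (q * s) k), (qpoch_inf_split q Hq (- (r * s)) k),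
    (qpoch_inf_split q Hq G k).
  replace (y * q ^ j) with (y / q ^ k * q ^ j * q ^ k) at 1 by (field; exact Hk).
  rewrite qfall_mul_qpow.
  replace (qpoch_inf (y / q ^ k * q * q ^ j) q)
    with (qpoch (y / q ^ k * q ^ j * q) q k * qpoch_inf (q * y * q ^ j) q).
  2:{ replace (y / q ^ k * q * q ^ j) with (y / q ^ k * q ^ j * q) by ring.
      rewrite (qpoch_inf_split q Hq (y / q ^ k * q ^ j * q) k).
      f_equal. f_equal. field. exact Hk. }
  replace (q * s * q ^ k * (y / q ^ k) * q ^ j) with (q * s * y * q ^ j) by (field; exact Hk).
  replace (- (r * s) * q ^ k * (y / q ^ k) * q ^ j) with (- (r * s) * y * q ^ j)
    by (field; exact Hk).
  replace (G * q ^ k * (y / q ^ k) * q ^ j) with (G * y * q ^ j) by (field; exact Hk).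
  replace (q * s * q ^ k * (- (r * s) * q ^ k) * (G * q ^ k) * (y / q ^ k) * (y / q ^ k) * q ^ j)
    with (- q * r * s * s * G * y * q ^ k * (y * q ^ j)) by (field; exact Hk).
  assert (N1 := qpoch_inf_tail_neq_0 q Hq _ j qpoch_inf_z_neq_0).
  assert (N3 := qpoch_inf_tail_neq_0 q Hq _ j qpoch_inf_nrsy_neq_0).
  assert (N4 := qpoch_inf_tail_neq_0 q Hq _ j qpoch_inf_qsy_neq_0).
  field. repeat split; assumption. }
rewrite E1, E2. unfold saal. ring.
Qed.

Lemma lattice_sum_R :
  lattice_sum * (qpoch_inf (- q * r * s * s * G * y) q
     * (qpoch_inf (q * s * y) q * qpoch_inf (- (r * s) * y) q * qpoch_inf (G * y) q))
  = qpoch_inf (q * q * s * s * y) q * qpoch_inf (- s * G) q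
    * (qpoch_inf q q * qpoch_inf y q * qpoch_inf (q / y) q)
    * CSeries (fun k => wp_coef bR cR (r * s) q k * (r * s * y) ^ k
        * (qpoch (q * s) q k * qpoch (- (r * s)) q k * qpoch G q k
           * (qpoch_inf (- q * r * s * s * y * q ^ k) q * qpoch_inf (q * s * (G * y) * q ^ k) q
              * qpoch_inf (- r * s * (G * y) * q ^ k) q))).
Proof.
assert (Hb' : qpoch_inf (bR * (r * s)) q <> 0) by now rewrite bR_mul_rs.
assert (Hc' : qpoch_inf (cR * (r * s)) q <> 0) by now rewrite cR_mul_rs.
assert (Hc : bounded (wp_coef bR cR (r * s) q)).
{ now apply (bounded_wp_coef bR cR (r * s) q Hq Hc' Hb' (fun k => k)). }
assert (E1 : CSeries lattice1 = cst
  * CSeries (fun k => wp_coef bR cR (r * s) q k * (r * s * y) ^ k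
                      * CSeries (fun j => q ^ j * watson1_factor k j))).
{ rewrite (CSeries_ext _ _ lattice1_R).
  apply (CSeries_interchange _ q (r * s * y) _ watson1_factor); auto using bounded_watson1. }
assert (E2 : CSeries lattice2 = cst
  * CSeries (fun k => wp_coef bR cR (r * s) q k * (r * s * y) ^ k
                      * CSeries (fun j => q ^ j * watson2_factor k j))).
{ rewrite (CSeries_ext _ _ lattice2_R).
  apply (CSeries_interchange _ q (r * s * y) _ watson2_factor); auto using bounded_watson2. }
assert (Hgeo : forall u : nat -> C, bounded u ->
  geo (fun k => wp_coef bR cR (r * s) q k * (r * s * y) ^ k * u k)).
{ intros u Hu. apply geo_ext with (fun k => (r * s * y) ^ k * (wp_coef bR cR (r * s) q k * u k)).
  - intro k. ring.
  - apply geo_bounded; [exact Hrsy|now apply bounded_mult]. }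
assert (G1 := Hgeo _ (bounded_CSeries q watson1_factor Hq bounded_watson1)).
assert (G2 := Hgeo _ (bounded_CSeries q watson2_factor Hq bounded_watson2)).
unfold lattice_sum. rewrite E1, E2. clear E1 E2.
match goal with |- (?c * ?X - ?y * (?c * ?Y)) * (?e * ?d) = _ =>
  transitivity (c * e * d * (X - y * Y)); [ring|] end.
rewrite <- (CSeries_scal y), <- CSeries_minus by (try apply geo_scal; assumption).
set (d := qpoch_inf (q * s * y) q * qpoch_inf (- (r * s) * y) q * qpoch_inf (G * y) q).
assert (Hd : d <> 0).
{ unfold d. repeat apply Cmult_neq_0;
    auto using qpoch_inf_qsy_neq_0, qpoch_inf_nrsy_neq_0, qpoch_inf_z_neq_0. }
rewrite (CSeries_ext _ (fun k => (qpoch_inf q q * qpoch_inf y q * qpoch_inf (q / y) q) / d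
  * (wp_coef bR cR (r * s) q k * (r * s * y) ^ k
        * (qpoch (q * s) q k * qpoch (- (r * s)) q k * qpoch G q k
           * (qpoch_inf (- q * r * s * s * y * q ^ k) q * qpoch_inf (q * s * (G * y) * q ^ k) q
              * qpoch_inf (- r * s * (G * y) * q ^ k) q))))).
- rewrite CSeries_scal.
  + unfold cst. field. auto.
  + apply Hgeo. bdd.
- intro k.
  transitivity (wp_coef bR cR (r * s) q k * (r * s * y) ^ k *
    (CSeries (fun j => q ^ j * watson1_factor k j) - y * CSeries (fun j => q ^ j * watson2_factor k j)));
    [ring|].
  rewrite watson_saal.
  assert (Hk := Cpow_nz q k Hq0). assert (Hyk := Cpow_nz y k Hy0).
  assert (EA : q * s * q ^ k * (y / q ^ k) = q * s * y) by (field; exact Hk).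
  assert (EB : - (r * s) * q ^ k * (y / q ^ k) = - (r * s) * y) by (field; exact Hk).
  assert (EC : G * q ^ k * (y / q ^ k) = G * y) by (field; exact Hk).
  assert (Hyq0 : y / q ^ k <> 0).
  { intro E. apply Hy0. replace y with (y / q ^ k * q ^ k) by (field; exact Hk).
    rewrite E. ring. }
  assert (NA := qpoch_inf_qsy_neq_0). rewrite <- EA in NA.
  assert (NB := qpoch_inf_nrsy_neq_0). rewrite <- EB in NB.
  assert (NC := qpoch_inf_z_neq_0). rewrite <- EC in NC.
  assert (HS := saal_eq (- (r * s) * q ^ k) (G * q ^ k) (y / q ^ k) q Hq Hyq0
    (qpoch_inf_y_div_neq_0 k) NB NC (q * s * q ^ k) NA).
  rewrite EA, EB, EC in HS. fold d in HS.
  replace (q / (y / q ^ k)) with (q / y * q ^ k) in HS by (field; auto).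
  replace (q * s * q ^ k * (- (r * s) * q ^ k) * (y / q ^ k))
    with (- q * r * s * s * y * q ^ k) in HS by (field; exact Hk).
  replace (q * s * q ^ k * (G * q ^ k) * (y / q ^ k))
    with (q * s * (G * y) * q ^ k) in HS by (field; exact Hk).
  replace (- (r * s) * q ^ k * (G * q ^ k) * (y / q ^ k))
    with (- r * s * (G * y) * q ^ k) in HS by (field; exact Hk).
  set (S := saal (- (r * s) * q ^ k) (G * q ^ k) (y / q ^ k) q (q * s * q ^ k)) in *.
  (* Quasi-periodicity absorbs [qfall 0 q k * q ^ k / y ^ k], so that a theta product independent of
     [k] is left. *)
  assert (HT := theta_shift y q k Hq Hq0 Hy0).
  transitivity (wp_coef bR cR (r * s) q k * (r * s * y) ^ k
    * (qpoch (q * s) q k * qpoch (- (r * s)) q k * qpoch G q k)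
    * (qfall 0 q k * q ^ k / y ^ k) / d * (d * S)); [field; auto|].
  rewrite HS.
  match goal with |- _ = _ / d * (?W * ?rsy * (?P * ?Q)) =>
    transitivity (W * rsy * P * Q * qpoch_inf q q / d / y ^ k
      * (qfall 0 q k * q ^ k * (qpoch_inf (y / q ^ k) q * qpoch_inf (q / y * q ^ k) q)));
    [field; auto|] end.
  rewrite HT. field. auto.
Qed.

End Lattice.

(** * Translation to hypergeometric series *)

(** For the base s^2 = ab the very-well-poised factor is (q s, - q s;q)_k / (s, - s;q)_k. The
    numerator parameter [- s] cancels (- s;q)_k and the denominator (- q s;q)_k cancels its
    counterpart, which leaves a 3phi2. *)
Lemma phi_wp (s G q z : C) :
  G <> 0 ->
  (forall k, qpoch q q k <> 0) -> (forall k, qpoch s q k <> 0) ->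
  (forall k, qpoch (- s * G) q k <> 0) -> (forall k, qpoch (- (q * s)) q k <> 0) ->
  phi [s * s; - q * s / G; q * s] [- s * G; s] q z
  = CSeries (fun k => wp_coef (- q * s / G) (- s) G q k * z ^ k).
Proof.
intros HG Hq Hs Hb Hqs. unfold phi. apply CSeries_ext. intro k. f_equal.
unfold qpochs, wp_coef. cbn [fold_right]. destruct k as [|m].
- simpl. field.
- replace (- q * s / G * - s * G) with (s * s * q) by (field; exact HG).
  replace (- q * s / G * G) with (- (q * s)) by (field; exact HG).
  rewrite (qpoch_S_l (s * s)).
  assert (Es : qpoch s q (S m) * (1 - s * q ^ S m) = (1 - s) * qpoch (q * s) q (S m)).
  { change (qpoch s q (S (S m)) = (1 - s) * qpoch (q * s) q (S m)).
    rewrite qpoch_S_l. now rewrite (Cmult_comm s q). }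
  assert (Ens : qpoch (- s) q (S m) * (1 + s * q ^ S m) = (1 + s) * qpoch (- (q * s)) q (S m)).
  { transitivity (qpoch (- s) q (S (S m))); [cbn [qpoch]; ring|].
    rewrite qpoch_S_l. replace (- s * q) with (- (q * s)) by ring. ring. }
  assert (Hs1 : 1 - s <> 0).
  { assert (H := qpoch_factor_neq_0 s q 0 (Hs 1%nat)). now rewrite Cmult_1_r in H. }
  assert (Hqs' : 1 + s * q ^ S m <> 0).
  { assert (H := qpoch_factor_neq_0 _ q m (Hqs (S m))).
    replace (1 - - (q * s) * q ^ m) with (1 + s * q ^ S m) in H by (rewrite Cpow_S; ring).
    exact H. }
  assert (E1 : qpoch (q * s) q (S m) = qpoch s q (S m) * (1 - s * q ^ S m) / (1 - s))
    by (rewrite Es; field; exact Hs1).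
  (* [1 + s] may vanish, so (- s;q) is expressed through (- q s;q) and not conversely. *)
  assert (E2 : qpoch (- s) q (S m) = (1 + s) * qpoch (- (q * s)) q (S m) / (1 + s * q ^ S m))
    by (rewrite <- Ens; field; exact Hqs').
  rewrite E1, E2.
  replace (q ^ (2 * m + 1)) with (q ^ S m * q ^ m)
    by (rewrite <- Cpow_add_r; f_equal; lia).
  replace (s * s * q * (q ^ S m * q ^ m)) with (s * s * (q ^ S m * q ^ S m))
    by (rewrite !Cpow_S; ring).
  assert (N1 := Hq (S m)). assert (N2 := Hs (S m)). assert (N3 := Hb (S m)).
  assert (N4 := Hqs (S m)).
  generalize dependent (qpoch q q (S m)). generalize dependent (qpoch s q (S m)).
  generalize dependent (qpoch (- s * G) q (S m)).
  generalize dependent (qpoch (- (q * s)) q (S m)).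
  intros. set (p := q ^ S m) in *. field. repeat split; assumption.
Qed.

(** The base times q is the product b c d of [wp_coef]. The parameters q s, - r s, G, which are
    absent from [wp_coef], form the additional quotient with their three denominators; the
    nonvanishing of these is extracted for [W87_lattice_sum], which passes to the infinite
    products. *)
Lemma W87_wp (r s y G q : C) :
  r ^ 2 = q -> q <> 0 -> s <> 0 -> y <> 0 -> G <> 0 ->
  W87_denominators_nonzero (- r * s * s * G * y)
    (q * s) (- (r * s)) (- G / r) G (q * r * s * y) q ->
  W87 (- r * s * s * G * y) (q * s) (- (r * s)) (- G / r) G (q * r * s * y) q (r * s * y)
  = CSeries (fun k => wp_coef (- G / r) (q * r * s * y) (r * s) q k * (r * s * y) ^ k
      * (qpoch (q * s) q k * qpoch (- (r * s)) q k * qpoch G q k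
         / (qpoch (- r * s * (G * y)) q k * qpoch (q * s * (G * y)) q k
            * qpoch (- q * r * s * s * y) q k)))
  /\ (forall k, qpoch (- r * s * (G * y)) q k <> 0)
  /\ (forall k, qpoch (q * s * (G * y)) q k <> 0)
  /\ (forall k, qpoch (- q * r * s * s * y) q k <> 0).
Proof.
intros Hr Hq Hs Hy HG [H1 H].
assert (Hr0 : r <> 0) by (intro E; apply Hq; rewrite <- Hr, E; ring).
unfold W87, W87_den, qpochs in *. cbn [fold_right] in *.
replace (q * (- r * s * s * G * y) / (q * s)) with (- r * s * (G * y)) in * by (field; auto).
replace (q * (- r * s * s * G * y) / - (r * s)) with (q * s * (G * y)) in * by (field; auto).
replace (q * (- r * s * s * G * y) / (- G / r)) with (q * q * s * s * y) in *
  by (rewrite <- Hr; field; auto).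
replace (q * (- r * s * s * G * y) / G) with (- q * r * s * s * y) in * by (field; auto).
replace (q * (- r * s * s * G * y) / (q * r * s * y)) with (- s * G) in * by (field; auto).
assert (Hn : forall k, qpoch q q k <> 0 /\ qpoch (- r * s * (G * y)) q k <> 0
  /\ qpoch (q * s * (G * y)) q k <> 0 /\ qpoch (q * q * s * s * y) q k <> 0
  /\ qpoch (- q * r * s * s * y) q k <> 0 /\ qpoch (- s * G) q k <> 0).
{ intro k. specialize (H k).
  repeat (let H' := fresh in apply Cmult_neq_0_inv in H; destruct H as [H' H]). auto 10. }
split; [|repeat split; apply Hn].
apply CSeries_ext. intro k.
destruct (Hn k) as (N1 & N2 & N3 & N4 & N5 & N6).
unfold wp_coef.
replace (q * r * s * y * (r * s)) with (q * q * s * s * y) by (rewrite <- Hr; ring).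
replace (- G / r * (r * s)) with (- s * G) by (field; auto).
replace (- G / r * (q * r * s * y) * (r * s)) with (- r * s * s * G * y * q) by (field; auto).
destruct k as [|m].
- simpl. field. intro E. apply H1. rewrite <- E. ring.
- rewrite (qpoch_S_l (- r * s * s * G * y)).
  replace (q ^ (2 * S m)) with (q * q ^ (2 * m + 1))
    by (rewrite <- Cpow_S; f_equal; lia).
  field. repeat split; try assumption.
Qed.

(** * The three members of the theorem as multiples of one lattice sum *)

Section Main.

Variables r s y G q : C.
Hypothesis Hr : r ^ 2 = q.
Hypothesis Hq0 : q <> 0.
Hypothesis Hq : (Cmod q < 1)%R.
Hypothesis Hs0 : s <> 0.
Hypothesis Hy0 : y <> 0.
Hypothesis HG0 : G <> 0.
Hypothesis Hz : (Cmod (G * y) < 1)%R.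
Hypothesis Hrsy : (Cmod (r * s * y) < 1)%R.
Hypothesis Hbeta : qpoch_inf (- s * G) q <> 0.
Hypothesis Hqs : qpoch_inf (- (q * s)) q <> 0.
Hypothesis Hkappa : qpoch_inf (q * q * s * s * y) q <> 0.
Hypothesis He : qpoch_inf (- q * r * s * s * G * y) q <> 0.
Hypothesis Hy : qpoch_inf y q <> 0.
Hypothesis Hyi : qpoch_inf (/ y) q <> 0.
Hypothesis Hby : qpoch_inf (- s * G * y) q <> 0.
Hypothesis Hqw : qpoch_inf (q * q * s * s * y * y) q <> 0.

Let P := qpoch_inf q q * qpoch_inf y q * qpoch_inf (q / y) q.

Lemma qpoch_inf_qdivy_neq_0 : qpoch_inf (q / y) q <> 0.
Proof.
rewrite (qpoch_inf_S_l q Hq (/ y)) in Hyi. apply Cmult_neq_0_inv in Hyi.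
destruct Hyi as [_ H]. now replace (/ y * q) with (q / y) in H by (field; exact Hy0).
Qed.

Lemma qpoch_inf_qmuly_neq_0 : qpoch_inf (q * y) q <> 0.
Proof.
rewrite (qpoch_inf_S_l q Hq y) in Hy. apply Cmult_neq_0_inv in Hy.
destruct Hy as [_ H]. now rewrite Cmult_comm in H.
Qed.

Lemma one_minus_w_neq_0 : 1 - q * s * s * y * y <> 0.
Proof.
assert (H := qpoch_inf_factor_neq_0 q Hq _ 0
  (qpoch_inf_neq_0_small q Hq _ (Cmod_w r s y q Hr Hrsy))).
now rewrite Cmult_1_r in H.
Qed.

Lemma phi_lattice1 :
  phi [q * s; r * s; - (r * s); G] [- s * G; q * q * s * s * y; q / y] q q
  = CSeries (lattice1 r s y G q)
    / (qpoch_inf q q * qpoch_inf (- s * G) q * qpoch_inf (q * q * s * s * y) q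
       * qpoch_inf (q / y) q).
Proof.
assert (Hqq := qpoch_inf_q_neq_0 q Hq). assert (Hqy := qpoch_inf_qdivy_neq_0).
match goal with |- _ = ?x / ?c =>
  replace (x / c) with (/ c * x) by (unfold Cdiv; ring) end.
rewrite <- CSeries_scal.
2:{ unfold lattice1. apply geo_bounded; [exact Hq|]. bdd. }
apply CSeries_ext. intro k. unfold qpochs, lattice1. cbn [fold_right].
rewrite (qpoch_inf_split q Hq q k), (qpoch_inf_split q Hq (- s * G) k),
  (qpoch_inf_split q Hq (q * q * s * s * y) k), (qpoch_inf_split q Hq (q / y) k).
field. repeat split; try (now apply qpoch_neq_0_of_inf); now apply qpoch_inf_tail_neq_0.
Qed.

(** The products stay on the side of the series: (r s, G;q)_oo may vanish and cannot be divided
    out. *)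
Lemma phi_lattice2 :
  qpoch_inf (q * s) q * qpoch_inf (r * s) q * qpoch_inf (- (r * s)) q * qpoch_inf G q
  * (qpoch_inf q q * qpoch_inf (q * y) q * qpoch_inf (- s * G * y) q
     * qpoch_inf (q * q * s * s * y * y) q)
  / (qpoch_inf (q * s * y) q * qpoch_inf (r * s * y) q * qpoch_inf (- (r * s) * y) q
       * qpoch_inf (G * y) q)
  * phi [G * y; - (r * s) * y; r * s * y; q * s * y]
        [q * q * s * s * y * y; q * y; - s * G * y] q q
  = CSeries (lattice2 r s y G q).
Proof.
assert (Hqq := qpoch_inf_q_neq_0 q Hq). assert (Hqy := qpoch_inf_qmuly_neq_0).
assert (N1 := qpoch_inf_z_neq_0 y G q Hq Hz).
assert (N2 := qpoch_inf_rsy_neq_0 r s y q Hq Hrsy).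
assert (N3 := qpoch_inf_nrsy_neq_0 r s y q Hq Hrsy).
assert (N4 := qpoch_inf_qsy_neq_0 r s y q Hr Hq Hrsy).
unfold phi. rewrite <- CSeries_scal.
- apply CSeries_ext. intro k. unfold qpochs, lattice2. cbn [fold_right].
  rewrite (qpoch_inf_split q Hq q k) at 1.
  rewrite (qpoch_inf_split q Hq (q * y) k), (qpoch_inf_split q Hq (- s * G * y) k),
    (qpoch_inf_split q Hq (q * q * s * s * y * y) k),
    (qpoch_inf_split q Hq (G * y) k), (qpoch_inf_split q Hq (r * s * y) k),
    (qpoch_inf_split q Hq (- (r * s) * y) k), (qpoch_inf_split q Hq (q * s * y) k).
  field. repeat split; try (now apply qpoch_neq_0_of_inf); now apply qpoch_inf_tail_neq_0.
- unfold qpochs. cbn [fold_right].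
  apply geo_ext with (fun k => q ^ k * (qpoch (G * y) q k * qpoch (- (r * s) * y) q k
    * qpoch (r * s * y) q k * qpoch (q * s * y) q k
    * (/ qpoch q q k * / qpoch (q * q * s * s * y * y) q k * / qpoch (q * y) q k
       * / qpoch (- s * G * y) q k))).
  + intro k. field. repeat split; now apply qpoch_neq_0_of_inf.
  + apply geo_bounded; [exact Hq|]. bdd; assumption.
Qed.

Lemma phi43_pair_lattice_sum :
  qpochs_inf [q * s * s * y * y; q * q * s * s * y] q
     / qpochs_inf [q * q * s * s * y * y; y] q
     * phi [q * s; r * s; - (r * s); G] [- s * G; q * q * s * s * y; q / y] q q
  + qpochs_inf [q * s * s; - (q * s) * y; G; - s * G * y] q
     / qpochs_inf [- s * G; - (q * s); G * y; / y] q
     * phi [G * y; - (r * s) * y; r * s * y; q * s * y]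
           [q * q * s * s * y * y; q * y; - s * G * y] q q
  = (1 - q * s * s * y * y) / (P * qpoch_inf (- s * G) q) * lattice_sum r s y G q.
Proof.
assert (Hqq := qpoch_inf_q_neq_0 q Hq). assert (Hqy := qpoch_inf_qmuly_neq_0).
assert (Hqy' := qpoch_inf_qdivy_neq_0).
assert (N1 := qpoch_inf_z_neq_0 y G q Hq Hz).
assert (N2 := qpoch_inf_rsy_neq_0 r s y q Hq Hrsy).
assert (N3 := qpoch_inf_nrsy_neq_0 r s y q Hq Hrsy).
assert (N4 := qpoch_inf_qsy_neq_0 r s y q Hr Hq Hrsy).
assert (Hw := one_minus_w_neq_0).
unfold lattice_sum. rewrite <- phi_lattice2, phi_lattice1.
set (F1 := CSeries (lattice1 r s y G q)).
set (F2 := phi [G * y; - (r * s) * y; r * s * y; q * s * y]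
           [q * q * s * s * y * y; q * y; - s * G * y] q q).
unfold qpochs_inf, P. cbn [fold_right].
rewrite (qpoch_inf_qss_factor r s q Hr Hq).
assert (Ew := qpoch_inf_w_factor r s y q Hr Hq).
rewrite (qpoch_inf_S_l q Hq (q * s * s * y * y)) in Ew |- *.
replace (q * s * s * y * y * q) with (q * q * s * s * y * y) in * by ring.
(* The doubling formula, solved for (- q s y;q)_oo, trades this numerator for the denominators (r s
   y, - r s y, q s y;q)_oo. *)
assert (E1 : qpoch_inf (- (q * s) * y) q = (1 - q * s * s * y * y)
   * qpoch_inf (q * q * s * s * y * y) q
   / (qpoch_inf (r * s * y) q * qpoch_inf (- (r * s) * y) q * qpoch_inf (q * s * y) q)).
{ rewrite Ew. field. auto. }
rewrite E1.
(* Splitting off the first factors explains the sign: 1 - 1/y = -(1 - y) / y yields the weight -y of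
   the second half. *)
assert (Hy1 := Hy). assert (Hyi1 := Hyi).
rewrite (qpoch_inf_S_l q Hq y) in Hy1 |- *. rewrite (qpoch_inf_S_l q Hq (/ y)) in Hyi1 |- *.
replace (y * q) with (q * y) in * by ring.
replace (/ y * q) with (q / y) in * by (field; exact Hy0).
apply Cmult_neq_0_inv in Hy1, Hyi1. destruct Hy1 as [Hy1 _]. destruct Hyi1 as [Hyi1 _].
assert (Hyi2 : y - 1 <> 0).
{ intro E. apply Hy1. replace (1 - y) with (- (y - 1)) by ring. rewrite E. ring. }
field. repeat split; assumption.
Qed.

Lemma phi32_lattice_sum :
  (forall k, qpoch s q k <> 0) ->
  phi [s * s; - q * s / G; q * s] [- s * G; s] q (G * y)
  = (1 - q * s * s * y * y) / (P * qpoch_inf (- s * G) q) * lattice_sum r s y G q.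
Proof.
intro Hs.
rewrite phi_wp; auto using qpoch_q_neq_0, qpoch_neq_0_of_inf.
assert (H := lattice_sum_L r s y G q Hr Hq0 Hq Hy0 HG0 Hz Hrsy Hbeta Hqs).
assert (Hqq := qpoch_inf_q_neq_0 q Hq). assert (Hqy' := qpoch_inf_qdivy_neq_0).
transitivity (/ (P * qpoch_inf (- s * G) q) * (lattice_sum r s y G q * (1 - q * s * s * y * y))).
- rewrite H. unfold P. field. repeat split; assumption.
- field. unfold P. repeat split; repeat apply Cmult_neq_0; assumption.
Qed.

Lemma W87_lattice_sum :
  W87_denominators_nonzero (- r * s * s * G * y)
    (q * s) (- (r * s)) (- G / r) G (q * r * s * y) q ->
  qpochs_inf [q * s * s * y * y; q * s * (G * y); - r * s * (G * y);
        - q * r * s * s * y; q * q * s * s * y] q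
     / qpochs_inf [q * q * s * s * y * y; G * y; - (r * s) * y; q * s * y;
         - q * r * s * s * G * y] q
     * W87 (- r * s * s * G * y) (q * s) (- (r * s)) (- G / r) G (q * r * s * y) q (r * s * y)
  = (1 - q * s * s * y * y) / (P * qpoch_inf (- s * G) q) * lattice_sum r s y G q.
Proof.
intro HW.
destruct (W87_wp r s y G q Hr Hq0 Hs0 Hy0 HG0 HW) as (E & D1 & D2 & D3). rewrite E. clear E.
assert (H := lattice_sum_R r s y G q Hr Hq0 Hq Hy0 Hz Hrsy Hbeta Hkappa He Hy Hyi).
assert (Hqq := qpoch_inf_q_neq_0 q Hq). assert (Hqy' := qpoch_inf_qdivy_neq_0).
assert (N1 := qpoch_inf_z_neq_0 y G q Hq Hz).
assert (N3 := qpoch_inf_nrsy_neq_0 r s y q Hq Hrsy).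
assert (N4 := qpoch_inf_qsy_neq_0 r s y q Hr Hq Hrsy).
assert (I1 := qpoch_inf_neq_0_of_all q Hq _ D1).
assert (I2 := qpoch_inf_neq_0_of_all q Hq _ D2).
assert (I3 := qpoch_inf_neq_0_of_all q Hq _ D3).
set (c := qpoch_inf (- q * r * s * s * y) q * qpoch_inf (q * s * (G * y)) q
          * qpoch_inf (- r * s * (G * y)) q).
assert (ES : c * CSeries (fun k => wp_coef (- G / r) (q * r * s * y) (r * s) q k * (r * s * y) ^ k
      * (qpoch (q * s) q k * qpoch (- (r * s)) q k * qpoch G q k
         / (qpoch (- r * s * (G * y)) q k * qpoch (q * s * (G * y)) q k
            * qpoch (- q * r * s * s * y) q k)))
  = CSeries (fun k => wp_coef (- G / r) (q * r * s * y) (r * s) q k * (r * s * y) ^ k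
        * (qpoch (q * s) q k * qpoch (- (r * s)) q k * qpoch G q k
           * (qpoch_inf (- q * r * s * s * y * q ^ k) q * qpoch_inf (q * s * (G * y) * q ^ k) q
              * qpoch_inf (- r * s * (G * y) * q ^ k) q)))).
{ assert (Hb' : qpoch_inf (- G / r * (r * s)) q <> 0) by (now rewrite (bR_mul_rs r s G q Hr Hq0)).
  assert (Hc' : qpoch_inf (q * r * s * y * (r * s)) q <> 0) by (now rewrite (cR_mul_rs r s y q Hr)).
  rewrite <- CSeries_scal.
  - apply CSeries_ext. intro k. unfold c.
    rewrite (qpoch_inf_split q Hq (- q * r * s * s * y) k),
      (qpoch_inf_split q Hq (q * s * (G * y)) k), (qpoch_inf_split q Hq (- r * s * (G * y)) k).
    field. auto.
  - apply geo_ext with (fun k => (r * s * y) ^ k * (wp_coef (- G / r) (q * r * s * y) (r * s) q k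
      * (qpoch (q * s) q k * qpoch (- (r * s)) q k * qpoch G q k
         * (/ qpoch (- r * s * (G * y)) q k * / qpoch (q * s * (G * y)) q k
            * / qpoch (- q * r * s * s * y) q k)))).
    + intro k. field. auto.
    + apply geo_bounded; [exact Hrsy|]. apply bounded_mult; [|bdd; assumption].
      now apply (bounded_wp_coef (- G / r) (q * r * s * y) (r * s) q Hq Hc' Hb' (fun k => k)). }
rewrite <- ES in H. clear ES.
match type of H with _ = _ * _ * _ * (c * ?X) => set (S := X) in * end.
unfold qpochs_inf. cbn [fold_right].
assert (Hw := one_minus_w_neq_0).
rewrite (qpoch_inf_S_l q Hq (q * s * s * y * y)).
replace (q * s * s * y * y * q) with (q * q * s * s * y * y) by ring.
fold P in H.
assert (HP : P <> 0) by (unfold P; repeat apply Cmult_neq_0; assumption).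
transitivity ((1 - q * s * s * y * y) / (P * qpoch_inf (- s * G) q)
  / (qpoch_inf (- q * r * s * s * G * y) q *
      (qpoch_inf (q * s * y) q * qpoch_inf (- (r * s) * y) q * qpoch_inf (G * y) q))
  * (qpoch_inf (q * q * s * s * y) q * qpoch_inf (- s * G) q * P * (c * S))).
- unfold c. field. repeat split; assumption.
- rewrite <- H. field. repeat split; assumption.
Qed.

End Main.

(** * The theorem in the original parameters *)

Theorem theorem3p9 (q a b z sq sa sb : C)
  (hq0 : 0 < Cmod q) (hq1 : Cmod q < 1)
  (ha0 : a <> 0%C) (hb0 : b <> 0%C) (hz0 : z <> 0%C)
  (ha1 : Cmod a < 1) (hz1 : Cmod z < 1)
  (* sq, sa, sb are the fixed square roots of q, a, b *)
  (hsq : (sq ^ 2)%C = q) (hsa : (sa ^ 2)%C = a) (hsb : (sb ^ 2)%C = b)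
  (* no denominator vanishes *)
  (hd1 : phi_denominators_nonzero [sq * b; sa * sb] q)
  (hd2 : qpochs_inf [q * a ^ 2 * z ^ 2; - (sa / (sq * sb)) * z] q <> 0%C)
  (hd3 : phi_denominators_nonzero
           [sq * b; - (q * sq * a * sa * sb) * z; - (q * sq * sb / sa) / z] q)
  (hd4 : qpochs_inf
           [sq * b; - (q * (sa * sb)); z; - (sq * sb / sa) / z] q <> 0%C)
  (hd5 : phi_denominators_nonzero
           [q * a ^ 2 * z ^ 2; - (sq * sa / sb) * z; - (sa * sb) * z] q)
  (hd6 : qpochs_inf
           [q * a ^ 2 * z ^ 2; z; a * z; - sq * a * z;
            - (q * sq) * a * b * z] q <> 0%C)
  (hd7 : W87_denominators_nonzero
           (- sq * a * b * z)
           (q * (sa * sb)) (- (sq * sa * sb)) (sb / sa) (- (sq * sb / sa))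
           (- q * a * z) q) :
  phi [a * b; sq * a; q * (sa * sb)] [sq * b; sa * sb] q z
  = (qpochs_inf [a ^ 2 * z ^ 2; - (q * sq * a * sa * sb) * z] q
     / qpochs_inf [q * a ^ 2 * z ^ 2; - (sa / (sq * sb)) * z] q
     * phi [q * (sa * sb); sq * sa * sb; - (sq * sa * sb); - (sq * sb / sa)]
           [sq * b; - (q * sq * a * sa * sb) * z; - (q * sq * sb / sa) / z]
           q q
     + qpochs_inf
         [q * a * b; sq * a * z; - (sq * sb / sa); - (sa * sb) * z] q
       / qpochs_inf
           [sq * b; - (q * (sa * sb)); z; - (sq * sb / sa) / z] q
       * phi [z; a * z; - a * z; - sq * a * z]
             [q * a ^ 2 * z ^ 2; - (sq * sa / sb) * z; - (sa * sb) * z]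
             q q)%C
  /\
  (qpochs_inf [a ^ 2 * z ^ 2; - (q * sq * a * sa * sb) * z] q
     / qpochs_inf [q * a ^ 2 * z ^ 2; - (sa / (sq * sb)) * z] q
     * phi [q * (sa * sb); sq * sa * sb; - (sq * sa * sb); - (sq * sb / sa)]
           [sq * b; - (q * sq * a * sa * sb) * z; - (q * sq * sb / sa) / z]
           q q
     + qpochs_inf
         [q * a * b; sq * a * z; - (sq * sb / sa); - (sa * sb) * z] q
       / qpochs_inf
           [sq * b; - (q * (sa * sb)); z; - (sq * sb / sa) / z] q
       * phi [z; a * z; - a * z; - sq * a * z]
             [q * a ^ 2 * z ^ 2; - (sq * sa / sb) * z; - (sa * sb) * z]
             q q)%C
  = (qpochs_inf
       [a ^ 2 * z ^ 2; q * (sa * sb) * z; - (sq * sa * sb) * z;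
        q * (a * sa * sb) * z; - (q * sq * a * sa * sb) * z] q
     / qpochs_inf
         [q * a ^ 2 * z ^ 2; z; a * z; - sq * a * z;
          - (q * sq) * a * b * z] q
     * W87 (- sq * a * b * z)
           (q * (sa * sb)) (- (sq * sa * sb)) (sb / sa) (- (sq * sb / sa))
           (- q * a * z) q (- a * z))%C.
Proof.
assert (Hq0 : q <> 0) by now apply Cmod_gt_0.
assert (Hsq0 : sq <> 0) by (intro E; apply Hq0; rewrite <- hsq, E; ring).
assert (Hsa0 : sa <> 0) by (intro E; apply ha0; rewrite <- hsa, E; ring).
assert (Hsb0 : sb <> 0) by (intro E; apply hb0; rewrite <- hsb, E; ring).
set (s := sa * sb) in *.
set (y := - (sa / (sq * sb)) * z) in *.
set (G := - (sq * sb / sa)) in *.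
assert (Hs0 : s <> 0) by now apply Cmult_neq_0.
assert (Hy0 : y <> 0).
{ intro E. apply hz0. replace z with (- (sq * sb / sa) * y) by (unfold y; field; auto).
  rewrite E. ring. }
assert (HG0 : G <> 0).
{ intro E. apply Hsq0. replace sq with (- G * sa / sb) by (unfold G; field; auto).
  rewrite E. field. auto. }
assert (Ez : z = G * y) by (unfold G, y; field; auto).
assert (Haz : (Cmod (sq * s * y) < 1)%R).
{ replace (sq * s * y) with (- (a * z)) by (unfold s, y; rewrite <- hsa; field; auto).
  rewrite Cmod_opp, Cmod_mult. assert (H1 := Cmod_ge_0 a). assert (H2 := Cmod_ge_0 z). nra. }
assert (E1 : a * b = s * s)
  by (unfold s, y, G; rewrite <- ?hsq, <- ?hsa, <- ?hsb; field; auto).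
assert (E2 : sq * a * z = - (q * s) * y)
  by (unfold s, y, G; rewrite <- ?hsq, <- ?hsa, <- ?hsb; field; auto).
assert (E3 : sq * a = - q * s / G)
  by (unfold s, y, G; rewrite <- ?hsq, <- ?hsa, <- ?hsb; field; auto).
assert (E4 : sq * b = - s * G)
  by (unfold s, y, G; rewrite <- ?hsq, <- ?hsa, <- ?hsb; field; auto).
assert (E5 : - (sq * sa * sb) * z = - sq * s * (G * y))
  by (unfold s, y, G; rewrite <- ?hsq, <- ?hsa, <- ?hsb; field; auto).
assert (E6 : sq * sa * sb = sq * s)
  by (unfold s, y, G; rewrite <- ?hsq, <- ?hsa, <- ?hsb; field; auto).
assert (E7 : a ^ 2 * z ^ 2 = q * s * s * y * y)
  by (unfold s, y, G; rewrite <- ?hsq, <- ?hsa, <- ?hsb; field; auto).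
assert (E8 : q * a ^ 2 * z ^ 2 = q * q * s * s * y * y)
  by (unfold s, y, G; rewrite <- ?hsq, <- ?hsa, <- ?hsb; field; auto).
assert (E9 : - (q * sq * a * sa * sb) * z = q * q * s * s * y)
  by (unfold s, y, G; rewrite <- ?hsq, <- ?hsa, <- ?hsb; field; auto).
assert (E10 : - (q * sq * sb / sa) / z = q / y)
  by (unfold s, y, G; rewrite <- ?hsq, <- ?hsa, <- ?hsb; field; auto).
assert (E11 : q * a * b = q * s * s)
  by (unfold s, y, G; rewrite <- ?hsq, <- ?hsa, <- ?hsb; field; auto).
assert (E12 : - s * z = - s * G * y)
  by (unfold s, y, G; rewrite <- ?hsq, <- ?hsa, <- ?hsb; field; auto).
assert (E13 : G / z = / y)
  by (unfold s, y, G; rewrite <- ?hsq, <- ?hsa, <- ?hsb; field; auto).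
assert (E14 : a * z = - (sq * s) * y)
  by (unfold s, y, G; rewrite <- ?hsq, <- ?hsa, <- ?hsb; field; auto).
assert (E15 : - a * z = sq * s * y)
  by (unfold s, y, G; rewrite <- ?hsq, <- ?hsa, <- ?hsb; field; auto).
assert (E16 : - sq * a * z = q * s * y)
  by (unfold s, y, G; rewrite <- ?hsq, <- ?hsa, <- ?hsb; field; auto).
assert (E17 : - (sq * sa / sb) * z = q * y)
  by (unfold s, y, G; rewrite <- ?hsq, <- ?hsa, <- ?hsb; field; auto).
assert (E18 : q * s * z = q * s * (G * y))
  by (unfold s, y, G; rewrite <- ?hsq, <- ?hsa, <- ?hsb; field; auto).
assert (E19 : q * (a * sa * sb) * z = - q * sq * s * s * y)
  by (unfold s, y, G; rewrite <- ?hsq, <- ?hsa, <- ?hsb; field; auto).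
assert (E20 : - (q * sq) * a * b * z = - q * sq * s * s * G * y)
  by (unfold s, y, G; rewrite <- ?hsq, <- ?hsa, <- ?hsb; field; auto).
assert (E21 : - sq * a * b * z = - sq * s * s * G * y)
  by (unfold s, y, G; rewrite <- ?hsq, <- ?hsa, <- ?hsb; field; auto).
assert (E22 : sb / sa = - G / sq)
  by (unfold s, y, G; rewrite <- ?hsq, <- ?hsa, <- ?hsb; field; auto).
assert (E23 : - q * a * z = q * sq * s * y)
  by (unfold s, y, G; rewrite <- ?hsq, <- ?hsa, <- ?hsb; field; auto).
clearbody s y G.
(* Longer products are rewritten before those they contain: [sq * a * z] before [sq * a], and [E5]
   before [E6]. With the bodies of [s], [y], [G] cleared, these equations and [Ez] carry the whole
   translation. *)
let rw E := (try rewrite E in hd1; try rewrite E in hd2; try rewrite E in hd3; try rewrite E in hd4;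
  try rewrite E in hd5; try rewrite E in hd6; try rewrite E in hd7; rewrite E) in
rw E1; rw E2; rw E3; rw E4; rw E5; rw E6; rw E7; rw E8;
rw E9; rw E10; rw E11; rw E12; rw E13; rw E14; rw E15; rw E16;
 rw E17; rw E18; rw E19; rw E20; rw E21; rw E22; rw E23.
clear E1 E2 E3 E4 E5 E6 E7 E8 E9 E10 E11 E12 E13 E14 E15 E16 E17 E18 E19 E20 E21 E22 E23.
rewrite !Ez in *.
unfold phi_denominators_nonzero, qpochs, qpochs_inf in hd1, hd2, hd3, hd4, hd6.
cbn [fold_right] in hd1, hd2, hd3, hd4, hd6.
assert (Hs : forall k, qpoch s q k <> 0).
{ intros k E. apply (hd1 k). rewrite E. ring. }
assert (Hkappa : qpoch_inf (q * q * s * s * y) q <> 0).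
{ apply qpoch_inf_neq_0_of_all; [exact hq1|]. intros k E. apply (hd3 k). rewrite E. ring. }
assert (Hby : qpoch_inf (- s * G * y) q <> 0).
{ apply qpoch_inf_neq_0_of_all; [exact hq1|]. intros k E. apply (hd5 k).
  unfold qpochs. cbn [fold_right]. rewrite E. ring. }
apply Cmult_neq_0_inv in hd2. destruct hd2 as [Hqw hd2].
apply Cmult_neq_0_inv in hd2. destruct hd2 as [Hy _].
apply Cmult_neq_0_inv in hd4. destruct hd4 as [Hbeta hd4].
apply Cmult_neq_0_inv in hd4. destruct hd4 as [Hqs hd4].
apply Cmult_neq_0_inv in hd4. destruct hd4 as [_ hd4].
apply Cmult_neq_0_inv in hd4. destruct hd4 as [Hyi _].
assert (He : qpoch_inf (- q * sq * s * s * G * y) q <> 0).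
{ intro E. apply hd6. rewrite E. ring. }
rewrite phi43_pair_lattice_sum by assumption. split.
- now apply phi32_lattice_sum.
- symmetry. now apply W87_lattice_sum.
Qed.
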